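(* Let $\mathbb{F}$ be a field and let $\Delta$ be a $d$-dimensional normal pseudomanifold with nonempty boundary, with $d\ge3$. Then \[ g_2(\Delta,\partial\Delta)\ge\binom{d+2}{2}\big(\mu_1(\Delta,\partial\Delta;\mathbb{F})-\mu_0(\Delta,\partial\Delta;\mathbb{F})\big). \] Furthermore, equality holds if and only if for every boundary vertex $v$, $\binom{d+2}{2}\tilde\sigma_0\big(\mathrm{lk}_\Delta(v),\partial\,\mathrm{lk}_\Delta(v)\big)=\frac12 f_0\big(\mathrm{lk}_\Delta(v),\partial\,\mathrm{lk}_\Delta(v)\big)$, and for every interior vertex $v$, the link of $v$ is a stacked sphere.
   Context: Simplicial complexes are families of subsets of a finite ground set closed under subsets. For $\Gamma\subseteq\Delta$, $(\Delta,\Gamma)$ consists of the faces of $\Delta$ not in $\Gamma$; $f_i$ counts its faces of cardinality $i+1$ ($i\ge-1$); if $\dim(\Delta,\Gamma)=D-1$, $h_j=\sum_{i=0}^j(-1)^{j-i}\binom{D-i}{D-j}f_{i-1}$, $g_0=h_0$, $g_j=h_j-h_{j-1}$. $\Delta_W=\{F\in\Delta:F\subseteq W\}$; $\mathrm{lk}_\Delta(G)=\{H\in\Delta:H\cup G\in\Delta,H\cap G=\emptyset\}$ (empty if $G\notin\Delta$). $\tilde b_i(\Delta,\Gamma;\mathbb{F})$ is the dimension of the $i$-th homology of $C_\bullet(\Delta)/C_\bullet(\Gamma)$, $C_k(\Delta)$ ($k\ge-1$) having basis the faces of cardinality $k+1$ ($C_{-1}(\Delta)=\mathbb{F}$ if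 $\Delta\ne\emptyset$, else $0$). $\tilde\sigma_i(\Delta,\Gamma)=\frac{1}{|V|+1}\sum_{W\subseteq V}\binom{|V|}{|W|}^{-1}\tilde b_i(\Delta_W,\Gamma_W)$ with $V$ any finite set containing the vertices of $\Delta$ (independent of choice); $\mu_i(\Delta,\Gamma;\mathbb{F})=\sum_{v\in V(\Delta)}\tilde\sigma_{i-1}(\mathrm{lk}_\Delta(v),\mathrm{lk}_\Gamma(v))$ for $i\ge0$. A $d$-dimensional complex is a normal pseudomanifold if it is pure, every $(d-1)$-face (ridge) lies in at most two facets, and the link of every nonempty face of dimension $\le d-2$ is connected; it has boundary if some ridge is in exactly one facet, and the boundary $\partial\Delta$ is the pure $(d-1)$-dimensional complex whose facets are those ridges. Interior vertices: vertices $v$ with $\{v\}\notin\partial\Delta$; boundary vertices: $\{v\}\in\partial\Delta$. For a boundary vertex, $\partial\,\mathrm{lk}_\Delta(v)$ denotes the boundary of the normal pseudomanifold with boundary $\mathrm{lk}_\Delta(v)$. A stacked sphere is a connected sum of boundary complexes of simplices of equal dimension, where the connected sum of two pure equidimensional complexes on disjoint vertex sets identifies a facet of one with a facet of the other via a bijection of vertices and then removes the identified facet. *)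

(* Defs.v *)
From HB Require Import structures.
From mathcomp Require Import all_boot all_order all_algebra.

Set Implicit Arguments.
Unset Strict Implicit.
Unset Printing Implicit Defensive.

Import Order.TTheory GRing.Theory Num.Theory.
Local Open Scope ring_scope.

(* A family of faces is a set of subsets of a finite ground type T.  The empty
   family and the family {set0} are distinct, and the vertices of a complex
   need not exhaust T. *)
Section Complexes.

Variable T : finType.
Implicit Types (D G S : {set {set T}}) (A B R W : {set T}).

Definition simplicial_complex D : Prop :=
  forall A B, A \in D -> B \subset A -> B \in D.

Definition vertices D : {set T} := [set v | [set v] \in D].

(* The relative complex (D, G), as the set of its faces. *)
Definition rel_faces D G : {set {set T}} := D :\: G.

(* One more than the dimension. *)
Definition rank S : nat := \max_(A in S) #|A|.

Definition facet D A : bool := maxset (fun B => B \in D) A.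

Definition pure D : Prop := forall A, facet D A -> #|A| = rank D.

Definition induced D W : {set {set T}} := [set A in D | A \subset W].

Definition link D A : {set {set T}} :=
  [set B in D | (B :|: A \in D) && [disjoint B & A]].

Definition connected_complex D : Prop :=
  {in vertices D &, forall u v, connect [rel x y | [set x; y] \in D] u v}.

Definition ridge D R : bool := (R \in D) && (#|R|.+1 == rank D).

Definition facets_over D R : {set {set T}} :=
  [set A : {set T} | facet D A && (R \subset A)].

Definition normal_pseudomanifold (d : nat) D : Prop :=
  [/\ simplicial_complex D,
      rank D = d.+1,
      pure D,
      forall R, ridge D R -> (#|facets_over D R| <= 2)%N
    & (* dim A <= d - 2 means #|A| < d *)
      forall A, A \in D -> A != set0 -> (#|A| < d)%N ->
        connected_complex (link D A)].

Definition boundary D : {set {set T}} :=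
  [set A : {set T} | [exists R : {set T},
     [&& ridge D R, #|facets_over D R| == 1%N & A \subset R]]].

(* Dimensions of faces are integers >= -1, so the indices of f, of chain
   groups and of homology are of type int. *)
Definition f_num D G (i : int) : nat :=
  #|[set A in rel_faces D G | #|A|%:Z == i + 1]|.

(* Meaningful for j at most rank (rel_faces D G): the subtractions below are on
   nat. *)
Definition h_num D G (j : nat) : int :=
  let r := rank (rel_faces D G) in
  \sum_(i < j.+1)
     (-1) ^+ (j - i) * 'C(r - i, r - j)%:Z * (f_num D G (i%:Z - 1))%:Z.

Definition g_num D G (j : nat) : int :=
  if j is j'.+1 then h_num D G j - h_num D G j' else h_num D G 0.

Section Homology.

Variable F : fieldType.

(* Chains on the full simplex on T, including the empty face. *)
Definition chain := {ffun {set T} -> F^o}.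

Definition face_chain A : chain := [ffun B => (B == A)%:R].

(* Faces are oriented by the enumeration order of T. *)
Definition face_sign A (x : T) : F :=
  (-1) ^+ #|[set y in A | (enum_rank y < enum_rank x)%N]|.

Definition bd_fun (c : chain) : chain :=
  \sum_(A : {set T}) c A *: \sum_(x in A) face_sign A x *: face_chain (A :\ x).

Lemma bd_fun_is_linear : linear bd_fun.
Proof.
move=> a u v; rewrite /bd_fun scaler_sumr -big_split /=; apply: eq_bigr => A _.
by rewrite !ffunE scalerDl scalerA.
Qed.

HB.instance Definition _ :=
  GRing.isLinear.Build F chain chain *:%R bd_fun bd_fun_is_linear.

Definition bd : 'End(chain) := linfun bd_fun.

Definition chains (k : int) D : {vspace chain} :=
  <<[seq face_chain A | A <- enum D & (#|A|%:Z == k + 1)%R]>>%VS.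

(* The kernel and the image of the differentials of C(D) / C(G) in degree k,
   pulled back to C_k(D); both contain C_k(G), so the k-th homology of
   C(D) / C(G) is the quotient of the first by the second. *)
Definition rel_cycles (k : int) D G : {vspace chain} :=
  (chains k D :&: bd @^-1: chains (k - 1)%R G)%VS.

Definition rel_boundaries (k : int) D G : {vspace chain} :=
  (bd @: chains (k + 1)%R D + chains k G)%VS.

Definition betti (k : int) D G : nat :=
  (\dim (rel_cycles k D G) - \dim (rel_boundaries k D G))%N.

(* The value does not depend on the finite set containing the vertices of D
   over which the sum is taken; the set of vertices itself is used. *)
Definition sigma (i : int) D G : rat :=
  let V := vertices D in
  (#|V|.+1)%:R^-1 *
  \sum_(W in powerset V)
     'C(#|V|, #|W|)%:R^-1 * (betti i (induced D W) (induced G W))%:R.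

Definition mu (i : nat) D G : rat :=
  \sum_(v in vertices D) sigma (i%:Z - 1) (link D [set v]) (link G [set v]).

End Homology.

End Complexes.

Definition simplex_boundary (T : finType) (A : {set T}) : {set {set T}} :=
  [set B : {set T} | B \proper A].

Definition image_complex (T T' : finType) (f : T -> T') (D : {set {set T}}) :
    {set {set T'}} :=
  [set f @: A | A : {set T} in D].

Section ConnectedSum.

Variables (T1 T2 : finType).

(* Inside the disjoint union of the ground sets, every x in A is replaced by
   phi x. *)
Definition glue (A : {set T1}) (phi : T1 -> T2) (x : T1) : T1 + T2 :=
  if x \in A then inr (phi x) else inl x.

Definition connected_sum (D1 : {set {set T1}}) (D2 : {set {set T2}})
    (A : {set T1}) (phi : T1 -> T2) : {set {set (T1 + T2)%type}} :=
  (image_complex (glue A phi) D1 :|: image_complex inr D2) :\ (glue A phi @: A).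

End ConnectedSum.

(* Stacked spheres of dimension k, up to isomorphism: the boundary of a
   (k + 1)-simplex has k + 2 vertices. *)
Inductive stacked_sphere_dim (k : nat) :
    forall T : finType, {set {set T}} -> Prop :=
| StackedSimplex (T : finType) (A : {set T}) :
    #|A| = k.+2 -> stacked_sphere_dim k (simplex_boundary A)
| StackedSum (T1 T2 : finType) (D1 : {set {set T1}}) (D2 : {set {set T2}})
    (A : {set T1}) (phi : T1 -> T2) :
    stacked_sphere_dim k D1 -> stacked_sphere_dim k D2 ->
    facet D1 A -> {in A &, injective phi} -> facet D2 (phi @: A) ->
    stacked_sphere_dim k (connected_sum D1 D2 A phi)
| StackedIso (T T' : finType) (D : {set {set T}}) (f : T -> T') :
    stacked_sphere_dim k D -> {in vertices D &, injective f} ->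
    stacked_sphere_dim k (image_complex f D).

Definition stacked_sphere (T : finType) (D : {set {set T}}) : Prop :=
  exists k : nat, stacked_sphere_dim k D.

Arguments betti {T} F k D G.
Arguments sigma {T} F i D G.
Arguments mu {T} F i D G.

(* Main.v *)
Require Import Defs.
From HB Require Import structures.
From mathcomp Require Import all_boot all_order all_algebra zify ring lra.

(* The expected number of components of the graph induced on a random vertex set
   W of a link, each vertex being kept with the same uniformly random
   probability, is sigma_0 - sigma_(-1) of that link, up to an additive 1.  For a
   boundary vertex v the cone with apex v over the boundary of the link is added
   and W is required to contain v, which discards the components of W meeting the
   boundary of the link.

   In both cases the facets form an inclusion-minimal cycle modulo 2, of
   dimension d - 1 >= 2, and along such a cycle the expectation grows by at most
   1 / ((d + 1) (d + 2)) for each vertex outside a given facet.  This is proved by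
   contracting an edge uv of the cycle: inclusion-exclusion for the components
   adjacent to u and v controls the change of the expectation, because u and v
   have at least d - 1 common neighbours, while the image of the cycle under the
   contraction is again a cycle modulo 2, whose minimal subcycles lift to pieces
   of the original one.  In the case of equality the contractions can be undone
   within chordal graphs; a simplicial vertex of the cycle then has degree d, and
   removing it exhibits the link as a stacked sphere.

   The theorem is the sum over all vertices v of these local inequalities,
   compared with f_1 by counting pairs of a vertex and an edge containing it. *)

Set Implicit Arguments.
Unset Strict Implicit.
Unset Printing Implicit Defensive.

Import Order.TTheory GRing.Theory Num.Theory.

(** * Connected components of induced subgraphs *)

(** Contracting an edge can destroy the pseudomanifold property, and the image of a minimal cycle
    need not be minimal; cycles modulo 2 survive, at the price of being decomposed again after each
    contraction. The growth bound is therefore relative to a set [U] of vertices already reached, so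
    that the pieces of a cycle can be attached one after another, and it concerns a graph that may
    have more edges than the cells show, since cells can cancel under a contraction while their
    edges stay. The constant comes from the contraction formula: if vertices are kept with
    probability [p], the expectation changes by the mean of [p (1 - p)] times 1 minus the number of
    components adjacent to both ends. That factor is positive only if every common neighbour is
    omitted, which has probability at most [(1 - p) ^ (d - 1)], and the integral of [p (1 - p) ^ d]
    is [1 / ((d + 1) (d + 2))]. Multiplied by the binomial coefficient of the theorem it becomes
    1/2, the share of an edge that falls to each of its ends. *)

Lemma disjointsU_eq (T : finType) (X Y N : {set T}) :
  [disjoint X :|: Y & N] = [disjoint X & N] && [disjoint Y & N].
Proof. by rewrite -!setI_eq0 setIUl setU_eq0. Qed.

Lemma meetP (T : finType) (A B : {set T}) :
  reflect (exists2 x, x \in A & x \in B) (~~ [disjoint A & B]).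
Proof.
rewrite -setI_eq0; apply: (iffP (set0Pn _)) => [[x /setIP[]]|[x xA xB]].
  by exists x.
by exists x; rewrite inE xA.
Qed.

Section Components.

Variables (T : finType) (e : rel T).
Implicit Types (W X K N : {set T}) (x y u v : T).

Definition within W : rel T := [rel x y | [&& x \in W, y \in W & e x y]].

(** Holds of the empty set; nonemptiness is required separately where it matters. *)
Definition conn K : Prop := {in K &, forall x y, connect (within K) x y}.

Definition component W x : {set T} := [set y in W | connect (within W) x y].

Definition comps W : {set {set T}} := [set component W x | x in W].

Definition nbr u : {set T} := [set y | e u y].

Lemma connect_withinS W X x y :
  W \subset X -> connect (within W) x y -> connect (within X) x y.
Proof.
move=> /subsetP WX; apply: connect_sub => {x y} x y /= /and3P[xW yW exy].
by apply: connect1; rewrite /within /= !WX.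
Qed.

Lemma connect_within_closed W K x y :
    (forall a b, a \in K -> b \in W -> e a b -> b \in K) ->
  x \in K -> connect (within W) x y -> connect (within K) x y /\ y \in K.
Proof.
move=> clK xK /connectP[p]; elim: p x xK => [|z p IH] x xK /=.
  by move=> _ ->; rewrite connect0.
move=> /andP[/and3P[xW zW exz] zp] yE.
have zK := clK _ _ xK zW exz.
have [czy yK] := IH _ zK zp yE; split=> //.
by apply: connect_trans czy; apply: connect1; rewrite /within /= xK zK.
Qed.

Hypothesis e_sym : symmetric e.

Lemma connect_within_sym W : connect_sym (within W).
Proof.
by apply: sym_connect_sym => x y; rewrite /within /= e_sym andbCA.
Qed.

Lemma compsP W K :
  reflect [/\ K != set0, K \subset W, conn K
             & forall a b, a \in K -> b \in W -> e a b -> b \in K]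
          (K \in comps W).
Proof.
apply: (iffP imsetP) => [[x xW ->]|[/set0Pn[x xK] KW Kconn clK]].
  have xx : x \in component W x by rewrite inE xW connect0.
  have clx a b : a \in component W x -> b \in W -> e a b -> b \in component W x.
    rewrite !inE => /andP[aW ca] bW eab; rewrite bW (connect_trans ca) //.
    by apply: connect1; rewrite /within /= aW bW.
  split=> //; first by apply/set0Pn; exists x.
    by apply/subsetP=> y; rewrite inE => /andP[].
  have cx y : y \in component W x -> connect (within (component W x)) x y.
    rewrite inE => /andP[_ cxy].
    by have [] := connect_within_closed clx xx cxy.
  move=> y z /cx cy /cx; apply: connect_trans.
  by rewrite connect_within_sym.
exists x; first exact: (subsetP KW).
apply/setP=> y; rewrite inE; apply/idP/andP => [yK|[yW cxy]].
  by split; [apply: (subsetP KW) | apply: connect_withinS (Kconn _ _ xK yK)].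
by have [] := connect_within_closed clK xK cxy.
Qed.

Lemma comps_eq W K K' x :
  K \in comps W -> K' \in comps W -> x \in K -> x \in K' -> K = K'.
Proof.
suff sub L L' : L \in comps W -> L' \in comps W -> x \in L -> x \in L' ->
    L \subset L'.
  by move=> Kc K'c xK xK'; apply/eqP; rewrite eqEsubset !sub.
move=> /compsP[_ LW Lc _] /compsP[_ _ _ clL'] xL xL'; apply/subsetP=> y yL.
have [|//] := @connect_within_closed W L' x y clL' xL'.
exact: connect_withinS (Lc _ _ xL yL).
Qed.

Lemma mem_comp W x : x \in W -> x \in component W x.
Proof. by move=> xW; rewrite inE xW connect0. Qed.

Lemma comp_comps W x : x \in W -> component W x \in comps W.
Proof. exact: imset_f. Qed.

Lemma conn_sub_comps W K x : K \subset W -> conn K -> x \in K ->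
  K \subset component W x.
Proof.
move=> KW Kc xK; apply/subsetP=> y yK; rewrite inE (subsetP KW) //=.
exact: connect_withinS (Kc _ _ xK yK).
Qed.

Lemma connU K L x y : conn K -> conn L -> x \in K -> y \in L ->
  (x == y) || e x y -> conn (K :|: L).
Proof.
move=> Kc Lc xK yL exy.
have cK a b : a \in K -> b \in K -> connect (within (K :|: L)) a b.
  by move=> aK bK; apply: connect_withinS (Kc _ _ aK bK); apply: subsetUl.
have cL a b : a \in L -> b \in L -> connect (within (K :|: L)) a b.
  by move=> aK bK; apply: connect_withinS (Lc _ _ aK bK); apply: subsetUr.
have cxy : connect (within (K :|: L)) x y.
  case/orP: exy => [/eqP->|exy]; first exact: connect0.
  by apply: connect1; rewrite /within /= !inE xK yL orbT.
have cx a : a \in K :|: L -> connect (within (K :|: L)) x a.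
  by case/setUP=> [aK|aL]; [apply: cK | apply: connect_trans cxy (cL _ _ yL aL)].
by move=> a b /cx ca /cx; apply: connect_trans; rewrite connect_within_sym.
Qed.

Lemma conn1 x : conn [set x].
Proof. by move=> a b /set1P-> /set1P->; apply: connect0. Qed.

Lemma conn_setU1 K x y : conn K -> y \in K -> e x y -> conn (x |: K).
Proof. by move=> Kc yK exy; apply: (connU (@conn1 x) Kc (set11 x) yK); rewrite exy orbT. Qed.

(** When [N] is the neighbourhood of a vertex outside [W], this counts the components that adding
    the vertex merges into one. *)
Definition kappa N W : nat := #|[set K in comps W | ~~ [disjoint K & N]]|.

Lemma card_comps_meet N W :
  #|comps W| = kappa N W + #|[set K in comps W | [disjoint K & N]]|.
Proof.
rewrite addnC -(cardsID [set K : {set T} | [disjoint K & N]] (comps W)); congr (_ + _).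
  by apply: eq_card => K; rewrite !inE.
by apply: eq_card => K; rewrite !inE andbC.
Qed.

(** The new vertex absorbs exactly the components that it touches; the others stay closed under
    adjacency. *)
Lemma comps_setU1 u W : u \notin W ->
  comps (u |: W) =
    component (u |: W) u |: [set K in comps W | [disjoint K & nbr u]].
Proof.
move=> uW; have uU : u \in u |: W by rewrite setU11.
apply/setP=> K; apply/idP/setU1P => [Kc|[->|]]; last 2 first.
- exact: comp_comps.
- rewrite inE => /andP[/compsP[K0 KW Kc clK] dK].
  apply/compsP; split=> //; first exact: subset_trans KW (subsetUr _ _).
  move=> a b aK /setU1P[->|]; last exact: clK.
  by rewrite e_sym => eua; have := disjointFr dK aK; rewrite inE eua.
case: (boolP (u \in K)) => [uK|uK].
  by left; apply: comps_eq Kc (comp_comps uU) uK (mem_comp uU).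
right; have /compsP[K0 KW Kc' clK] := Kc.
rewrite inE; apply/andP; split.
  apply/compsP; split=> //.
    apply/subsetP=> x xK; have /setU1P[xu|//] := subsetP KW _ xK.
    by rewrite -xu xK in uK.
  by move=> a b aK bW; apply: clK => //; rewrite setU1r.
apply/pred0P=> x /=; apply/negbTE/negP => /andP[xK]; rewrite inE => eux.
by case/negP: uK; apply: (clK x); rewrite // e_sym.
Qed.

Lemma card_comps_setU1 u W : u \notin W ->
  #|comps (u |: W)| + kappa (nbr u) W = #|comps W| + 1.
Proof.
move=> uW; rewrite comps_setU1 // cardsU1 (card_comps_meet (nbr u) W).
suff -> : component (u |: W) u \notin [set K in comps W | [disjoint K & nbr u]].
  by rewrite add1n addSn addn1 addnC.
rewrite inE; apply/negP => /andP[/compsP[_ /subsetP KW _ _] _].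
by case/negP: uW; apply: KW; rewrite mem_comp ?setU11.
Qed.

End Components.

Section MoreComponents.

Variable T : finType.
Implicit Types (e : rel T) (W X K N : {set T}) (x y u v : T).

(** Edges are compared between distinct vertices only, because loops do not affect connectivity. *)
Lemma connect_within_sub e e' W x y :
    {in W &, forall a b, a != b -> e a b -> e' a b} ->
  connect (within e W) x y -> connect (within e' W) x y.
Proof.
move=> sub; apply: connect_sub => {x y} x y /= /and3P[xW yW exy].
have [->|neq] := eqVneq x y; first exact: connect0.
by apply: connect1; rewrite /within /= xW yW sub.
Qed.

Lemma conn_sub e e' K :
  {in K &, forall a b, a != b -> e a b -> e' a b} -> conn e K -> conn e' K.
Proof. by move=> sub Kc x y xK yK; apply: connect_within_sub (Kc _ _ xK yK). Qed.

Lemma eq_comps e e' W :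
  {in W &, forall a b, a != b -> e a b = e' a b} -> comps e W = comps e' W.
Proof.
move=> eqe; suff E x : component e W x = component e' W x by apply: eq_imset.
apply/setP=> y; rewrite !inE; congr andb.
by apply/idP/idP; apply: connect_within_sub => a b aW bW nab; rewrite eqe.
Qed.

Lemma leq_card_comps e e' W : symmetric e' ->
    {in W &, forall a b, a != b -> e a b -> e' a b} ->
  #|comps e' W| <= #|comps e W|.
Proof.
move=> e'_sym sub.
(* All vertices of a component for [e] have the same component for [e']; [g] sends the former to the
   latter and reaches every component for [e']. *)
pose g (K : {set T}) := \bigcup_(x in K) component e' W x.
apply: leq_trans (leq_imset_card g (comps e W)).
apply/subset_leq_card/subsetP=> _ /imsetP[x xW ->].
apply/imsetP; exists (component e W x); first exact: comp_comps.
apply/setP=> y; apply/idP/bigcupP => [yx|[z]].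
  by exists x; rewrite ?mem_comp.
rewrite !inE => /andP[zW xz] /andP[yW zy]; rewrite yW /=.
by apply: connect_trans zy; apply: connect_within_sub xz.
Qed.

Lemma comps_conn e K : conn e K -> K != set0 -> comps e K = [set K].
Proof.
move=> Kc /set0Pn[x xK].
have E y : y \in K -> component e K y = K.
  move=> yK; apply/eqP; rewrite eqEsubset conn_sub_comps // andbT.
  by apply/subsetP=> z; rewrite inE => /andP[].
apply/setP=> L; rewrite inE; apply/imsetP/eqP => [[y yK ->]|->].
  exact: E.
by exists x => //; rewrite E.
Qed.

Lemma comps0 e : comps e set0 = set0.
Proof. exact: imset0. Qed.

Section Sym.

Variable e : rel T.
Hypothesis e_sym : symmetric e.

Lemma card_comps_pair x y : x != y -> ~~ e x y -> #|comps e [set x; y]| = 2.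
Proof.
move=> nxy nexy; have xy : x \notin [set y] by rewrite inE.
have := card_comps_setU1 e_sym xy.
have y0 : [set y] != set0 by apply/set0Pn; exists y; rewrite set11.
rewrite /kappa (comps_conn (@conn1 _ e y)) // cards1.
suff -> : [set K in [set [set y]] | ~~ [disjoint K & nbr e x]] = set0.
  by rewrite cards0 addn0.
apply/setP=> K; rewrite !inE; apply/negbTE/negP => /andP[/eqP-> /negP[]].
by rewrite disjoints1 inE.
Qed.

(** Each end of the edge [uv], added alone, merges these components; adding both ends merges them
    only once. They are the correction term of the inclusion-exclusion below. *)
Definition bridges u v X : nat :=
  #|[set K in comps e X | ~~ [disjoint K & nbr e u] & ~~ [disjoint K & nbr e v]]|.

Definition only u v X : nat :=
  #|[set K in comps e X | ~~ [disjoint K & nbr e u] & [disjoint K & nbr e v]]|.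

Lemma bridgesC u v X : bridges u v X = bridges v u X.
Proof. by apply: eq_card => K; rewrite !inE [X in _ && X]andbC. Qed.

Lemma kappa_split u v X : kappa e (nbr e u) X = bridges u v X + only u v X.
Proof.
rewrite /kappa -(cardsID [set K : {set T} | ~~ [disjoint K & nbr e v]]).
by congr (_ + _); apply: eq_card => K; rewrite !inE; case: (K \in _);
  case: (disjoint _ _); case: (disjoint _ _).
Qed.

(** * Component counts under the contraction of an edge *)

Section Contraction.

Variables (u v : T) (X : {set T}).
Hypotheses (uv : u != v) (uX : u \notin X) (vX : v \notin X) (euv : e u v).

(** Since [uv] is an edge, [v] touches the component of [u], which accounts for the successor; every
    other component of [u |: X] misses the neighbours of [u]. *)
Lemma kappa_nbr_setU1 :
  kappa e (nbr e v) (u |: X) = (only v u X).+1.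
Proof.
rewrite /kappa comps_setU1 // -add1n.
have nin : component e (u |: X) u \notin
    [set K in comps e X | ~~ [disjoint K & nbr e v] & [disjoint K & nbr e u]].
  rewrite inE; apply/negP => /andP[/(compsP e_sym)[_ /subsetP KW _ _] _].
  by case/negP: uX; apply: KW; rewrite mem_comp ?setU11.
transitivity #|component e (u |: X) u |:
    [set K in comps e X | ~~ [disjoint K & nbr e v] & [disjoint K & nbr e u]]|.
  apply: eq_card => K; rewrite !inE; have [->|_] /= := eqVneq K _.
    apply/negP => d; have := disjointFr d (mem_comp _ (setU11 u X)).
    by rewrite inE e_sym euv.
  by rewrite -andbA; congr andb; rewrite andbC.
by rewrite cardsU1 nin.
Qed.

Lemma card_comps_setU2 :
  #|comps e (u |: (v |: X))| + (bridges u v X + only u v X + only v u X)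
    = #|comps e X| + 1.
Proof.
have vuX : v \notin u |: X by rewrite !inE eq_sym negb_or uv.
have := card_comps_setU1 e_sym vuX; rewrite kappa_nbr_setU1 setUCA.
have := card_comps_setU1 e_sym uX; rewrite (kappa_split u v) => <-.
by lia.
Qed.

(** Adding [u] or [v] merges the components touching it, and adding both merges the union of the two
    families, whose overlap is counted by [bridges]. The 1 appears because the adjacent vertices [u]
    and [v] bring a single new component instead of two. *)
Lemma card_comps_inclusion_exclusion :
  #|comps e (u |: X)| + #|comps e (v |: X)| + bridges u v X =
    #|comps e (u |: (v |: X))| + #|comps e X| + 1.
Proof.
have hu := card_comps_setU1 e_sym uX; rewrite (kappa_split u v) in hu.
have hv := card_comps_setU1 e_sym vX; rewrite (kappa_split v u) bridgesC in hv.
have huv := card_comps_setU2.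
by lia.
Qed.

End Contraction.

(** The merged vertex is [u]; [v] stays in the type and is discarded by passing to [V :\ v]. A loop
    at [u] may arise and is harmless, as adjacency matters only between distinct vertices. *)
Definition contract u v : rel T :=
  [rel x y | [|| e x y, (x == u) && e v y | (y == u) && e x v]].

Lemma contract_sym u v : symmetric (contract u v).
Proof.
move=> x y; rewrite /contract /= e_sym; congr orb; rewrite orbC.
by rewrite [e x v]e_sym [e y v]e_sym.
Qed.

Lemma contract_id u v : {in predC1 u &, contract u v =2 e}.
Proof.
by move=> x y; rewrite !inE /contract /= => /negPf-> /negPf->; rewrite !orbF.
Qed.

End Sym.

Lemma comps_contract e u v X : u \notin X ->
  comps (contract e u v) X = comps e X.
Proof.
move=> uX; apply: eq_comps => a b aX bX _; apply: contract_id; rewrite inE;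
  by apply: contraNneq uX => <-.
Qed.

(** The merged vertex touches a component exactly when [u] or [v] does, so it merges the same
    components as [u] and [v] together. *)
Lemma card_comps_contract e u v X : symmetric e ->
    u != v -> u \notin X -> v \notin X -> e u v ->
  #|comps (contract e u v) (u |: X)| = #|comps e (u |: (v |: X))|.
Proof.
move=> e_sym uv uX vX euv.
have := card_comps_setU1 (contract_sym e_sym u v) uX.
have := card_comps_setU2 e_sym uv uX vX euv.
rewrite (comps_contract e v uX) => <- /eqP.
suff -> : kappa (contract e u v) (nbr (contract e u v) u) X =
    bridges e u v X + only e u v X + only e v u X.
  by rewrite eqn_add2r => /eqP.
rewrite -kappa_split /kappa (comps_contract e v uX).
rewrite -(cardsID [set K : {set T} | ~~ [disjoint K & nbr e u]]).
have mE K : K \in comps e X -> ~~ [disjoint K & nbr (contract e u v) u] =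
    ~~ [disjoint K & nbr e u] || ~~ [disjoint K & nbr e v].
  move=> /(compsP e_sym)[_ /subsetP KX _ _].
  have Ku y : y \in K -> (y == u) = false.
    by move=> yK; apply: contraNF uX => /eqP<-; apply: KX.
  apply/meetP/orP => [[y yK]|[]/meetP[y yK]]; rewrite !inE.
  - rewrite /contract /= (Ku y yK) eqxx /= orbF => /orP[]euy; [left|right];
      by apply/meetP; exists y; rewrite ?inE.
  - by move=> euy; exists y; rewrite // inE /contract /= euy.
  by move=> evy; exists y; rewrite // inE /contract /= eqxx evy orbT.
congr (_ + _); apply: eq_card => K; rewrite !inE.
  by case: (boolP (K \in comps e X)) => //= Kc; rewrite mE //;
    case: (disjoint _ _); case: (disjoint _ _).
case: (boolP (K \in comps e X)) => /= Kc; last by rewrite andbF.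
by rewrite mE //; case: (disjoint _ _); case: (disjoint _ _).
Qed.

End MoreComponents.

(** * Chordal graphs *)

Section Chordal.

Variable T : finType.
Implicit Types (e : rel T) (R V W X Y N K : {set T}) (x y u v a b : T).

(* Equivalent to chordality: for a chordless cycle through the edge ab, let X be
   the rest of the cycle. *)
Definition chordal e V : Prop := forall a b X,
  a \in V -> b \in V -> a != b -> e a b ->
  X \subset V -> a \notin X -> b \notin X -> conn e X ->
  ~~ [disjoint X & nbr e a] -> ~~ [disjoint X & nbr e b] ->
  ~~ [disjoint X & nbr e a :&: nbr e b].

Lemma chordalS e V W : W \subset V -> chordal e V -> chordal e W.
Proof.
move=> WV chV a b X aW bW ab eab XW; apply: chV => //; try exact: (subsetP WV).
exact: subset_trans XW WV.
Qed.

Lemma eq_chordal e e' V : {in V &, forall x y, x != y -> e x y = e' x y} ->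
  chordal e V -> chordal e' V.
Proof.
move=> ee' chV a b X aV bV ab eab XV aX bX Xc aN bN.
have E c : c \in V -> c \notin X ->
    {in X, forall x, (x \in nbr e c) = (x \in nbr e' c)}.
  move=> cV cX x xX; rewrite !inE ee' //; first exact: (subsetP XV).
  by apply: contraNneq cX => ->.
have /meetP[x xX] : ~~ [disjoint X & nbr e a :&: nbr e b].
  apply: chV; rewrite ?ee' //.
  - by apply: conn_sub Xc => x y xX yX xy; rewrite ee' //; apply: (subsetP XV).
  - by have /meetP[x xX xa] := aN; apply/meetP; exists x; rewrite ?E.
  by have /meetP[x xX xb] := bN; apply/meetP; exists x; rewrite ?E.
by rewrite in_setI !E // => xab; apply/meetP; exists x; rewrite // in_setI.
Qed.

Lemma chordal_clique e V : {in V &, forall x y, x != y -> e x y} -> chordal e V.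
Proof.
move=> eV a b X aV bV ab eab XV aX bX _ /meetP[x xX _] _.
have xV := subsetP XV _ xX.
apply/meetP; exists x => //; rewrite !inE !eV //.
  by apply: contraNneq bX => ->.
by apply: contraNneq aX => ->.
Qed.

(** A component of [X :\ v] that did not touch [v] would be closed under adjacency in the connected
    set [X] and so would contain [v]. *)
Lemma component_meet e X v z : symmetric e -> conn e X -> v \in X ->
  z \in X :\ v -> ~~ [disjoint component e (X :\ v) z & nbr e v].
Proof.
move=> e_sym Xc vX zXv; apply/negP => dis.
have zX : z \in X by move: zXv; rewrite inE => /andP[].
have cl a b : a \in component e (X :\ v) z -> b \in X -> e a b ->
    b \in component e (X :\ v) z.
  have /(compsP e_sym)[_ _ _ cl] := comp_comps e zXv.
  move=> aZ bX eab; have [bv|bv] := eqVneq b v.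
    by have := disjointFr dis aZ; rewrite inE -bv e_sym eab.
  by apply: cl eab; rewrite // !inE bv.
have [_] := connect_within_closed cl (mem_comp e zXv) (Xc _ _ zX vX).
by rewrite !inE eqxx.
Qed.

Lemma conn_imset e e' f X :
    {in X &, forall x y, e x y -> (f x == f y) || e' (f x) (f y)} ->
  conn e X -> conn e' (f @: X).
Proof.
move=> fe Xc _ _ /imsetP[x xX ->] /imsetP[y yX ->].
have /connectP[p] := Xc _ _ xX yX; elim: p x xX => [|z p IH] x xX /=.
  by move=> _ ->; apply: connect0.
move=> /andP[/and3P[_ zX exz] zp] yE; apply: connect_trans (IH z zX zp yE).
have /orP[/eqP->|e'xz] := fe _ _ xX zX exz; first exact: connect0.
by apply: connect1; rewrite /within /= !imset_f.
Qed.

(** * Lifting chordality back through the contraction of an edge *)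

Section Uncontract.

Variables (e : rel T) (V : {set T}).
Hypothesis e_sym : symmetric e.

Local Notation meet1 X a := (~~ [disjoint X & nbr e a]).
Local Notation meet2 X a b := (~~ [disjoint X & nbr e a :&: nbr e b]).

(** The information that equality in the contraction bound yields about the edge [uv]: connected
    sets touching both ends contain a common neighbour, and the common neighbours form a clique. *)
Let tight u v :=
  (forall X, X \subset V :\: [set u; v] -> conn e X ->
      meet1 X u -> meet1 X v ->
      meet2 X u v)
  /\ {in (V :\: [set u; v]) :&: (nbr e u :&: nbr e v) &,
        forall y z, y != z -> e y z}.

(** Chordality of the contracted graph at an edge from the merged vertex to [b], in terms of [e]:
    the vertex found is adjacent to [b], but possibly to only one of [u] and [v]. *)
Let weak_edge u v := forall p b X,
  p \in [set u; v] -> b \in V :\: [set u; v] -> X \subset V :\: [set u; v] ->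
  b \notin X -> conn e X -> e p b ->
  meet1 X p -> meet1 X b ->
  exists2 x, x \in X & (e u x || e v x) && e b x.

(** Chordality of the contracted graph at an edge avoiding the merged vertex. In the second
    alternative the common neighbour found is the merged vertex itself. *)
Let weak_pair u v := forall a b X,
  a \in V :\: [set u; v] -> b \in V :\: [set u; v] -> a != b -> e a b ->
  X \subset V -> a \notin X -> b \notin X -> conn e X ->
  meet1 X a -> meet1 X b ->
  (exists2 x, x \in X & e a x && e b x) \/
  [/\ (u \in X) || (v \in X), e u a || e v a & e u b || e v b].

Let weak_edgeP u v : u \in V -> v \in V -> u != v -> e u v ->
  chordal (contract e u v) (V :\ v) -> weak_edge u v.
Proof.
move=> uV vV uv euv ch p b X puv bV XV bX Xc epb Xp Xb.
have uX : u \notin X by apply/negP => /(subsetP XV); rewrite !inE eqxx.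
have [bu bv bV'] : [/\ b != u, b != v & b \in V].
  by move: bV; rewrite !inE negb_or => /andP[/andP[]].
have e'u x : e p x -> contract e u v u x.
  by rewrite /contract /=; case/set2P: puv => -> ->; rewrite ?eqxx ?orbT.
have /meetP[x xX] : ~~ [disjoint X & nbr (contract e u v) u :&: nbr (contract e u v) b].
  apply: ch => //; rewrite ?inE ?uv ?bv ?(eq_sym u) //.
  - exact: e'u.
  - by apply: subset_trans XV _; apply/subsetP=> x; rewrite !inE negb_or -andbA => /and3P[_ -> ->].
  - by apply: conn_sub Xc => x y _ _ _ exy; rewrite /contract /= exy.
  - by have /meetP[x xX xp] := Xp; apply/meetP; exists x => //; move: xp; rewrite !inE; apply: e'u.
  by have /meetP[x xX xp] := Xb; apply/meetP; exists x => //; move: xp; rewrite !inE /contract /= => ->.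
have xu : (x == u) = false by apply: contraNF uX => /eqP<-.
rewrite !inE /contract /= eqxx xu (negPf bu) !orbF /= => xP.
by exists x.
Qed.

Let weak_pairP u v : u \in V -> v \in V -> u != v -> e u v ->
  chordal (contract e u v) (V :\ v) -> weak_pair u v.
Proof.
move=> uV vV uv euv ch a b X aV bV ab eab XV aX bX Xc Xa Xb.
have [au av aV'] : [/\ a != u, a != v & a \in V].
  by move: aV; rewrite !inE negb_or => /andP[/andP[]].
have [bu bv bV'] : [/\ b != u, b != v & b \in V].
  by move: bV; rewrite !inE negb_or => /andP[/andP[]].
pose f x := if x == v then u else x.
have fN c : c != u -> c \notin X -> c \notin f @: X.
  move=> cu cX; apply/imsetP => -[x xX]; rewrite /f; case: eqP => _ E.
    by rewrite E eqxx in cu.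
  by rewrite E xX in cX.
have fe c x : c != u -> e c x -> contract e u v c (f x).
  rewrite /f /contract /= => /negPf-> ecx; case: eqP => [E|_]; last by rewrite ecx.
  by rewrite eqxx -E ecx orbT.
have /meetP[x' /imsetP[x xX ->]] :
    ~~ [disjoint f @: X & nbr (contract e u v) a :&: nbr (contract e u v) b].
  apply: ch; rewrite ?inE ?av ?bv ?fN //.
  - by rewrite /contract /= eab.
  - apply/subsetP=> _ /imsetP[x xX ->]; rewrite /f !inE.
    by case: (eqVneq x v) => [_|-> ]; rewrite ?uv //=; apply: (subsetP XV).
  - apply: conn_imset Xc => x y xX yX exy; rewrite /f /contract /=.
    case: (eqVneq x v) => [xv|xv]; case: (eqVneq y v) => [yv|yv]; rewrite ?eqxx //=.
    + by rewrite -xv exy /= !orbT.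
    + by rewrite -yv exy /= !orbT.
    by rewrite exy !orbT.
  - have /meetP[x xX] := Xa; rewrite inE => /fe h.
    by apply/meetP; exists (f x); rewrite ?imset_f // inE h.
  have /meetP[x xX] := Xb; rewrite inE => /fe h.
  by apply/meetP; exists (f x); rewrite ?imset_f // inE h.
rewrite !inE /contract /= (negPf au) (negPf bu) /=.
rewrite /f; case: (eqVneq x v) => xv; last have [xu|xu] := eqVneq x u.
- rewrite eqxx /= -!(e_sym _ a) -!(e_sym _ b) => /andP[ha hb]; right.
  by split=> //; rewrite -xv xX orbT.
- rewrite /= xu ![e _ u]e_sym ![e _ v]e_sym => /andP[ha hb]; right.
  by split=> //; rewrite -xu xX.
by rewrite /= !orbF => h; left; exists x.
Qed.

Let tightC u v : tight u v -> tight v u.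
Proof.
move=> [h1 h2]; have uvC : [set v; u] = [set u; v] by rewrite setUC.
have nC : nbr e v :&: nbr e u = nbr e u :&: nbr e v by rewrite setIC.
by split=> [X|]; rewrite uvC nC // => XV Xc Xv Xu; apply: h1.
Qed.

(** If [v] is in [X] and not adjacent to [b], the part [Y] of [X :\ v] touching [b] suffices:
    [b |: Y] touches [u] and [v], so [Y] contains a common neighbour of them. In a set avoiding [v],
    [weak_edge] gives some [x]; if [x] is adjacent to [v] only, tightness on [{b, x}] makes [b] a
    common neighbour of [u] and [v], hence adjacent to any common neighbour inside the set. *)
Let uncontract_edge u v b X : u \in V -> v \in V -> e u v ->
    tight u v -> weak_edge u v ->
  b \in V :\: [set u; v] -> X \subset V -> u \notin X -> b \notin X ->
  e u b -> conn e X -> meet1 X u -> meet1 X b ->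
  meet2 X u b.
Proof.
move=> uV vV euv [h1 h2] wk bV XV uX bX eub Xc Xu Xb.
have bu : b != u by move: bV; rewrite !inE negb_or => /andP[/andP[]].
have bV' : [set b] \subset V :\: [set u; v] by rewrite sub1set.
suff main Y : Y \subset V -> u \notin Y -> b \notin Y -> v \notin Y -> conn e Y ->
    meet1 Y u -> meet1 Y b ->
    meet2 Y u b.
  have [vX|vX] := boolP (v \in X); last exact: main.
  have [evb|evb] := boolP (e v b).
    by apply/meetP; exists v => //; rewrite !inE euv e_sym.
  have /meetP[z zX] := Xb; rewrite inE => ebz.
  have zXv : z \in X :\ v.
    by rewrite !inE zX andbT; apply: contraNneq evb => <-; rewrite e_sym.
  have /(compsP e_sym)[_ YX Yc _] := comp_comps e zXv.
  have zY := mem_comp e zXv; have Ym := component_meet e_sym Xc vX zXv.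
  move: (component _ _ _) YX Yc zY Ym => Y YX Yc zY Ym.
  have YX' := subset_trans YX (subsetDl _ _).
  have YV := subset_trans YX' XV.
  have vY : v \notin Y by apply/negP => /(subsetP YX); rewrite !inE eqxx.
  have uY : u \notin Y by apply: contra uX; apply: subsetP.
  have bY : b \notin Y by apply: contra bX; apply: subsetP.
  have YV' : Y \subset V :\: [set u; v].
    apply/subsetP=> y yY; rewrite !inE (subsetP YV) // andbT negb_or.
    by apply/andP; split; [apply: contraNneq uY => <- | apply: contraNneq vY => <-].
  have /meetP[w] : ~~ [disjoint b |: Y & nbr e u :&: nbr e v].
    apply: h1; rewrite ?subUset ?bV' //.
    - exact: conn_setU1 Yc zY ebz.
    - by apply/meetP; exists b; rewrite ?setU11 // inE.
    by have /meetP[y yY yv] := Ym; apply/meetP; exists y; rewrite // inE yY orbT.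
  rewrite !inE => /orP[/eqP-> /andP[_ evb']|wY /andP[euw _]]; first by rewrite evb' in evb.
  have /meetP[x xY xub] : meet2 Y u b.
    apply: main => //; first by apply/meetP; exists w; rewrite // inE.
    by apply/meetP; exists z; rewrite // inE.
  by apply/meetP; exists x => //; apply: (subsetP YX').
move=> YV uY bY vY Yc Yu Yb.
have YV' : Y \subset V :\: [set u; v].
  apply/subsetP=> y yY; rewrite !inE (subsetP YV) // andbT negb_or.
  by apply/andP; split; [apply: contraNneq uY => <- | apply: contraNneq vY => <-].
have [x xY /andP[exuv ebx]] := wk u b Y (set21 _ _) bV YV' bY Yc eub Yu Yb.
have [eux|eux] := boolP (e u x).
  by apply/meetP; exists x; rewrite // !inE eux.
rewrite (negPf eux) /= in exuv.
have /meetP[y yY] : meet2 Y u v.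
  by apply: h1 => //; apply/meetP; exists x; rewrite // inE.
rewrite !inE => /andP[euy evy].
have /meetP[z] : ~~ [disjoint b |: [set x] & nbr e u :&: nbr e v].
  apply: h1; rewrite ?subUset ?bV' ?sub1set ?(subsetP YV') //.
  - exact: conn_setU1 (@conn1 _ _ x) (set11 x) ebx.
  - by apply/meetP; exists b; rewrite ?setU11 // inE.
  by apply/meetP; exists x; rewrite !inE ?eqxx ?orbT.
rewrite !inE => /orP[/eqP->|/eqP->]; last by rewrite (negPf eux).
move=> /andP[_ evb]; apply/meetP; exists y => //; rewrite !inE euy /=.
apply: h2; last by apply: contraNneq bY => ->.
  by rewrite in_setI bV !inE eub evb.
by rewrite in_setI (subsetP YV') // !inE euy evy.
Qed.

Let pair_far u v a b X : tight u v -> weak_pair u v ->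
  a \in V :\: [set u; v] -> b \in V :\: [set u; v] -> a != b -> e a b ->
  X \subset V :\: [set u; v] -> a \notin X -> b \notin X -> conn e X ->
  meet1 X a -> meet1 X b ->
  meet2 X a b.
Proof.
move=> tuv wk aV bV ab eab XV aX bX Xc Xa Xb.
have XV' := subset_trans XV (subsetDl _ _).
have [[x xX xab]|[]] := wk a b X aV bV ab eab XV' aX bX Xc Xa Xb.
  by apply/meetP; exists x; rewrite // !inE.
by case/orP=> /(subsetP XV); rewrite !inE eqxx ?orbT.
Qed.

(** Isolates the part of [X :\ u] that touches [c]: together with [c] it touches both [u] and [v],
    so tightness puts a common neighbour of them into it. *)
Let far_part u v c X : u \in V -> v \in V -> tight u v ->
  c \in V :\: [set u; v] -> X \subset V -> u \in X -> v \notin X -> c \notin X ->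
  ~~ e u c -> e v c -> conn e X -> meet1 X c ->
  exists y Y, [/\ Y \subset X :\ u, conn e Y, meet1 Y c,
                 y \in Y & (y \in nbr e u :&: nbr e v) /\ Y \in comps e (X :\ u)].
Proof.
move=> uV vV [h1 _] cV XV uX vX cX euc evc Xc /meetP[z zX]; rewrite inE => ecz.
have zXu : z \in X :\ u.
  by rewrite !inE zX andbT; apply: contraNneq euc => <-; rewrite e_sym.
have Yc := comp_comps e zXu; have zY := mem_comp e zXu.
have Ym := component_meet e_sym Xc uX zXu.
move: (component _ _ _) Yc zY Ym => Y Yc zY Ym.
have /(compsP e_sym)[_ YX Ycn _] := Yc.
have /meetP[y] : ~~ [disjoint c |: Y & nbr e u :&: nbr e v].
  apply: h1.
  - rewrite subUset sub1set cV /=; apply: subset_trans YX _.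
    apply/subsetP=> y; rewrite !inE negb_or => /andP[-> yX].
    by rewrite (subsetP XV) // andbT; apply: contraNneq vX => <-.
  - exact: conn_setU1 Ycn zY ecz.
  - by have /meetP[y yY yu] := Ym; apply/meetP; exists y; rewrite // inE yY orbT.
  by apply/meetP; exists c; rewrite ?setU11 // inE.
move=> /setU1P[->|yY ynbr]; first by rewrite !inE (negPf euc).
exists y, Y; split=> //; apply/meetP; exists z => //; by rewrite inE.
Qed.

(** The part [Y] of [X :\ u] that touches [a] also touches [b], which reduces the claim to a set
    avoiding [u] and [v]. If [b] is adjacent to [u], then [b] is a common neighbour of [u] and [v],
    hence adjacent to the one in [Y]. Otherwise the part touching [b] also contains a common
    neighbour, and the clique condition makes the two parts equal. *)
Let pair_one u v a b X : u \in V -> v \in V -> tight u v -> weak_pair u v ->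
  a \in V :\: [set u; v] -> b \in V :\: [set u; v] -> a != b -> e a b ->
  X \subset V -> a \notin X -> b \notin X -> u \in X -> v \notin X ->
  conn e X -> meet1 X a -> meet1 X b ->
  e u a || e v a -> e u b || e v b -> ~~ e u a ->
  meet2 X a b.
Proof.
move=> uV vV tuv wk aV bV ab eab XV aX bX uX vX Xc Xa Xb ea eb nua.
have [h1 h2] := tuv.
rewrite (negPf nua) /= in ea.
have [y [Y [YX Ycn Ya yY [ynbr Yc]]]] :=
  far_part uV vV tuv aV XV uX vX aX nua ea Xc Xa.
have YX' := subset_trans YX (subsetDl _ _).
have YV : Y \subset V :\: [set u; v].
  apply: subset_trans YX _; apply/subsetP=> x; rewrite !inE negb_or => /andP[-> xX].
  by rewrite (subsetP XV) // andbT; apply: contraNneq vX => <-.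
have aY : a \notin Y by apply: contra aX; apply: subsetP.
have bY : b \notin Y by apply: contra bX; apply: subsetP.
suff Yb : meet1 Y b.
  have /meetP[x xY xab] := pair_far tuv wk aV bV ab eab YV aY bY Ycn Ya Yb.
  by apply/meetP; exists x => //; apply: (subsetP YX').
have [eub|nub] := boolP (e u b).
  have /meetP[z] : ~~ [disjoint a |: [set b] & nbr e u :&: nbr e v].
    apply: h1; first by rewrite subUset !sub1set aV.
    - exact: conn_setU1 (@conn1 _ _ b) (set11 b) eab.
    - by apply/meetP; exists b; rewrite !inE ?eqxx ?orbT.
    by apply/meetP; exists a; rewrite ?setU11 // inE.
  move=> /setU1P[->|/set1P->]; first by rewrite !inE (negPf nua).
  move=> bnbr; apply/meetP; exists y => //; rewrite inE.
  apply: h2; [by rewrite in_setI bV| by rewrite in_setI (subsetP YV)|].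
  by apply: contraNneq bY => ->.
rewrite (negPf nub) /= in eb.
have [z [Z [ZX Zcn Zb zZ [znbr Zc]]]] :=
  far_part uV vV tuv bV XV uX vX bX nub eb Xc Xb.
suff -> : Y = Z by [].
have zX := subsetP ZX _ zZ.
apply: (comps_eq e_sym Yc Zc _ zZ).
have [<-//|yz] := eqVneq y z.
have /(compsP e_sym)[_ _ _ cl] := Yc; apply: (cl y) => //.
have sub W : W \subset X :\ u -> W \subset V :\: [set u; v].
  move=> WX; apply: subset_trans WX _; apply/subsetP=> x; rewrite !inE negb_or => /andP[-> xX].
  by rewrite (subsetP XV) // andbT; apply: contraNneq vX => <-.
apply: h2 => //; rewrite in_setI; first by rewrite (subsetP YV).
by rewrite (subsetP (sub _ ZX)).
Qed.

(** The work lies in the edges [ab] off [{u, v}] whose only common neighbour after contraction is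
    the merged vertex; they are treated according to which of [u] and [v] belong to [X]. *)
Lemma chordal_uncontract u v : u \in V -> v \in V -> u != v -> e u v ->
    (forall X, X \subset V :\: [set u; v] -> conn e X ->
      ~~ [disjoint X & nbr e u] -> ~~ [disjoint X & nbr e v] ->
      ~~ [disjoint X & nbr e u :&: nbr e v]) ->
    {in (V :\: [set u; v]) :&: (nbr e u :&: nbr e v) &,
        forall y z, y != z -> e y z} ->
  chordal (contract e u v) (V :\ v) -> chordal e V.
Proof.
move=> uV vV uv euv h1 h2 ch.
have tuv : tight u v by []. 
have tvu := tightC tuv; have evu : e v u by rewrite e_sym.
have we := weak_edgeP uV vV uv euv ch; have wp := weak_pairP uV vV uv euv ch.
have we' : weak_edge v u.
  move=> p b X; rewrite ![[set v; u]]setUC => pP bP XP bX Xc epb Xp Xb.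
  by have [x xX] := we p b X pP bP XP bX Xc epb Xp Xb; rewrite orbC; exists x.
have wp' : weak_pair v u.
  move=> a b X; rewrite ![[set v; u]]setUC => aP bP ab eab XP aX bX Xc Xa Xb.
  have [|[]] := wp a b X aP bP ab eab XP aX bX Xc Xa Xb; first by left.
  by rewrite orbC [e u a || _]orbC [e u b || _]orbC => ? ? ?; right.
have edge p b X : p \in [set u; v] -> b \in V -> p != b -> e p b ->
    X \subset V -> p \notin X -> b \notin X -> conn e X ->
    meet1 X p -> meet1 X b ->
    meet2 X p b.
  move=> pP bV pb epb XV pX bX Xc Xp Xb.
  have [bP|bP] := boolP (b \in [set u; v]).
    have XV' : X \subset V :\: [set u; v].
      rewrite subsetD XV disjoint_sym disjointsU_eq !disjoints1.
      by case/set2P: pP pb pX => ->; case/set2P: bP bX => ->; rewrite ?eqxx // => -> _ ->.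
    case/set2P: pP pb Xp => ->; case/set2P: bP Xb => ->; rewrite ?eqxx // => X1 _ X2.
      exact: h1.
    by rewrite setIC; apply: h1.
  have bV' : b \in V :\: [set u; v] by rewrite inE bP.
  case/set2P: pP pX epb Xp => -> pX epb Xp.
    exact: uncontract_edge euv tuv we bV' XV pX bX epb Xc Xp Xb.
  apply: uncontract_edge evu tvu we' _ XV pX bX epb Xc Xp Xb => //.
  by rewrite [[set v; u]]setUC.
move=> a b X aV bV ab eab XV aX bX Xc Xa Xb.
have [aP|aP] := boolP (a \in [set u; v]); first exact: edge.
have [bP|bP] := boolP (b \in [set u; v]).
  by rewrite setIC; apply: edge; rewrite // 1?eq_sym // e_sym.
have {}aV : a \in V :\: [set u; v] by rewrite inE aP.
have {}bV : b \in V :\: [set u; v] by rewrite inE bP.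
have [[x xX xab]|[uvX ea eb]] := wp a b X aV bV ab eab XV aX bX Xc Xa Xb.
  by apply/meetP; exists x; rewrite // !inE.
have aV' : a \in V :\: [set v; u] by rewrite [[set v; u]]setUC.
have bV' : b \in V :\: [set v; u] by rewrite [[set v; u]]setUC.
have eba : e b a by rewrite e_sym.
have ba : b != a by rewrite eq_sym.
have ea' : e v a || e u a by rewrite orbC.
have eb' : e v b || e u b by rewrite orbC.
have [uX|uX] := boolP (u \in X); have [vX|vX] := boolP (v \in X).
- have [/andP[ua ub]|nu] := boolP (e u a && e u b).
    by apply/meetP; exists u; rewrite // !inE e_sym ua e_sym ub.
  have [/andP[va vb]|nv] := boolP (e v a && e v b).
    by apply/meetP; exists v; rewrite // !inE e_sym va e_sym vb.
  have /meetP[z] : ~~ [disjoint a |: [set b] & nbr e u :&: nbr e v].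
    apply: h1; first by rewrite subUset !sub1set aV.
    - exact: conn_setU1 (@conn1 _ _ b) (set11 b) eab.
    - apply/meetP; case/orP: ea nv => ea; first by exists a; rewrite ?setU11 // inE.
      rewrite ea /= => nvb; exists b; rewrite !inE ?eqxx ?orbT //.
      by case/orP: eb => // evb; rewrite evb in nvb.
    apply/meetP; case/orP: ea nu => ea; last by exists a; rewrite ?setU11 // inE.
    rewrite ea /= => nub; exists b; rewrite !inE ?eqxx ?orbT //.
    by case/orP: eb => // eub; rewrite eub in nub.
  rewrite !inE => /orP[]/eqP-> /andP[h h'].
    by move: nu nv eb; rewrite h h' /= => /negPf-> /negPf->.
  by move: nu nv ea; rewrite h h' !andbT => /negPf-> /negPf->.
- have [/andP[ua ub]|] := boolP (e u a && e u b).
    by apply/meetP; exists u; rewrite // !inE e_sym ua e_sym ub.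
  rewrite negb_and => /orP[nua|nub].
    exact: (pair_one uV vV tuv wp aV bV).
  by rewrite setIC; apply: (pair_one uV vV tuv wp bV aV).
- have [/andP[va vb]|] := boolP (e v a && e v b).
    by apply/meetP; exists v; rewrite // !inE e_sym va e_sym vb.
  rewrite negb_and => /orP[nva|nvb].
    exact: (pair_one vV uV tvu wp' aV' bV').
  by rewrite setIC; apply: (pair_one vV uV tvu wp' bV' aV').
- by rewrite (negPf uX) (negPf vX) in uvX.
Qed.

End Uncontract.

Definition simplicial e V x : Prop :=
  {in V :&: nbr e x &, forall y z, y != z -> e y z}.

(** Dirac's theorem on chordal graphs. The set [S] of vertices around a component [K] of
    non-neighbours of [x] is a clique, and the rest [R] supplies the simplicial vertex by
    induction. *)
Lemma chordal_simplicial e V : symmetric e -> irreflexive e -> chordal e V ->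
  V != set0 -> exists2 x, x \in V & simplicial e V x.
Proof.
move=> e_sym e_irr.
have [n] := ubnP #|V|; elim: n V => // n IH V cV chV V0.
pose far x := V :\: (x |: nbr e x).
pose P (p : T * {set T}) := (p.1 \in V) && (p.2 \in comps e (far p.1)).
have [p0 Pp0|noP] := pickP P; last first.
  (* No vertex has a non-neighbour, so [V] is a clique. *)
  have /set0Pn[x xV] := V0; exists x => // y z /setIP[yV _] /setIP[zV _] yz.
  apply: contraT => nyz; have zfar : z \in far y.
    by rewrite !inE zV andbT negb_or eq_sym yz.
  by have := noP (y, component e (far y) z); rewrite /P /= yV comp_comps.
(* Maximality of [K] makes every vertex of [R] adjacent to all of [S]: if [r] misses [s], then
   [s |: K] is a larger connected set of non-neighbours of [r]. *)
case: (arg_maxnP (fun p : T * {set T} => #|p.2|) Pp0) => -[x K] /andP[/= xV Kc] Kmax.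
have /(compsP e_sym)[K0 Kfar Kcn Kcl] := Kc.
have KV : K \subset V := subset_trans Kfar (subsetDl _ _).
pose S := [set s in V :\: K | ~~ [disjoint K & nbr e s]].
have Sx s : s \in S -> e x s.
  rewrite !inE => /andP[/andP[sK sV] /meetP[k kK]]; rewrite inE => esk.
  have kx : k \notin x |: nbr e x by have := subsetP Kfar _ kK; rewrite inE => /andP[].
  apply: contraT => nxs; case/negP: sK; apply: (Kcl k) => //; last by rewrite e_sym.
  rewrite inE sV andbT !inE negb_or nxs andbT.
  by apply: contraNneq kx => <-; rewrite !inE esk orbT.
pose R := V :\: (K :|: S).
have RV : R \subset V := subsetDl _ _.
have xR : x \in R.
  rewrite in_setD in_setU xV andbT negb_or.
  apply/andP; split; first by apply/negP => /(subsetP Kfar); rewrite !inE eqxx.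
  by apply/negP => /Sx; rewrite e_irr.
have RS r s : r \in R -> s \in S -> e r s.
  move=> rR sS; apply: contraT => nrs.
  have rV := subsetP RV _ rR.
  have [sK sV Ks] : [/\ s \notin K, s \in V & ~~ [disjoint K & nbr e s]].
    by move: sS; rewrite !inE => /andP[/andP[]].
  have /meetP[k kK esk] := Ks; rewrite inE in esk.
  have Kfar' : K \subset far r.
    apply/subsetP=> y yK; rewrite !inE (subsetP KV _ yK) andbT negb_or.
    move: rR; rewrite in_setD in_setU rV andbT negb_or => /andP[rK rS].
    apply/andP; split; first by apply: contraNneq rK => <-.
    apply: contra rS => ry; rewrite !inE rK rV /=.
    by apply/meetP; exists y; rewrite ?inE.
  have sfar : s \in far r.
    rewrite !inE sV andbT negb_or nrs andbT; apply/negP => /eqP sr.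
    by move: rR; rewrite -sr in_setD in_setU sS orbT.
  have sKc : conn e (s |: K) by apply: conn_setU1 Kcn kK esk.
  have := Kmax (r, component e (far r) s).
  rewrite /P /= rV comp_comps // => /(_ isT); rewrite leqNgt => /negP[].
  have := subset_leq_card (conn_sub_comps _ sKc (setU11 s K)).
  by rewrite cardsU1 sK; apply; rewrite subUset sub1set sfar.
have ltR : #|R| < n.
  apply: leq_trans (_ : #|V| <= n); last by rewrite -ltnS.
  apply: proper_card; rewrite properE RV /=; apply/subsetPn.
  have /set0Pn[k kK] := K0; exists k; first exact: (subsetP KV).
  by rewrite in_setD in_setU kK.
have [|r rR simp] := IH R ltR (chordalS RV chV).
  by apply/set0Pn; exists x.
have rV := subsetP RV _ rR.
exists r => //.
(* A neighbour of [r] in [K] would put [r] into [S]; hence the neighbours of [r] lie in the clique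
   [S] or among its neighbours in [R]. *)
have split y : y \in V :&: nbr e r -> (y \in R :&: nbr e r) || (y \in S).
  move=> /setIP[yV ery]; rewrite in_setI ery andbT in_setD yV andbT in_setU negb_or.
  have [yS|yS] := boolP (y \in S); rewrite ?orbT // andbT orbF.
  apply: contraL rR => yK; rewrite in_setD rV andbT negbK in_setU.
  have [//|rK] /= := boolP (r \in K); rewrite !inE rK rV /=.
  by apply/meetP; exists y; rewrite // inE.
have SS s t : s \in S -> t \in S -> s != t -> e s t.
  move=> sS tS st.
  have [sK sV Ks] : [/\ s \notin K, s \in V & ~~ [disjoint K & nbr e s]].
    by move: sS; rewrite !inE => /andP[/andP[]].
  have [tK tV Kt] : [/\ t \notin K, t \in V & ~~ [disjoint K & nbr e t]].
    by move: tS; rewrite !inE => /andP[/andP[]].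
  have exs := Sx s sS; have ext := Sx t tS.
  have neq a b : e a b -> a != b by apply: contraTneq => ->; rewrite e_irr.
  have xK : x \notin K by apply/negP => /(subsetP Kfar); rewrite !inE eqxx.
  have /meetP[z] : ~~ [disjoint t |: K & nbr e x :&: nbr e s].
    apply: chV => //.
    - exact: neq.
    - by rewrite subUset sub1set tV.
    - by rewrite !inE negb_or xK (neq _ _ ext).
    - by rewrite !inE negb_or sK st.
    - by have /meetP[k kK] := Kt; rewrite inE => etk; apply: conn_setU1 Kcn kK etk.
    - by apply/meetP; exists t; rewrite ?setU11 // inE.
    by have /meetP[k kK ks] := Ks; apply/meetP; exists k; rewrite // inE kK orbT.
  rewrite !inE => /orP[/eqP->|/(subsetP Kfar)]; first by case/andP.
  by rewrite !inE negb_or => /andP[/andP[_ /negPf->]].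
move=> y z yr zr yz.
case/orP: (split y yr) => hy; case/orP: (split z zr) => hz.
- exact: simp.
- by apply: RS hz; move: hy; rewrite inE => /andP[].
- by rewrite e_sym; apply: RS hy; move: hz; rewrite inE => /andP[].
- exact: SS.
Qed.

End Chordal.

(** * Cycles modulo 2 *)

Section Parity.

Lemma big_addb_card (I : finType) (P f : pred I) :
  \big[addb/false]_(i | P i) f i = odd #|[set i | P i & f i]|.
Proof.
rewrite -sum1_card (big_morph odd oddD (erefl _)) big_mkcond [RHS]big_mkcond.
by apply: eq_bigr => i _; rewrite inE; case: (P i) => //=; case: (f i).
Qed.

(** The terms at [(i, j)] and [(j, i)] cancel. This is the form in which a boundary having no
    boundary is used. *)
Lemma big_addb_sym (I : finType) (h : I -> I -> bool) :
    (forall i j, h i j = h j i) -> (forall i, h i i = false) ->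
  \big[addb/false]_i \big[addb/false]_j h i j = false.
Proof.
move=> hC hI; rewrite pair_big /=.
rewrite (bigID (fun p : I * I => enum_rank p.1 < enum_rank p.2)) /=.
set s1 := (X in X (+) _); set s2 := (X in _ (+) X).
suff -> : s2 = s1 by rewrite addbb.
rewrite /s1 (reindex_inj (h := fun p : I * I => (p.2, p.1))) /=; last first.
  by move=> [a b] [c d] [-> ->].
rewrite /s2 (bigID (fun p : I * I => p.1 == p.2)) /= big1 => [|[i j] /andP[_ /eqP/= ->]] //.
rewrite addFb; apply: eq_big => [[i j]|[i j] _] //=.
by rewrite -leqNgt ltn_neqAle andbC -(inj_eq enum_rank_inj) eq_sym.
Qed.

End Parity.

Section Cycles.

Variable T : finType.
Implicit Types (A B C D P Z : {set {set T}}) (F G Q R S : {set T}).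
Implicit Types (u v x y : T) (d : nat).

(* The coefficient of R in the boundary, over the field with two elements, of
   the chain whose support is C. *)
Definition bd2 C R : bool := \big[addb/false]_(x | x \notin R) ((x |: R) \in C).

Definition symdiff C D : {set {set T}} := [set F | (F \in C) (+) (F \in D)].

Definition mod2_cycle d C : bool :=
  [forall F in C, #|F| == d]
  && [forall R : {set T}, (#|R|.+1 == d) ==> ~~ bd2 C R].

Definition min_cycle d C : bool :=
  minset (fun Z => mod2_cycle d Z && (Z != set0)) C.

Lemma bd2_odd C R : bd2 C R = odd #|[set x | x \notin R & (x |: R) \in C]|.
Proof. by rewrite -big_addb_card. Qed.

Lemma mod2_cycleP d C :
  reflect ((forall F, F \in C -> #|F| = d)
           /\ (forall R, #|R|.+1 = d -> bd2 C R = false)) (mod2_cycle d C).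
Proof.
apply: (iffP andP) => -[h1 h2]; split.
- by move=> F FC; apply/eqP; apply: (forall_inP h1).
- by move=> R /eqP Rd; apply/negbTE; apply: (implyP (forallP h2 R)).
- by apply/forall_inP => F /h1 ->.
- by apply/forallP => R; apply/implyP => /eqP/h2 ->.
Qed.

Lemma min_cycleP d C :
  reflect [/\ mod2_cycle d C, C != set0
             & forall Z, Z \subset C -> mod2_cycle d Z -> Z != set0 -> Z = C]
          (min_cycle d C).
Proof.
apply: (iffP minsetP) => [[/andP[Cc C0] Cmin]|[Cc C0 Cmin]].
  by split=> // Z ZC Zc Z0; apply: Cmin; rewrite ?Zc.
by rewrite Cc C0; split=> // Z /andP[Zc Z0] ZC; apply: Cmin.
Qed.

Lemma bd2_symdiff C D R : bd2 (symdiff C D) R = bd2 C R (+) bd2 D R.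
Proof. by rewrite /bd2 -big_split /=; apply: eq_bigr => x _; rewrite inE. Qed.

Lemma cycle_symdiff d C D : mod2_cycle d C -> mod2_cycle d D -> mod2_cycle d (symdiff C D).
Proof.
move=> /mod2_cycleP[Cd Cb] /mod2_cycleP[Dd Db]; apply/mod2_cycleP; split=> [F|R Rd].
  by rewrite inE; case: (boolP (F \in C)) => [/Cd//|_ /Dd].
by rewrite bd2_symdiff Cb // Db.
Qed.

(** The face [F :\ x] lies in an even number of cells, one of which is [F]. This exchange of a
    vertex is the basic move in a cycle. *)
Lemma cycle_ridge d C F x : mod2_cycle d C -> F \in C -> x \in F ->
  exists2 y, y \notin F & (y |: (F :\ x)) \in C.
Proof.
move=> /mod2_cycleP[Cd Cb] FC xF; have Fd := Cd F FC.
have := Cb (F :\ x); rewrite bd2_odd; set N := [set _ | _ & _].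
have xN : x \in N by rewrite !inE eqxx setD1K.
rewrite (cardsD1 x N) xN /= => h.
have /card_gt0P[y] : 0 < #|N :\ x|.
  case: #|N :\ x| h => //; move: Fd; rewrite (cardsD1 x F) xF => <-.
  by move/(_ (erefl _)).
rewrite !inE negb_and negbK => /andP[yx /andP[]].
by rewrite (negPf yx) /= => yF yC; exists y.
Qed.

(** Exchanging [v] in a cell would produce a cell without [v]. *)
Lemma cycle_all_pair d C u v : u != v -> mod2_cycle d C ->
  (forall F, F \in C -> (u \in F) && (v \in F)) -> C = set0.
Proof.
move=> uv Cc h; apply/eqP; apply: contraT => /set0Pn[F FC].
have /andP[uF vF] := h F FC.
have [y yF /h] := cycle_ridge Cc FC vF.
rewrite !inE eqxx /= orbF => /andP[_ /eqP vy].
by rewrite -vy vF in yF.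
Qed.

(** A cycle minimal among those containing [F] is minimal outright: a proper nonempty subcycle
    missing [F] could be subtracted from it. *)
Lemma ex_min_cycle d C F : mod2_cycle d C -> F \in C ->
  exists2 B, min_cycle d B & (B \subset C) && (F \in B).
Proof.
move=> Cc FC.
pose P Z := [&& mod2_cycle d Z, F \in Z & Z \subset C].
have PC : P C by rewrite /P Cc FC subxx.
have [B /minsetP[/and3P[Bc FB BC] Bmin] _] := minset_exists PC.
exists B; last by rewrite BC.
apply/min_cycleP; split=> // [|Z ZB Zc Z0]; first by apply/set0Pn; exists F.
have [FZ|FZ] := boolP (F \in Z).
  by apply: Bmin => //; rewrite /P Zc FZ (subset_trans ZB).
have /set0Pn[G GZ] := Z0; have GB := subsetP ZB _ GZ.
suff E : symdiff B Z = B by move: (GB); rewrite -{1}E inE GB GZ.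
have sub : symdiff B Z \subset B.
  by apply/subsetP=> H; rewrite inE; case: (boolP (H \in B)) => //= HB /(subsetP ZB); apply: contraTT.
apply: Bmin => //; rewrite /P cycle_symdiff //= inE FB (negPf FZ) /=.
exact: subset_trans BC.
Qed.

Definition simplex_cells d Q : {set {set T}} :=
  [set F : {set T} | (F \subset Q) && (#|F| == d)].

Lemma simplex_cell_subP d Q F : #|Q| = d.+1 ->
  reflect (exists2 x, x \in Q & F = Q :\ x) (F \in simplex_cells d Q).
Proof.
move=> Qd; rewrite inE; apply: (iffP andP) => [[FQ /eqP Fd]|[x xQ ->]].
  have : #|Q :\: F| = 1 by rewrite cardsD (setIidPr FQ) Qd Fd subSnn.
  move=> /eqP/cards1P[x xE]; have : x \in Q :\: F by rewrite xE set11.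
  rewrite inE => /andP[xF xQ]; exists x => //.
  by rewrite -xE setDDr setDv set0U; apply/esym/setIidPr.
by rewrite subsetDl; split=> //; move: Qd; rewrite (cardsD1 x) xQ => -[/eqP].
Qed.

(** From one facet [Q :\ x] of the simplex, exchanging [y] forces the facet [Q :\ y], so a nonempty
    subcycle is everything. *)
Lemma simplex_cells_min d Q : #|Q| = d.+1 -> min_cycle d (simplex_cells d Q).
Proof.
move=> Qd; apply/min_cycleP; split.
- apply/mod2_cycleP; split=> [F|R Rd]; first by rewrite inE => /andP[_ /eqP].
  rewrite bd2_odd; have [RQ|RQ] := boolP (R \subset Q).
    have -> : [set x | x \notin R & (x |: R) \in simplex_cells d Q] = Q :\: R.
      apply/setP=> x; rewrite !inE; have [//|xR] /= := boolP (x \in R).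
      by rewrite subUset sub1set RQ cardsU1 xR add1n Rd eqxx !andbT.
    by rewrite cardsD (setIidPr RQ) Qd -Rd subSn // subSnn.
  have -> : [set x | x \notin R & (x |: R) \in simplex_cells d Q] = set0.
    by apply/setP=> x; rewrite !inE subUset (negPf RQ) !andbF.
  by rewrite cards0.
- have /card_gt0P[x xQ] : 0 < #|Q| by rewrite Qd.
  by apply/set0Pn; exists (Q :\ x); apply/simplex_cell_subP => //; exists x.
move=> Z ZQ Zc /set0Pn[G GZ]; apply/eqP; rewrite eqEsubset ZQ /=.
have /(simplex_cell_subP _ Qd)[x xQ GE] := subsetP ZQ _ GZ.
apply/subsetP=> _ /(simplex_cell_subP _ Qd)[y yQ ->].
have [<-|yx] := eqVneq x y; first by rewrite -GE.
have yG : y \in G by rewrite GE !inE eq_sym yx.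
have [z zG zZ] := cycle_ridge Zc GZ yG.
have := subsetP ZQ _ zZ; rewrite inE subUset sub1set => /andP[/andP[zQ _] _].
have zx : z = x by apply: contraNeq zG => zx; rewrite GE !inE zx.
suff -> : Q :\ y = z |: (G :\ y) by [].
rewrite GE zx; apply/setP=> t; rewrite !inE.
by have [->|] := eqVneq t x; rewrite ?xQ ?yx.
Qed.

End Cycles.

(** * Identification of two vertices in a cycle modulo 2 *)

Section Pieces.

Variable T : finType.
Variables (d : nat) (u v : T).
Hypothesis uv : u != v.
Implicit Types (A B C D P Z : {set {set T}}) (F G Q R S : {set T}) (x y : T).

Definition fold_face F : {set T} := if v \in F then u |: (F :\ v) else F.

Definition split_cells C : {set {set T}} :=
  [set F in C | ~~ ((u \in F) && (v \in F))].

Let bd2D1 A R w : w \notin R -> bd2 A R =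
  (w |: R \in A) (+) \big[addb/false]_(x | (x \notin R) && (x != w)) (x |: R \in A).
Proof. by move=> wR; rewrite /bd2 (bigD1 w). Qed.

(* B is the mod 2 image of the chain A under the identification of v with u. *)
Let folds A B :=
  [/\ forall G, v \in G -> G \in B = false,
      forall G, u \notin G -> v \notin G -> (G \in B) = (G \in A)
    & forall S, u \notin S -> v \notin S ->
        (u |: S \in B) = (u |: S \in A) (+) (v |: S \in A)].

Let folds_bd A B : folds A B ->
  [/\ forall R, v \in R -> bd2 B R = false,
      forall R, u \notin R -> v \notin R -> bd2 B R = bd2 A R
    & forall S, u \notin S -> v \notin S ->
        bd2 B (u |: S) = bd2 A (u |: S) (+) bd2 A (v |: S)].
Proof.
move=> [fv f0 fu]; split=> [R vR|R uR vR|S uS vS].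
- by rewrite /bd2 big1 // => x _; rewrite fv // !inE vR orbT.
- rewrite /bd2 (bigD1 v) //= [in RHS](bigD1 v) //= (bigD1 u) ?uR //=.
  rewrite [in X in _ = _ (+) X](bigD1 u) ?uR //= fu // fv ?setU11 //.
  rewrite addFb addbA [(v |: R \in A) (+) _]addbC; congr addb.
  apply: eq_bigr => x /andP[/andP[xR xv] xu].
  by rewrite f0 // !inE negb_or eq_sym ?xu ?xv.
have vuS : v \notin u |: S by rewrite !inE negb_or eq_sym uv.
have uvS : u \notin v |: S by rewrite !inE negb_or uv.
rewrite (bd2D1 B vuS) (bd2D1 A vuS) (bd2D1 A uvS) fv ?setU11 //.
rewrite [v |: (u |: S)]setUCA addFb addbACA addbb addFb.
rewrite [X in _ (+) X](eq_bigl (fun x => (x \notin u |: S) && (x != v))) => [|x].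
  rewrite -big_split /=; apply: eq_bigr => x; rewrite !inE negb_or.
  move=> /andP[/andP[xu xS] xv]; rewrite ![x |: (_ |: S)]setUCA.
  by apply: fu; rewrite !inE negb_or ?uS ?vS eq_sym ?xu ?xv.
by rewrite !inE; case: (x == u); case: (x == v); case: (x \in S).
Qed.

Definition fold C : {set {set T}} :=
  [set G : {set T} | (v \notin G) &&
     (if u \in G then (G \in C) (+) (v |: (G :\ u) \in C) else G \in C)].

Let folds_fold C : folds C (fold C).
Proof.
split=> [G vG|G uG vG|S uS vS]; rewrite !inE ?vG ?vS ?eqxx ?(negPf uG) //=.
by rewrite negb_or eq_sym uv vS setU1K.
Qed.

Lemma fold_cycle C : mod2_cycle d C -> mod2_cycle d (fold C).
Proof.
move=> /mod2_cycleP[Cd Cb]; have [bv b0 bu] := folds_bd (folds_fold C).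
apply/mod2_cycleP; split=> [G|R Rd].
  rewrite inE => /andP[vG]; case: ifP => uG; last exact: Cd.
  case: (boolP (G \in C)) => [/Cd //|_] /= /Cd.
  by rewrite cardsU1 !inE (negPf vG) andbF /= (cardsD1 u G) uG.
have [vR|vR] := boolP (v \in R); first exact: bv.
have [uR|uR] := boolP (u \in R); last by rewrite b0 // Cb.
have RE : R = u |: (R :\ u) by rewrite setD1K.
rewrite RE bu ?setD11 ?inE ?(negPf vR) ?andbF // -RE Cb // Cb //.
by rewrite cardsU1 !inE (negPf vR) andbF /= -Rd (cardsD1 u R) uR.
Qed.

(** Cells of [P] containing both [u] and [v] need not belong to [C]; only the nondegenerate ones
    must. The boundary of a simplex through [u] and [v] is the case in which the identification
    sends [P] to zero. *)
Definition piece C P : Prop :=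
  [/\ min_cycle d P, split_cells P \subset C
    & (exists Q, [/\ u \in Q, v \in Q, #|Q| = d.+1 & P = simplex_cells d Q])
      \/ min_cycle d [set fold_face F | F in split_cells P]].

Definition is_piece C P : bool :=
  [&& min_cycle d P, split_cells P \subset C
    & [exists Q : {set T},
         [&& u \in Q, v \in Q, #|Q| == d.+1 & P == simplex_cells d Q]]
      || min_cycle d [set fold_face F | F in split_cells P]].

Lemma pieceP C P : reflect (piece C P) (is_piece C P).
Proof.
apply: (iffP and3P) => [[h1 h2 h3]|[h1 h2 h3]]; split=> //.
  case/orP: h3 => [/existsP[Q /and4P[uQ vQ /eqP Qd /eqP PQ]]|]; last by right.
  by left; exists Q.
apply/orP; case: h3 => [[Q [uQ vQ Qd PQ]]|]; last by right.
by left; apply/existsP; exists Q; rewrite uQ vQ Qd PQ !eqxx.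
Qed.

Lemma fold_face_notin F : v \notin fold_face F.
Proof.
rewrite /fold_face; case: (boolP (v \in F)) => // vF.
by rewrite !inE eqxx /= orbF eq_sym.
Qed.

(** The cells of [C] lying over [B] form a chain [A] whose boundary vanishes after identification;
    it is completed to a cycle by cells through both [u] and [v]. A subcycle folds to zero or to
    [B], and chains of degenerate cells contain no nonzero cycle, so the result is minimal. *)
Let lift_piece C B : mod2_cycle d C -> min_cycle d B -> B \subset fold C ->
  exists2 P, piece C P & split_cells P != set0.
Proof.
move=> Cc Bm BC; have [Bc B0 Bmin] := min_cycleP _ _ Bm.
have [/mod2_cycleP[Cd Cb] /mod2_cycleP[Bd Bb]] := conj Cc Bc.
pose A := [set F in split_cells C | fold_face F \in B].
have AE F : (F \in A) = [&& F \in C, ~~ ((u \in F) && (v \in F)) & fold_face F \in B].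
  by rewrite !inE -andbA.
have AB : folds A B.
  split=> [G vG|G uG vG|S uS vS].
  - by apply: contraTF vG => /(subsetP BC); rewrite inE => /andP[].
  - rewrite AE (negPf uG) /fold_face (negPf vG) /=.
    apply/idP/andP=> [GB|[]//]; split=> //.
    by have := subsetP BC _ GB; rewrite inE vG (negPf uG).
  have [uS1 vS1] : v \notin u |: S /\ u \notin v |: S.
    by rewrite !inE !negb_or uv eq_sym uv.
  rewrite !AE !setU11 (negPf uS1) (negPf vS1) /fold_face setU11 (negPf uS1) setU1K //=.
  case: (boolP (u |: S \in B)) => [/(subsetP BC)|_]; rewrite ?andbF //.
  by rewrite inE uS1 setU11 setU1K // !andbT /= => ->.
have [_ b0 bu] := folds_bd AB.
(* Outside faces containing both [u] and [v], the boundary of [A] consists of pairs [u |: S],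
   [v |: S]; the cell on [S], [u] and [v] cancels such a pair. *)
pose X := [set F : {set T} | [&& u \in F, v \in F, #|F| == d & bd2 A (F :\ v)]].
have AX : [disjoint A & X].
  apply/pred0P=> F /=; apply/negbTE/negP => /andP[]; rewrite AE => /and3P[_ h _].
  by rewrite inE => /and4P[uF vF _ _]; rewrite uF vF in h.
have bdX R : u \notin R -> v \notin R -> bd2 X R = false.
  move=> uR vR; rewrite /bd2 big1 // => x _; rewrite !inE (negPf uR) (negPf vR) !orbF.
  by apply/negbTE; apply: contra uv => /and3P[/eqP-> /eqP-> _].
have bdXS S w w' : #|S|.+2 = d -> u \notin S -> v \notin S ->
    (w, w') \in [:: (u, v); (v, u)] ->
    bd2 X (w |: S) = bd2 A (u |: S).
  move=> Sd uS vS ww'.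
  have [nww' w'S] : w != w' /\ w' \notin S.
    by move: ww'; rewrite !inE => /orP[]/eqP[-> ->]; rewrite // eq_sym.
  have w'wS : w' \notin w |: S by rewrite !inE negb_or eq_sym nww'.
  rewrite (bd2D1 X w'wS) big1 => [|x /andP[xwS xw']]; last first.
    move: xwS; rewrite !inE negb_or => /andP[xw xS].
    move: ww' xw xw'; rewrite !inE => /orP[]/eqP[-> ->] xw xw';
      rewrite ![_ == x]eq_sym (negPf xw) (negPf xw') ?(negPf uS) ?(negPf vS) ?eqxx /=.
      by rewrite [v == u]eq_sym (negPf uv).
    by rewrite (negPf uv).
  rewrite addbF.
  have -> : w' |: (w |: S) = v |: (u |: S).
    by move: ww'; rewrite !inE => /orP[]/eqP[-> ->] //; rewrite setUCA.
  rewrite inE !inE !eqxx orbT /=.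
  have vuS : v \notin u |: S by rewrite !inE negb_or eq_sym uv.
  by rewrite setU1K // cardsU1 vuS cardsU1 uS !add1n Sd eqxx.
pose P := A :|: X.
have PE : P = symdiff A X.
  apply/setP=> F; rewrite in_setU [RHS]inE.
  by case: (boolP (F \in A)) => //= FA; rewrite (disjointFr AX FA).
have splitP : split_cells P = A.
  apply/setP=> F; rewrite inE in_setU; have [FA|FA] /= := boolP (F \in A).
    by move: FA; rewrite AE => /and3P[_ ->].
  by rewrite inE; case: (u \in F); case: (v \in F); rewrite // andbF.
have Pc : mod2_cycle d P.
  apply/mod2_cycleP; split=> [F|R Rd].
    by rewrite in_setU AE inE => /orP[/and3P[/Cd]|/and4P[_ _ /eqP]].
  rewrite PE bd2_symdiff.
  have [uR|uR] := boolP (u \in R); have [vR|vR] := boolP (v \in R).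
  - rewrite {1}/bd2 big1 => [|x _]; last by rewrite AE !inE uR vR !orbT andbF.
    rewrite addFb; have [S [RE uS vS]] : exists S, [/\ R = v |: (u |: S), u \notin S & v \notin S].
      exists (R :\ u :\ v); split; rewrite ?inE ?eqxx ?andbF //.
      by rewrite setUCA setD1K ?setD1K // !inE vR andbT eq_sym.
    have vuS : v \notin u |: S by rewrite !inE negb_or eq_sym uv.
    have Av x : v |: (x |: (u |: S)) \in A = false.
      by rewrite AE !inE !eqxx !orbT andbF.
    (* On a face containing both [u] and [v] the coefficient is one of the boundary of a boundary, a
       sum over ordered pairs of added vertices. *)
    transitivity (\big[addb/false]_x \big[addb/false]_y
        [&& x != y, x \notin R, y \notin R & x |: (y |: (u |: S)) \in A]); last first.
      apply: big_addb_sym => [x y|x]; last by rewrite eqxx.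
      by rewrite eq_sym setUCA; case: (y == x); case: (x \in R); case: (y \in R).
    rewrite /bd2 big_mkcond /=; apply: eq_bigr => x _.
    have [xR|xR] /= := boolP (x \in R).
      by rewrite big1 // => y _; rewrite andbF.
    move: (xR); rewrite {1}RE !inE !negb_or => /and3P[xv xu xS].
    have xE : (x |: R) :\ v = x |: (u |: S).
      by rewrite RE setUCA setU1K // !inE !negb_or eq_sym xv eq_sym uv.
    rewrite xE uR vR !orbT /= cardsU1 xR add1n Rd eqxx /=.
    have vxS : v \notin x |: (u |: S) by rewrite !inE !negb_or eq_sym xv eq_sym uv.
    rewrite (bd2D1 A vxS) Av addFb [RHS](bigD1 v) //= vR !andbF addFb.
    rewrite big_mkcond [RHS]big_mkcond; apply: eq_bigr => y _ /=.
    rewrite [y |: (x |: _)]setUCA; move: (x |: _ \in A) => b.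
    rewrite RE !inE !negb_or [x == y]eq_sym.
    by case: (y == v); case: (y == x); case: (y == u); case: (y \in S).
  - have [S [RE uS vS]] : exists S, [/\ R = u |: S, u \notin S & v \notin S].
      by exists (R :\ u); rewrite setD1K // !inE eqxx (negPf vR) andbF.
    rewrite RE (bdXS S u v) ?addbb ?inE ?eqxx //.
    by rewrite -Rd RE cardsU1 uS.
  - have [S [RE uS vS]] : exists S, [/\ R = v |: S, u \notin S & v \notin S].
      by exists (R :\ v); rewrite setD1K // !inE eqxx (negPf uR) andbF.
    have Sd : #|S|.+2 = d by rewrite -Rd RE cardsU1 vS.
    rewrite RE (bdXS S v u) ?inE ?eqxx ?orbT // addbC -bu // Bb //.
    by rewrite cardsU1 uS.
  by rewrite bdX // addbF -b0 // Bb.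
have lift F : F \in A -> fold_face F \in B by rewrite AE => /and3P[].
have nboth S : u \notin S -> v \notin S -> u |: S \in A -> v |: S \notin A.
  move=> uS vS uSA; apply/negP => vSA; have [_ _ fu] := AB.
  have := lift _ uSA; rewrite /fold_face !inE eq_sym (negPf uv) (negPf vS) /=.
  by rewrite fu // uSA vSA.
have noX Z : Z \subset X -> mod2_cycle d Z -> Z = set0.
  move=> ZX Zc; apply: (cycle_all_pair uv Zc) => F /(subsetP ZX).
  by rewrite inE => /and4P[-> ->].
have Pm : min_cycle d P.
  apply/min_cycleP; split=> //.
    apply: contra_neq B0 => P0; have A0 : A = set0.
      by apply/eqP; rewrite -subset0 -P0 subsetUl.
    have [fv f0 fu] := AB; apply/setP=> G; rewrite inE.
    have [vG|vG] := boolP (v \in G); first exact: fv.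
    have [uG|uG] := boolP (u \in G); last by rewrite f0 // A0 inE.
    by rewrite -(setD1K uG) fu ?A0 ?inE ?eqxx ?(negPf vG) ?andbF.
  move=> Z ZP Zc Z0.
  have notX F : F \in Z -> ~~ ((u \in F) && (v \in F)) -> F \in A.
    move=> /(subsetP ZP); rewrite in_setU => /orP[//|].
    by rewrite inE => /and4P[-> ->].
  have [zv z0 zu] := folds_fold Z.
  have AZ F : F \in A -> (fold_face F \in fold Z) = (F \in Z).
    move=> FA; have nF : ~~ ((u \in F) && (v \in F)).
      by move: FA; rewrite AE => /and3P[].
    case: (boolP (v \in F)) nF => vF; rewrite ?andbT => nF; last first.
      rewrite /fold_face (negPf vF).
      have [uF|uF] := boolP (u \in F); last exact: z0.
      move: FA vF; rewrite -(setD1K uF); move: (F :\ u) (setD11 u F) => S /negbT uS FA.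
      rewrite in_setU1 negb_or => /andP[_ vS]; rewrite zu // {nF}.
      suff /negPf-> : v |: S \notin Z by rewrite addbF.
      apply: contra (nboth S uS vS FA) => /notX; apply.
      by rewrite !inE (negPf uS) (negPf uv).
    rewrite /fold_face vF; move: FA nF; rewrite -{1 2 4}(setD1K vF).
    move: (F :\ v) (setD11 v F) => S /negbT vS FA.
    rewrite in_setU1 negb_or => /andP[_ uS]; rewrite zu //.
    suff /negPf-> : u |: S \notin Z by rewrite addFb.
    apply: contraL FA => /notX uSA; apply: nboth => //; apply: uSA.
    by rewrite !inE eqxx (negPf vS) eq_sym (negPf uv).
  have ZB : fold Z \subset B.
    apply/subsetP=> G GZ; have [vG|vG] := boolP (v \in G); first by rewrite zv in GZ.
    have [uG|uG] := boolP (u \in G); last first.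
      move: GZ; rewrite z0 // => /notX; rewrite (negPf uG) => /(_ isT)/lift.
      by rewrite /fold_face (negPf vG).
    move: GZ vG; rewrite -(setD1K uG); move: (G :\ u) (setD11 u G) => S /negbT uS.
    move=> + vuS; have vS : v \notin S by apply: contra vuS; rewrite inE orbC => ->.
    rewrite zu //; have [/notX|_ /=] := boolP (u |: S \in Z).
      by rewrite (negPf vuS) andbF => /(_ isT)/lift; rewrite /fold_face (negPf vuS).
    move=> /notX vSA; have /lift : v |: S \in A.
      by apply: vSA; rewrite !inE (negPf uS) (negPf uv).
    by rewrite /fold_face setU11 setU1K.
  have [fZ0|fZ0] := eqVneq (fold Z) set0.
    suff E : Z = set0 by rewrite E eqxx in Z0.
    apply: noX Zc; apply/subsetP=> F FZ; have := subsetP ZP _ FZ.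
    rewrite in_setU; have [FA|//] := boolP (F \in A).
    by have := AZ F FA; rewrite fZ0 FZ inE.
  (* By minimality of [B]; now [Z] contains all of [A], and [P] and [Z] can differ only in
     degenerate cells. *)
  have fZB : fold Z = B by apply: Bmin; rewrite ?fold_cycle.
  have AsZ : A \subset Z.
    by apply/subsetP=> F FA; rewrite -AZ // fZB lift.
  have : symdiff P Z = set0.
    apply: noX; last exact: cycle_symdiff.
    apply/subsetP=> F; rewrite inE in_setU.
    have [/(subsetP AsZ)->//|FA /=] := boolP (F \in A).
    have [//|FX] /= := boolP (F \in X).
    by move=> /(subsetP ZP); rewrite in_setU (negPf FA) (negPf FX).
  move/setP=> E; apply/setP=> F; have := E F; rewrite in_set0 /symdiff in_set.
  by case: (F \in P); case: (F \in Z).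
have fA : [set fold_face F | F in A] = B.
  apply/setP=> G; apply/imsetP/idP => [[F FA ->]|GB]; first exact: lift.
  have [fv f0 fu] := AB.
  have [vG|vG] := boolP (v \in G); first by rewrite fv in GB.
  have [uG|uG] := boolP (u \in G); last first.
    by exists G; rewrite -?f0 // /fold_face (negPf vG).
  move: GB vG; rewrite -(setD1K uG); move: (G :\ u) (setD11 u G) => S /negbT uS.
  move=> + vuS; have vS : v \notin S by apply: contra vuS; rewrite inE orbC => ->.
  rewrite fu //; have [uSA _|_ /= vSA] := boolP (u |: S \in A).
    by exists (u |: S); rewrite // /fold_face (negPf vuS).
  by exists (v |: S); rewrite // /fold_face setU11 setU1K.
exists P; last first.
  rewrite splitP; apply: contra_neq B0 => A0; by rewrite -fA A0 imset0.
split=> //.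
  by rewrite splitP; apply/subsetP=> F; rewrite AE => /and3P[].
by right; rewrite splitP fA.
Qed.

(** [C] is a sum modulo 2 of pieces, and restriction to [S] commutes with sums. Subtracting a piece
    removes its nondegenerate cells from [C] and adds none, so the number of nondegenerate cells
    decreases. *)
Lemma cycle_restrict_pieces C (S : {set {set T}}) : mod2_cycle d C ->
    (forall P, piece C P -> mod2_cycle d (P :&: S)) ->
  mod2_cycle d (C :&: S).
Proof.
have [n] := ubnP #|split_cells C|; elim: n => // n IH in C * => Cn Cc pieceS.
have [C0|C0] := eqVneq (split_cells C) set0.
  suff -> : C = set0.
    rewrite set0I; apply/mod2_cycleP; split=> [F|R _]; first by rewrite inE.
    by rewrite /bd2 big1 // => x _; rewrite inE.
  apply: (cycle_all_pair uv Cc) => F FC; apply: contraT => nF.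
  by have := in_set0 F; rewrite -C0 inE FC nF.
suff [P PC P0] : exists2 P, piece C P & split_cells P != set0.
  have [Pm PsC _] := PC; have /min_cycleP[Pc _ _] := Pm.
  have split_diff : split_cells (symdiff C P) = split_cells C :\: split_cells P.
    apply/setP=> F; have := subsetP PsC F; rewrite !inE.
    case: (F \in C); case: (F \in P); rewrite ?andbF ?andbT //=;
      by case: (~~ _) => //= /(_ isT).
  have -> : C :&: S = symdiff (symdiff C P :&: S) (P :&: S).
    by apply/setP=> F; rewrite !inE; case: (F \in C); case: (F \in P); case: (F \in S).
  apply: cycle_symdiff; last exact: pieceS.
  have lt : #|split_cells (symdiff C P)| < n.
    apply: leq_trans (_ : #|split_cells C| <= n); last by rewrite -ltnS.
    rewrite split_diff; apply: proper_card.
    rewrite properE subsetDl /=.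
    have /set0Pn[F FP] := P0; apply/subsetPn; exists F; last by rewrite in_setD FP.
    by have := FP; rewrite !inE => /andP[FP' nF]; rewrite nF (subsetP PsC).
  apply: IH => //; first exact: cycle_symdiff.
  move=> P' [P'm P's P'Q]; apply: pieceS; split=> //.
  have sub : split_cells P' \subset split_cells (symdiff C P).
    apply/subsetP=> F FP'; have FCP := subsetP P's _ FP'.
    by move: FP'; rewrite inE => /andP[_ nF]; rewrite inE FCP.
  apply: subset_trans sub _; rewrite split_diff.
  by apply/subsetP=> F; rewrite !inE => /andP[_ /andP[]].
have [fC0|/set0Pn[G GC]] := eqVneq (fold C) set0; last first.
  have [B Bm /andP[BC _]] := ex_min_cycle (fold_cycle Cc) GC.
  exact: lift_piece Cc Bm BC.
have [zv z0 zu] := folds_fold C.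
have zero G : G \in fold C = false by rewrite fC0 inE.
(* The identification sends [C] to zero, so its nondegenerate cells come in cancelling pairs; the
   boundary of the simplex spanned by one pair is a piece. *)
have [S' [uS vS uSC vSC]] : exists S', [/\ u \notin S', v \notin S', u |: S' \in C & v |: S' \in C].
  have /set0Pn[F] := C0; rewrite inE => /andP[FC nF].
  have [uF|uF] := boolP (u \in F); last have [vF|vF] := boolP (v \in F).
  - rewrite uF /= in nF; exists (F :\ u).
    have [uS vS] : u \notin F :\ u /\ v \notin F :\ u by rewrite !inE eqxx (negPf nF) andbF.
    have := zu _ uS vS; rewrite zero setD1K // FC uS vS => /esym/negbT.
    by rewrite addTb negbK.
  - exists (F :\ v).
    have [uS vS] : u \notin F :\ v /\ v \notin F :\ v by rewrite !inE eqxx (negPf uF) andbF.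
    have := zu _ uS vS; rewrite zero setD1K // FC uS vS => /esym/negbT.
    by rewrite addbT negbK.
  by have := z0 _ uF vF; rewrite zero FC.
have vuS : v \notin u |: S' by rewrite !inE negb_or eq_sym uv.
have uvS : u \notin v |: S' by rewrite !inE negb_or uv.
have /mod2_cycleP[Cd _] := Cc.
have Qd : #|v |: (u |: S')| = d.+1 by rewrite cardsU1 vuS Cd.
have uE : u |: S' = (v |: (u |: S')) :\ v by rewrite setU1K.
have vE : v |: S' = (v |: (u |: S')) :\ u by rewrite setUCA setU1K.
exists (simplex_cells d (v |: (u |: S'))); last first.
  apply/set0Pn; exists (u |: S'); rewrite inE (negPf vuS) andbF andbT.
  by apply/simplex_cell_subP => //; exists v; rewrite ?setU11.
split; first exact: simplex_cells_min.
  apply/subsetP=> F; rewrite inE => /andP[/(simplex_cell_subP _ Qd)[x xQ ->]].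
  rewrite !in_setD1 setU11 (in_setU1 u) setU11 orbT !andbT negb_and !negbK.
  by case/orP=> /eqP <-; rewrite -?uE -?vE.
by left; exists (v |: (u |: S')); split; rewrite ?setU11 // (in_setU1 u) setU11 orbT.
Qed.

End Pieces.

(** * Links of a normal pseudomanifold *)

Section Cone.

Variables (T : finType) (d : nat) (v : T) (K : {set {set T}}).
Hypotheses (Kd : forall F, F \in K -> #|F| = d) (vK : forall F, F \in K -> v \notin F).
Implicit Types (F G R : {set T}) (Z : {set {set T}}) (x y : T).

(* Completes K to a cycle modulo 2. *)
Definition cone_off : {set {set T}} :=
  K :|: [set F : {set T} | [&& v \in F, #|F| == d & bd2 K (F :\ v)]].

Lemma cone_offP F : reflect (F \in K \/ [/\ v \in F, #|F| = d & bd2 K (F :\ v)])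
  (F \in cone_off).
Proof.
rewrite !inE; apply: (iffP orP) => [[|/and3P[vF /eqP Fd bF]]|[|[-> -> ->]]]; [by left|by right|by left|].
by right; rewrite eqxx.
Qed.

Lemma cone_off_apex R : v \notin R -> #|R|.+1 = d -> (v |: R \in cone_off) = bd2 K R.
Proof.
move=> vR Rd; apply/cone_offP/idP => [[/vK|[_ _]]|bR].
- by rewrite setU11.
- by rewrite setU1K.
by right; rewrite setU11 setU1K // cardsU1 vR.
Qed.

Lemma cone_off_base F : v \notin F -> (F \in cone_off) = (F \in K).
Proof. by move=> vF; apply/cone_offP/idP => [[//|[]]|]; [rewrite (negPf vF) | left]. Qed.

Lemma bd2_apex Z R : v \notin R -> bd2 Z R =
  (v |: R \in Z) (+) bd2 (Z :&: [set F : {set T} | v \notin F]) R.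
Proof.
move=> vR; rewrite /bd2 (bigD1 v) //= [in RHS](bigD1 v) //=.
rewrite in_setI [in X in _ (+) (X (+) _)]inE setU11 andbF addFb; congr addb.
apply: eq_bigr => x /andP[xR xv]; rewrite in_setI [in RHS]inE.
by rewrite in_setU1 negb_or [v == x]eq_sym xv vR !andbT.
Qed.

(** Away from the apex the cone over the boundary of [K] cancels that boundary; at faces through the
    apex the sum is again a boundary of a boundary. *)
Lemma cone_off_cycle : mod2_cycle d cone_off.
Proof.
apply/mod2_cycleP; split=> [F /cone_offP[/Kd|[]]//|R Rd].
have [vR|vR] := boolP (v \in R); last first.
  rewrite bd2_apex // cone_off_apex //.
  suff -> : cone_off :&: [set F : {set T} | v \notin F] = K by rewrite addbb.
  apply/setP=> F; rewrite in_setI [in X in _ && X]inE.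
  by case: (boolP (v \in F)) => vF; rewrite ?andbF ?andbT ?cone_off_base //;
    apply/esym; apply: contraTF vF => /vK.
pose S := R :\ v; have vS : v \notin S by rewrite !inE eqxx.
have RE : R = v |: S by rewrite setD1K.
rewrite RE; transitivity (\big[addb/false]_x \big[addb/false]_y
    [&& x != y, x \notin R, y \notin R & x |: (y |: S) \in K]); last first.
  apply: big_addb_sym => [x y|x]; last by rewrite eqxx.
  by rewrite eq_sym setUCA; case: (y == x); case: (x \in R); case: (y \in R).
rewrite -RE {1}/bd2 big_mkcond /=; apply: eq_bigr => x _.
have [xR|xR] /= := boolP (x \in R); first by rewrite big1 // => y _; rewrite andbF.
have xv : x != v by apply: contraNneq xR => ->.
have xS : x \notin S by rewrite in_setD1 (negPf xR) andbF.
have vxS : v \notin x |: S by rewrite in_setU1 negb_or eq_sym xv.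
have xSd : #|x |: S|.+1 = d by rewrite cardsU1 xS -Rd RE cardsU1 vS.
rewrite {1}RE setUCA cone_off_apex // /bd2 big_mkcond /=; apply: eq_bigr => y _.
rewrite setUCA in_setU1 negb_or [x == y]eq_sym.
have [->|yv] := eqVneq y v.
  rewrite vS vR /= andbF; case: ifP => // _; apply/negbTE/negP => /vK.
  by rewrite setUCA setU11.
have -> : (y \in R) = (y \in S) by rewrite RE in_setU1 (negPf yv).
by case: (y == x); case: (y \in S).
Qed.

(** The part of a subcycle off the apex is closed under adjacency through ridges: a ridge where it
    stopped would need an apex cell, although the two cells of [K] at that ridge leave it no
    boundary. By strong connectedness this part is [K], and the apex cells are then determined. *)
Lemma cone_off_min :
    (forall R x y, #|R|.+1 = d -> x \notin R -> y \notin R ->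
      x |: R \in K -> y |: R \in K -> x != y ->
      #|[set z | z \notin R & z |: R \in K]| = 2) ->
    (forall Z : {set {set T}}, Z \subset K -> Z != set0 ->
      (forall R x y, #|R|.+1 = d -> x \notin R -> y \notin R ->
         x |: R \in Z -> y |: R \in K -> y |: R \in Z) -> Z = K) ->
  K != set0 -> min_cycle d cone_off.
Proof.
move=> two strong K0; apply/min_cycleP; split; first exact: cone_off_cycle.
  have /set0Pn[F FK] := K0; apply/set0Pn; exists F; by rewrite inE FK.
move=> Z ZC /mod2_cycleP[Zd Zb] Z0.
pose ZK := Z :&: [set F : {set T} | v \notin F].
have ZKK : ZK \subset K.
  apply/subsetP=> F; rewrite in_setI => /andP[/(subsetP ZC) FC].
  by rewrite in_set => vF; rewrite -cone_off_base.
have apexZ R : v \notin R -> #|R|.+1 = d -> (v |: R \in Z) = bd2 ZK R.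
  by move=> vR Rd; have := Zb R Rd; rewrite bd2_apex // -/ZK; case: (_ \in Z); case: (bd2 _ _).
have ZK0 : ZK != set0.
  apply: contra_neq Z0 => ZK0; apply/setP=> F; rewrite in_set0; apply/negbTE/negP => FZ.
  have vF : v \in F.
    apply: contraT => vF; have : F \in ZK by rewrite in_setI FZ inE.
    by rewrite ZK0 inE.
  have := apexZ (F :\ v); rewrite setD1K // FZ !inE eqxx => /(_ isT).
  rewrite -(Zd F FZ) (cardsD1 v F) vF => /(_ (erefl _)).
  by rewrite ZK0 /bd2 big1 // => x _; rewrite inE.
have ZKE : ZK = K.
  apply: strong => // R x y Rd xR yR xZ yK.
  have xK := subsetP ZKK _ xZ.
  have [<-//|xy] := eqVneq x y; apply: contraT => yZ.
  have vR : v \notin R by have := vK xK; rewrite in_setU1 negb_or => /andP[].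
  have two' := two R x y Rd xR yR xK yK xy.
  have cofE : [set z | z \notin R & z |: R \in K] = [set x; y].
    apply/esym/eqP; rewrite eqEcard two' cards2 xy andbT.
    by apply/subsetP=> z /set2P[]->; rewrite inE ?xR ?yR.
  have : bd2 ZK R.
    rewrite bd2_odd; suff -> : [set z | z \notin R & z |: R \in ZK] = [set x] by rewrite cards1.
    apply/setP=> z; rewrite inE in_set1; apply/andP/eqP => [[zR zZ]|->//].
    have : z \in [set x; y] by rewrite -cofE inE zR (subsetP ZKK).
    by case/set2P=> // E; rewrite -E zZ in yZ.
  rewrite -apexZ // => /(subsetP ZC); rewrite cone_off_apex // bd2_odd.
  by rewrite two'.
apply/eqP; rewrite eqEsubset ZC /=; apply/subsetP=> F FC.
have [vF|vF] := boolP (v \in F); last first.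
  by rewrite cone_off_base // -ZKE in_setI in FC; case/andP: FC.
have /cone_offP[/vK|[_ Fd bF]] := FC; first by rewrite vF.
rewrite -(setD1K vF) apexZ ?ZKE // ?inE ?eqxx //.
by rewrite -Fd (cardsD1 v F) vF.
Qed.

End Cone.

Section Link.

Variables (T : finType) (d : nat) (D : {set {set T}}).
Hypothesis D_npm : normal_pseudomanifold d D.
Implicit Types (A B F R : {set T}) (x y v w : T).

Let D_sc : simplicial_complex D. Proof. by case: D_npm. Qed.

Definition cofaces (E : {set {set T}}) R : {set T} :=
  [set x | x \notin R & x |: R \in E].

Lemma card_facets_over (E : {set {set T}}) n R :
    (forall F, facet E F = (F \in E) && (#|F| == n)) -> #|R|.+1 = n ->
  #|facets_over E R| = #|cofaces E R|.
Proof.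
move=> facetE Rn; have -> : facets_over E R = (fun x => x |: R) @: cofaces E R.
  apply/setP=> F; rewrite inE facetE; apply/idP/imsetP => [/andP[/andP[FE /eqP Fn] RF]|[x]].
    have : #|F :\: R| = 1 by rewrite cardsD (setIidPr RF) Fn -Rn subSnn.
    move=> /eqP/cards1P[x xE]; have : x \in F :\: R by rewrite xE set11.
    rewrite inE => /andP[xR xF]; have FxR : F = x |: R.
      by rewrite -[F](setID _ R) (setIidPr RF) xE setUC.
    by exists x; rewrite // inE xR -FxR.
  rewrite inE => /andP[xR xE] ->; rewrite xE cardsU1 xR add1n Rn eqxx /=.
  exact: subsetUr.
rewrite card_in_imset // => x y; rewrite !inE => /andP[xR _] /andP[yR _] /setP/(_ x).
by rewrite !inE eqxx (negPf xR) !orbF => /esym/eqP.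
Qed.

Lemma npm_facet F : facet D F = (F \in D) && (#|F| == d.+1).
Proof.
have [_ rk pu _ _] := D_npm; apply/idP/andP => [Ff|[FD /eqP Fd]].
  by split; [case/maxsetP: Ff | rewrite pu // rk].
apply/maxsetP; split=> // B BD FB; apply/esym/eqP; rewrite eqEcard FB Fd -rk.
exact: leq_bigmax_cond.
Qed.

Lemma npm_ext A : A \in D -> exists2 F, F \in D & (#|F| == d.+1) && (A \subset F).
Proof.
move=> AD; have [F Ff AF] := maxset_exists (P := fun B => B \in D) AD.
by have := npm_facet F; rewrite /facet Ff => /esym/andP[FD Fd]; exists F; rewrite ?Fd.
Qed.

Lemma npm_le A : A \in D -> #|A| <= d.+1.
Proof. by have [_ <- _ _ _] := D_npm; apply: leq_bigmax_cond. Qed.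

Lemma npm_ridge R : ridge D R = (R \in D) && (#|R| == d).
Proof. by rewrite /ridge; have [_ -> _ _ _] := D_npm. Qed.

Lemma cofaces_le2 R : #|R| = d -> #|cofaces D R| <= 2.
Proof.
move=> Rd; have [RD|RD] := boolP (R \in D).
  have [_ _ _ le2 _] := D_npm; rewrite -(card_facets_over npm_facet) ?Rd //.
  by apply: le2; rewrite npm_ridge RD Rd eqxx.
suff -> : cofaces D R = set0 by rewrite cards0.
apply/setP=> x; rewrite !inE; apply/negbTE; apply: contra RD => /andP[_ xR].
exact: D_sc xR (subsetUr _ _).
Qed.

Lemma mem_boundary A : reflect (exists R, [/\ R \in D, #|R| = d, #|cofaces D R| = 1 & A \subset R])
  (A \in boundary D).
Proof.
rewrite inE; apply: (iffP existsP) => -[R].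
  rewrite npm_ridge => /and3P[/andP[RD /eqP Rd] Rc AR]; exists R; split=> //.
  by rewrite -(card_facets_over npm_facet) ?Rd //; apply/eqP.
move=> [RD Rd Rc AR]; exists R; rewrite npm_ridge RD Rd eqxx AR andbT /=.
by rewrite (card_facets_over npm_facet) ?Rd // Rc.
Qed.

Lemma boundary_sc : simplicial_complex (boundary D).
Proof.
move=> A B /mem_boundary[R [RD Rd Rc AR]] BA; apply/mem_boundary; exists R; split=> //.
exact: subset_trans AR.
Qed.

Lemma boundary_sub : boundary D \subset D.
Proof. by apply/subsetP=> A /mem_boundary[R [RD _ _ AR]]; apply: D_sc RD AR. Qed.

Section Vertex.

Variable v : T.
Hypothesis vD : v \in vertices D.

Let L := link D [set v].

Lemma mem_link1 (E : {set {set T}}) A : simplicial_complex E ->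
  (A \in link E [set v]) = (v \notin A) && (v |: A \in E).
Proof.
move=> E_sc; rewrite inE setUC disjoint_sym disjoints1.
case: (boolP (v |: A \in E)) => vAE; rewrite ?andbF //= andbT andbC.
by rewrite (E_sc _ _ vAE (subsetUr _ _)) andbT.
Qed.

Let LP A : (A \in L) = (v \notin A) && (v |: A \in D). Proof. exact: mem_link1. Qed.

Lemma link_sc : simplicial_complex L.
Proof.
move=> A B; rewrite !LP => /andP[vA AD] BA; rewrite (contra (subsetP BA v) vA) /=.
by apply: D_sc AD _; apply: setUS.
Qed.

Lemma link_le A : A \in L -> #|A| <= d.
Proof. by rewrite LP => /andP[vA /npm_le]; rewrite cardsU1 vA. Qed.

Lemma link_ext A : A \in L -> exists2 F, F \in L & (#|F| == d) && (A \subset F).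
Proof.
rewrite LP => /andP[vA /npm_ext[F FD /andP[/eqP Fd AF]]].
have vF : v \in F by apply: (subsetP AF); rewrite setU11.
exists (F :\ v); first by rewrite LP setD1K // !inE eqxx.
rewrite subsetD1 vA (subset_trans (subsetUr _ _) AF) !andbT.
by apply/eqP; have := cardsD1 v F; rewrite vF Fd add1n => -[].
Qed.

Lemma link_facet F : facet L F = (F \in L) && (#|F| == d).
Proof.
apply/idP/andP => [/maxsetP[FL Fmax]|[FL /eqP Fd]].
  split=> //; have [G GL /andP[Gd FG]] := link_ext FL.
  by rewrite -(Fmax G GL FG).
apply/maxsetP; split=> // B BL FB; apply/esym/eqP; rewrite eqEcard FB Fd.
exact: link_le.
Qed.

Lemma set0_link : set0 \in L.
Proof. by rewrite LP inE /= setU0; move: vD; rewrite inE. Qed.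

Lemma link_rank : rank L = d.
Proof.
have [F FL /andP[/eqP Fd _]] := link_ext set0_link.
apply/eqP; rewrite eqn_leq; apply/andP; split.
  by apply/bigmax_leqP => A; apply: link_le.
by rewrite -Fd; apply: leq_bigmax_cond.
Qed.

Lemma cofaces_link R : v \notin R -> cofaces L R = cofaces D (v |: R).
Proof.
move=> vR; apply/setP=> x; rewrite [LHS]in_set [RHS]in_set LP !in_setU1 !negb_or vR andbT.
by rewrite [v == x]eq_sym setUCA andbCA andbA.
Qed.

(** Reconciles the link of the boundary, which occurs in [mu], with the boundary of the link, which
    occurs in the equality condition. *)
Lemma link_boundary : link (boundary D) [set v] = boundary L.
Proof.
apply/setP=> A; rewrite mem_link1; last exact: boundary_sc.
rewrite [RHS]inE; apply/andP/existsP => [[vA /mem_boundary[R [RD Rd Rc AR]]]|[R]].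
  have vR : v \in R by apply: (subsetP AR); rewrite setU11.
  have vS : v \notin R :\ v by rewrite !inE eqxx.
  have Sd : #|R :\ v|.+1 = d by rewrite -Rd (cardsD1 v R) vR.
  exists (R :\ v); rewrite /ridge link_rank Sd eqxx andbT.
  rewrite (card_facets_over link_facet Sd) cofaces_link // setD1K // Rc eqxx.
  by rewrite LP vS setD1K // RD subsetD1 vA (subset_trans (subsetUr _ _) AR).
rewrite /ridge link_rank => /and3P[/andP[RL /eqP Rd]].
rewrite (card_facets_over link_facet Rd) => /eqP Rc AR.
move: RL; rewrite LP => /andP[vR vRD].
split; first by apply: contra vR; apply: subsetP.
apply/mem_boundary; exists (v |: R); split=> //.
- by rewrite cardsU1 vR.
- by rewrite -cofaces_link.
exact: setUS.
Qed.

Definition link_cells : {set {set T}} := [set F in L | #|F| == d].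
Let K := link_cells.

Let KP F : (F \in K) = [&& v \notin F, v |: F \in D & #|F| == d].
Proof. by rewrite inE LP andbA. Qed.

Lemma link_cells_card F : F \in K -> #|F| = d.
Proof. by rewrite KP => /and3P[_ _ /eqP]. Qed.

Lemma link_cells_notin F : F \in K -> v \notin F.
Proof. by rewrite KP => /and3P[]. Qed.

Let cofaces_cells R : v \notin R -> #|R|.+1 = d -> cofaces K R = cofaces D (v |: R).
Proof.
move=> vR Rd; rewrite -cofaces_link //; apply/setP=> x; rewrite [LHS]in_set [RHS]in_set [_ \in K]in_set.
by case: (boolP (x \in R)) => //= xR; rewrite cardsU1 xR add1n Rd eqxx andbT.
Qed.

Lemma bd2_link_cells R : v \notin R -> #|R|.+1 = d ->
  bd2 K R = (#|cofaces D (v |: R)| == 1).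
Proof.
move=> vR Rd; rewrite bd2_odd -/(cofaces K R) cofaces_cells //.
have := @cofaces_le2 (v |: R); rewrite cardsU1 vR => /(_ Rd).
by case: #|_| => [|[|[|]]].
Qed.

(** Induction on the codimension of a common face [A] containing [v]: a path in the connected link
    of [A] gives facets each sharing with the next a face larger than [A]. In codimension one the
    facets are adjacent. *)
Lemma star_strongly_connected (P : {set T} -> Prop) :
    (forall R x y, #|R| = d -> v \in R -> x \notin R -> y \notin R ->
       x |: R \in D -> y |: R \in D -> P (x |: R) -> P (y |: R)) ->
  forall F F', F \in D -> F' \in D -> #|F| = d.+1 -> #|F'| = d.+1 ->
    v \in F -> v \in F' -> P F -> P F'.
Proof.
move=> adj; suff main m A : d.+1 - #|A| <= m -> v \in A -> A \in D ->
    forall F F', F \in D -> F' \in D -> #|F| = d.+1 -> #|F'| = d.+1 ->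
    A \subset F -> A \subset F' -> P F -> P F'.
  move=> F F' FD F'D Fd F'd vF vF'; apply: (main d.+1 [set v]); rewrite ?leq_subr ?set11 ?sub1set //.
  by move: vD; rewrite inE.
elim: m A => [|m IH] A Am vA AD F F' FD F'D Fd F'd AF AF' PF.
  have Ad : d.+1 <= #|A| by rewrite -subn_eq0 -leqn0.
  have FA : A = F by apply/eqP; rewrite eqEcard AF Fd.
  by have F'A : A = F' by [apply/eqP; rewrite eqEcard AF' F'd]; rewrite -F'A FA.
have [Ad|Ad|Ad] := ltngtP #|A| d; last first.
- have pt G : G \in D -> #|G| = d.+1 -> A \subset G -> exists2 x, x \notin A & G = x |: A.
    move=> GD Gd AG; have : #|G :\: A| = 1 by rewrite cardsD (setIidPr AG) Gd Ad subSnn.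
    move=> /eqP/cards1P[x xE]; have : x \in G :\: A by rewrite xE set11.
    rewrite inE => /andP[xA xG]; exists x => //.
    by rewrite -[LHS](setID _ A) (setIidPr AG) xE setUC.
  have [x xA FE] := pt F FD Fd AF; have [y yA F'E] := pt F' F'D F'd AF'.
  by rewrite F'E; apply: (adj A x y); rewrite -?FE -?F'E.
- have FA : A = F by apply/eqP; rewrite eqEcard AF Fd.
  by have F'A : A = F' by [apply/eqP; rewrite eqEcard AF' F'd]; rewrite -F'A FA.
have [_ _ _ _ links] := D_npm.
have A0 : A != set0 by apply/set0Pn; exists v.
have Lc := links A AD A0 Ad.
have ex G : G \in D -> #|G| = d.+1 -> A \subset G -> exists2 x, x \in G & x \in vertices (link D A).
  move=> GD Gd AG; have /card_gt0P[x] : 0 < #|G :\: A|.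
    by rewrite cardsD (setIidPr AG) Gd subn_gt0 ltnW.
  rewrite inE => /andP[xA xG]; exists x => //.
  rewrite !inE disjoints1 xA andbT; apply/andP; split; apply: D_sc GD _.
    by rewrite sub1set.
  by rewrite subUset sub1set xG.
have vert x : x \in vertices (link D A) -> x \notin A /\ x |: A \in D.
  by rewrite !inE disjoints1 => /and3P[_ -> ->].
have [x xF xV] := ex F FD Fd AF; have [y yF' yV] := ex F' F'D F'd AF'.
have /connectP[p] := Lc x y xV yV.
have step z G G' : z \in vertices (link D A) -> G \in D -> G' \in D ->
    #|G| = d.+1 -> #|G'| = d.+1 -> z |: A \subset G -> z |: A \subset G' -> P G -> P G'.
  move=> /vert[zA zAD]; apply: IH => //; last by rewrite setU1r.
  by rewrite cardsU1 zA add1n subSS; rewrite subSn ?ltnS // in Am; apply: ltnW.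
elim: p x xV F FD Fd AF xF PF => [|z p IHp] x xV F FD Fd AF xF PF /=.
  move=> _ yx; apply: (step x F) => //; first by rewrite subUset sub1set xF.
  by rewrite subUset sub1set -yx yF'.
move=> /andP[xz zp] yE.
have [G GD /andP[/eqP Gd xzG]] : exists2 G, G \in D & (#|G| == d.+1) && ([set x; z] :|: A \subset G).
  by apply: npm_ext; move: xz; rewrite !inE => /and3P[].
have zV : z \in vertices (link D A).
  have := xz; rewrite /= inE => /and3P[xzD xzAD dis].
  rewrite !in_set; apply/and3P; split.
  - by apply: D_sc xzD _; rewrite sub1set set22.
  - by apply: D_sc xzAD _; rewrite setSU // sub1set set22.
  by move: dis; rewrite disjointsU_eq => /andP[].
move: xzG; rewrite !subUset !sub1set => /andP[/andP[xG zG] AG].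
apply: (IHp z zV G) => //; apply: (step x F) => //; by rewrite subUset sub1set ?xF ?xG.
Qed.

(** The bound on facets per ridge gives the two-cell condition, and the connected links give strong
    connectedness of the star of [v]. *)
Lemma link_cycle : min_cycle d (cone_off d v K).
Proof.
apply: cone_off_min; [exact: link_cells_card | exact: link_cells_notin | | |].
- move=> R x y Rd xR yR xK yK xy; rewrite -/(cofaces K R).
  have vR : v \notin R.
    by have := link_cells_notin xK; rewrite in_setU1 negb_or => /andP[].
  apply/eqP; rewrite eqn_leq {1}cofaces_cells // cofaces_le2 ?cardsU1 ?vR //=.
  have <- : #|[set x; y]| = 2 by rewrite cards2 xy.
  by apply: subset_leq_card; apply/subsetP=> z /set2P[]->; rewrite inE ?xR ?yR.
- move=> Z ZK /set0Pn[F FZ] strong; apply/eqP; rewrite eqEsubset ZK /=.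
  apply/subsetP=> F' F'K; have FK := subsetP ZK _ FZ.
  have facet' G : G \in K -> (v |: G \in D) /\ #|v |: G| = d.+1.
    by rewrite KP => /and3P[vG -> /eqP Gd]; rewrite cardsU1 vG Gd.
  have [FD Fd] := facet' F FK; have [F'D F'd] := facet' F' F'K.
  have vF := link_cells_notin FK; have vF' := link_cells_notin F'K.
  suff : (v |: F') :\ v \in Z by rewrite setU1K.
  apply: (@star_strongly_connected (fun G => G :\ v \in Z) _ (v |: F)); rewrite ?setU11 ?setU1K //.
  move=> R x y Rd vR xR yR xD yD.
  have rem z : z \notin R -> (z |: R) :\ v = z |: (R :\ v).
    move=> zR; have zv : z != v by apply: contraNneq zR => ->.
    apply/setP=> w; rewrite !(in_setD1, in_setU1).
    by case: (eqVneq w v) => [->|//]; rewrite /= orbF eq_sym (negPf zv).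
  rewrite !rem // => xZ; apply: (strong _ x) xZ _ => //.
  + by rewrite -Rd (cardsD1 v R) vR.
  + by rewrite inE (negPf xR) andbF.
  + by rewrite inE (negPf yR) andbF.
  rewrite KP -rem // setD1K ?yD ?inE ?vR ?orbT ?eqxx //=.
  rewrite rem // cardsU1 in_setD1 (negPf yR) andbF add1n.
  by rewrite -Rd (cardsD1 v R) vR.
have [F FL /andP[Fd _]] := link_ext set0_link.
by apply/set0Pn; exists F; rewrite inE FL.
Qed.

End Vertex.

End Link.

Local Open Scope ring_scope.

(** * Expected number of components *)

Definition wt (a b : nat) : rat := (a`! * b`!)%:R / ((a + b).+1)`!%:R.

Lemma fact_neq0 n : n`!%:R != 0 :> rat.
Proof. by rewrite pnatr_eq0 -lt0n fact_gt0. Qed.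

Lemma wt_gt0 a b : 0 < wt a b.
Proof. by rewrite divr_gt0 // ltr0n ?muln_gt0 !fact_gt0. Qed.

(** Under the integral this is [p + (1 - p) = 1]: deciding one further vertex. *)
Lemma wt_split a b : wt a.+1 b + wt a b.+1 = wt a b.
Proof.
rewrite /wt addSn addnS -mulrDl -natrD !factS.
have := fact_neq0 (a + b).+1; rewrite factS => h.
apply/eqP; rewrite eqr_div ?mulf_neq0 ?pnatr_eq0 -?lt0n ?muln_gt0 ?fact_gt0 //.
by rewrite -!natrM eqr_nat; apply/eqP; lia.
Qed.

(** Identifies the weight of a subset in [sigma] with a Beta integral. *)
Lemma wt_bin (n m : nat) : (m <= n)%N ->
  n.+1%:R^-1 * 'C(n, m)%:R^-1 = wt m (n - m).
Proof.
move=> mn; rewrite /wt subnKC // -invfM -natrM factS -(bin_fact mn) mulnA.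
rewrite [X in _ = _ / X]natrM [X in _ = _ * X]invfM mulrCA mulfV ?mulr1 //.
by rewrite pnatr_eq0 muln_eq0 !gtn_eqF ?fact_gt0.
Qed.

Lemma wt0E b : wt 0 b = b.+1%:R^-1.
Proof. by have := wt_bin (leq0n b); rewrite bin0 invr1 mulr1 subn0 => <-. Qed.

Lemma wt1E b : wt 1 b = (b.+1 * b.+2)%:R^-1.
Proof. by have := @wt_bin b.+1 1 isT; rewrite bin1 subn1 natrM invfM mulrC => <-. Qed.

Lemma wt1_anti b b' : (b <= b')%N -> wt 1 b' <= wt 1 b.
Proof.
move=> bb'; rewrite !wt1E lef_pV2 ?posrE ?ltr0n ?muln_gt0 //.
by rewrite ler_nat leq_mul.
Qed.

Lemma eq_sum_le (I : finType) (P : pred I) (f g : I -> rat) :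
    (forall i, P i -> f i <= g i) ->
    \sum_(i | P i) f i = \sum_(i | P i) g i ->
  forall i, P i -> f i = g i.
Proof.
move=> fg eqfg i Pi; apply/esym/eqP; rewrite -subr_eq0.
apply/eqP/(psumr_eq0P (P := P) (F := fun i => g i - f i)) => //.
  by move=> j Pj; rewrite subr_ge0 fg.
by rewrite sumrB eqfg subrr.
Qed.

Section Subsets.

Variable T : finType.
Implicit Types (V W X N : {set T}).

Lemma big_subset_setU1 (f : {set T} -> rat) x V : x \notin V ->
  \sum_(W : {set T} | W \subset x |: V) f W =
    \sum_(W : {set T} | W \subset V) (f W + f (x |: W)).
Proof.
move=> xV; rewrite (bigID (fun W : {set T} => x \notin W)) /= big_split /=.
congr (_ + _).
  apply: eq_bigl => W; apply/andP/idP => [[WV xW]|WV].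
    by rewrite -(setU1K xV) subsetD1 WV.
  by split; [apply: subset_trans WV (subsetUr _ _) | apply: contra xV; apply: subsetP].
rewrite (reindex_onto (fun W => x |: W) (fun W => W :\ x)) /=.
  apply: eq_bigl => W; rewrite setU11 /= subUset sub1set setU11 /= andbT.
  apply/andP/idP => [[WV /eqP<-]|WV].
    by rewrite -(setU1K xV) setSD // subUset sub1set setU11.
  split; first exact: subset_trans WV (subsetUr _ _).
  by rewrite setU1K //; apply: contra xV; apply: subsetP.
by move=> W /andP[_]; rewrite negbK => /setD1K.
Qed.

Lemma cardsU1D x V W : x \notin V -> W \subset V ->
  #|(x |: V) :\: W| = #|V :\: W|.+1.
Proof.
move=> xV WV; have xW : x \notin W by apply: contra xV; apply: subsetP.
have -> : (x |: V) :\: W = x |: (V :\: W).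
  by apply/setP=> y; rewrite !inE; have [->|] //= := eqVneq y x; rewrite xW.
by rewrite cardsU1 !inE (negPf xV) andbF.
Qed.

Lemma cardsU1DU1 x V W : x \notin V -> #|(x |: V) :\: (x |: W)| = #|V :\: W|.
Proof.
move=> xV; apply: eq_card => y; rewrite !inE; have [->|] //= := eqVneq y x.
by rewrite (negPf xV) andbF.
Qed.

(** The choices at the vertices of [V] have total probability 1, leaving the integral of
    [p ^ i (1 - p) ^ j]. *)
Lemma sum_wt V i j :
  \sum_(W : {set T} | W \subset V) wt (#|W| + i) (#|V :\: W| + j) = wt i j.
Proof.
move: {2}#|V| (erefl #|V|) => n; elim: n V i j => [|n IH] V i j cV.
  move/eqP: cV; rewrite cards_eq0 => /eqP->.
  rewrite (big_pred1 set0) => [|W]; last by rewrite subset0.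
  by rewrite cards0 setD0 cards0.
have /set0Pn[x xV] : V != set0 by rewrite -cards_eq0 cV.
have xVx : x \notin V :\ x by rewrite setD11.
rewrite -{1}(setD1K xV) big_subset_setU1 // -(wt_split i j) -!(IH (V :\ x)); last 2 first.
- by move: cV; rewrite (cardsD1 x) xV => -[].
- by move: cV; rewrite (cardsD1 x) xV => -[].
rewrite -big_split /=; apply: eq_bigr => W WV; rewrite addrC.
have xW : x \notin W by apply: contra xVx; apply: subsetP.
rewrite -{1 2}(setD1K xV) cardsU1D // cardsU1DU1 // cardsU1 xW.
by rewrite add1n !addSnnS.
Qed.

Lemma sum_wt1 V :
  \sum_(W : {set T} | W \subset V) wt #|W| #|V :\: W| = 1.
Proof.
transitivity (wt 0 0); last by rewrite wt0E invr1.
by rewrite -(sum_wt V); apply: eq_bigr => W _; rewrite !addn0.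
Qed.

(** Each vertex of [N] must be omitted and contributes a factor [1 - p]. *)
Lemma sum_wt_disjoint V N i j : N \subset V ->
  \sum_(W : {set T} | (W \subset V) && [disjoint W & N])
     wt (#|W| + i) (#|V :\: W| + j) = wt i (#|N| + j).
Proof.
move=> NV; rewrite -(sum_wt (V :\: N)).
apply: eq_big => W; first by rewrite subsetD.
move=> /andP[WV dWN]; congr wt; rewrite addnA; congr (_ + _)%N.
have -> : V :\: W = (V :\: N :\: W) :|: N.
  apply/setP=> y; rewrite !inE; have [yN|] /= := boolP (y \in N).
    by rewrite orbT (disjointFl dWN yN) (subsetP NV).
  by rewrite orbF.
rewrite cardsU; suff -> : (V :\: N :\: W) :&: N = set0 by rewrite cards0 subn0.
by apply/setP=> y; rewrite !inE; case: (y \in N); rewrite ?andbF.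
Qed.

End Subsets.

Section Phi.

Variable T : finType.
Implicit Types (e : rel T) (R V W X N K : {set T}) (x y u v : T).

(* Choosing p in [0, 1] uniformly and then W by keeping each vertex of V :\: R
   with probability p, this is the expected number of components of W :|: R:
   wt a b is the integral of p ^ a (1 - p) ^ b. *)
Definition phi e R V : rat :=
  \sum_(W : {set T} | W \subset V :\: R)
     wt #|W| #|V :\: R :\: W| * #|comps e (W :|: R)|%:R.

Lemma eq_phi e e' R V : R \subset V ->
    {in V &, forall x y, x != y -> e x y = e' x y} ->
  phi e R V = phi e' R V.
Proof.
move=> RV ee'; apply: eq_bigr => W WV; congr (_ * _%:R); congr #|(_ : {set {set T}})|.
have /subsetP s : W :|: R \subset V by rewrite subUset RV (subset_trans WV (subsetDl _ _)).
by apply: eq_comps => x y xW yW; apply: ee'; apply: s.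
Qed.

Lemma le_phi e e' R V : symmetric e' -> R \subset V ->
    {in V &, forall x y, x != y -> e x y -> e' x y} ->
  phi e' R V <= phi e R V.
Proof.
move=> e'_sym RV ee'; apply: ler_sum => W WV.
rewrite ler_wpM2l ?(ltW (wt_gt0 _ _)) // ler_nat leq_card_comps // => x y xW yW.
have /subsetP s : W :|: R \subset V by rewrite subUset RV (subset_trans WV (subsetDl _ _)).
by apply: ee'; apply: s.
Qed.

(** All weights are positive, and an additional edge [xy] already lowers the component count of the
    set [{x, y}]. *)
Lemma eq_phi_rel e e' V : symmetric e -> symmetric e' ->
    {in V &, forall x y, x != y -> e x y -> e' x y} ->
  phi e' set0 V = phi e set0 V ->
  {in V &, forall x y, x != y -> e x y = e' x y}.
Proof.
move=> e_sym e'_sym ee' eqphi x y xV yV xy; apply/idP/idP; first exact: ee'.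
apply: contraTT => nexy; apply/negP => e'xy.
have le W : W \subset V :\: set0 ->
    wt #|W| #|V :\: set0 :\: W| * #|comps e' (W :|: set0)|%:R <=
    wt #|W| #|V :\: set0 :\: W| * #|comps e (W :|: set0)|%:R.
  rewrite setD0 setU0 => /subsetP WV; rewrite ler_wpM2l ?(ltW (wt_gt0 _ _)) //.
  by rewrite ler_nat leq_card_comps // => a b aW bW; apply: ee'; apply: WV.
have xyV : [set x; y] \subset V :\: set0.
  by rewrite setD0; apply/subsetP=> z /set2P[]->.
have := eq_sum_le le eqphi xyV.
move=> /(mulfI (lt0r_neq0 (wt_gt0 _ _)))/eqP; rewrite eqr_nat setU0.
rewrite (card_comps_pair e_sym) // (@comps_conn _ e' [set x; y]) ?cards1 //.
  exact: (conn_setU1 e'_sym (@conn1 _ _ y) (set11 y) e'xy).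
by apply/set0Pn; exists x; rewrite !inE eqxx.
Qed.

(** The expectation is the probability that the random set is nonempty. *)
Lemma phi_conn e V : symmetric e ->
    (forall W : {set T}, W \subset V -> W != set0 -> conn e W) ->
  phi e set0 V = 1 - #|V|.+1%:R^-1.
Proof.
move=> e_sym VK; rewrite /phi setD0.
rewrite -wt0E -[X in _ = X - _](sum_wt1 V) [in RHS](bigD1 set0) ?sub0set //=.
rewrite [in LHS](bigD1 set0) ?sub0set //= setU0 comps0 !cards0 mulr0 add0r setD0.
rewrite addrC addrK; apply: eq_bigr => W /andP[WV W0].
by rewrite setU0 comps_conn ?cards1 ?mulr1 //; apply: VK.
Qed.

Lemma phi_hub e r V : symmetric e -> r \in V ->
    {in V, forall x, x != r -> e r x} -> phi e [set r] V = 1.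
Proof.
move=> e_sym rV er; rewrite -(sum_wt1 (V :\ r)).
apply: eq_bigr => W WV; rewrite comps_conn ?cards1 ?mulr1 //; last first.
  by apply/set0Pn; exists r; rewrite !inE eqxx orbT.
have cr x : x \in W :|: [set r] -> connect (within e (W :|: [set r])) r x.
  move=> xW; have [->|xr] := eqVneq x r; first exact: connect0.
  apply: connect1; rewrite /within /= xW !inE eqxx orbT er //.
  by move: xW; rewrite !inE (negPf xr) orbF => /(subsetP WV); rewrite !inE xr.
move=> x y /cr cx /cr; apply: connect_trans; by rewrite connect_within_sym.
Qed.

Section Contraction.

Variables (e : rel T) (R V : {set T}) (u v : T).
Hypothesis e_sym : symmetric e.
Hypotheses (uV : u \in V :\: R) (vV : v \in V :\: R) (uv : u != v) (euv : e u v).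

Let A := V :\: R :\: [set u; v].

(** For a fixed choice [X] off [u] and [v], the four states of these two vertices against the two
    states of the merged vertex leave [p (1 - p)] times the inclusion-exclusion term. *)
Lemma phi_contractE :
  phi e R V - phi (contract e u v) R (V :\ v) =
    \sum_(X : {set T} | X \subset A) wt (#|X| + 1) (#|A :\: X| + 1) *
       (1 - (bridges e u v (X :|: R))%:R).
Proof.
have uA : u \notin A by rewrite !inE eqxx.
have vA : v \notin A by rewrite !inE eqxx orbT.
have vuA : u \notin v |: A by rewrite !inE eqxx (negPf uv).
have [uR vR] : u \notin R /\ v \notin R.
  by move: uV vV; rewrite !inE => /andP[-> _] /andP[-> _].
have VE : V :\: R = u |: (v |: A).
  apply/setP=> x; rewrite !inE; have [->|_] //= := eqVneq x u.
    by move: uV; rewrite inE.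
  by have [->|_] //= := eqVneq x v; move: vV; rewrite inE.
have V'E : V :\ v :\: R = u |: A.
  apply/setP=> x; rewrite !inE; have [->|_] //= := eqVneq x u.
    by move: uV; rewrite inE uv.
  by rewrite andbCA.
rewrite /phi V'E VE 3?big_subset_setU1 // -sumrB; apply: eq_bigr => X XA.
have [uX vX] : u \notin X /\ v \notin X.
  by split; [apply: contra uA | apply: contra vA]; apply: subsetP.
have uXR : u \notin X :|: R by rewrite inE negb_or uX.
have vXR : v \notin X :|: R by rewrite inE negb_or vX.
have XvA : X \subset v |: A by apply: subset_trans XA (subsetUr _ _).
rewrite -!setUA (comps_contract e v uXR) (card_comps_contract e_sym uv uXR vXR euv).
rewrite !cardsU1 !inE (negPf uX) (negPf vX) (negPf uv) /= !add1n.
have vuA' : v \notin u |: A by rewrite !inE eqxx eq_sym (negPf uv) orbT.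
have XuA : X \subset u |: A by apply: subset_trans XA (subsetUr _ _).
have ie := card_comps_inclusion_exclusion e_sym uv uXR vXR euv.
have {ie} := congr1 (fun n : nat => n%:R : rat) ie; rewrite /= !natrD => ie.
rewrite cardsU1DU1 // [in X in _ + (X + _)]setUCA !cardsU1DU1 // !cardsU1D //.
have -> : 1 - (bridges e u v (X :|: R))%:R =
    #|comps e (u |: (X :|: R))|%:R + #|comps e (v |: (X :|: R))|%:R
    - #|comps e (u |: (v |: (X :|: R)))|%:R - #|comps e (X :|: R)|%:R :> rat.
  by move: ie; move: (_%:R : rat) (_%:R : rat) (_%:R : rat) (_%:R : rat) (_%:R : rat) => *; lra.
rewrite -(wt_split #|X| #|A :\: X|.+1) -(wt_split #|X|.+1 #|A :\: X|) !addn1.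
by ring.
Qed.

Section CommonNeighbours.

Variables (d : nat) (N : {set T}).
Hypotheses (NV : N \subset V) (uN : u \notin N) (vN : v \notin N).
Hypotheses (eN : {in N, forall y, e u y && e v y}) (dN : (d <= #|N|.+1)%N).

Lemma bridges_gt0 X : u \notin X -> v \notin X -> ~~ [disjoint X & N] ->
  (0 < bridges e u v X)%N.
Proof.
move=> uX vX /meetP[y yX yN]; have /andP[uy vy] := eN yN.
apply/card_gt0P; exists (component e X y); rewrite inE comp_comps //=.
by apply/andP; split; apply/meetP; exists y; rewrite ?mem_comp ?inE.
Qed.

Lemma bridges_term_le X : X \subset A ->
  1 - (bridges e u v (X :|: R))%:R <= [disjoint X :|: R & N]%:R :> rat.
Proof.
move=> XA; case: (boolP [disjoint _ & _]) => dXN /=.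
  by rewrite lerBlDr lerDl ler0n.
rewrite subr_le0 ler1n; apply: bridges_gt0 => //; rewrite inE negb_or.
  move: uV; rewrite inE => /andP[-> _]; rewrite andbT.
  by apply/negP => /(subsetP XA); rewrite !inE eqxx.
move: vV; rewrite inE => /andP[-> _]; rewrite andbT.
by apply/negP => /(subsetP XA); rewrite !inE eqxx orbT.
Qed.

Lemma sum_disjoint_le :
  \sum_(X : {set T} | X \subset A) wt (#|X| + 1) (#|A :\: X| + 1) *
      [disjoint X :|: R & N]%:R <= wt 1 d.
Proof.
have [dRN|dRN] := boolP [disjoint R & N]; last first.
  rewrite big1 ?(ltW (wt_gt0 _ _)) // => X _.
  by rewrite disjointsU_eq (negPf dRN) andbF mulr0.
have NA : N \subset A.
  apply/subsetP=> y yN; rewrite !inE (subsetP NV) // (disjointFl dRN yN) andbT.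
  by rewrite negb_or !andbT; apply/andP; split; [apply: contraNneq uN => <-| apply: contraNneq vN => <-].
apply: le_trans (wt1_anti dN); rewrite -[#|N|.+1]addn1 -(sum_wt_disjoint 1 1 NA).
rewrite big_mkcondr /=; apply: ler_sum => X XA.
by rewrite disjointsU_eq dRN andbT; case: ifP => _; rewrite ?mulr1 ?mulr0.
Qed.

Lemma phi_contract_le :
  phi e R V <= phi (contract e u v) R (V :\ v) + wt 1 d.
Proof.
rewrite -lerBlDl phi_contractE; apply: le_trans sum_disjoint_le.
apply: ler_sum => X XA; rewrite ler_wpM2l ?(ltW (wt_gt0 _ _)) //.
exact: bridges_term_le.
Qed.

(** The bound is a sum of termwise bounds with positive weights, so equality holds in each of
    them. *)
Lemma phi_contract_eq X : X \subset A ->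
    phi e R V = phi (contract e u v) R (V :\ v) + wt 1 d ->
  bridges e u v (X :|: R) = ~~ [disjoint X :|: R & N] :> nat.
Proof.
move=> XA eqphi.
have le (Y : {set T}) : Y \subset A ->
    wt (#|Y| + 1) (#|A :\: Y| + 1) * (1 - (bridges e u v (Y :|: R))%:R) <=
    wt (#|Y| + 1) (#|A :\: Y| + 1) * [disjoint Y :|: R & N]%:R.
  by move=> YA; rewrite ler_wpM2l ?(ltW (wt_gt0 _ _)) //; apply: bridges_term_le.
have eqs : \sum_(X : {set T} | X \subset A) wt (#|X| + 1) (#|A :\: X| + 1) *
       (1 - (bridges e u v (X :|: R))%:R) =
    \sum_(X : {set T} | X \subset A) wt (#|X| + 1) (#|A :\: X| + 1) *
      [disjoint X :|: R & N]%:R.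
  apply/eqP; rewrite eq_le ler_sum //= -phi_contractE.
  apply: le_trans sum_disjoint_le _; lra.
have /(mulfI (lt0r_neq0 (wt_gt0 _ _))) := eq_sum_le le eqs XA.
case: [disjoint _ & _] => /= h; apply/eqP; rewrite -(eqr_nat rat); apply/eqP; lra.
Qed.

End CommonNeighbours.

End Contraction.

End Phi.

Section Simplicial.

Variable T : finType.
Implicit Types (e : rel T) (V X K : {set T}) (x y z : T).

(** The chosen neighbours of [x] lie in one component, so [x] creates a component exactly when none
    is chosen, with probability [p (1 - p)] raised in its second factor to the degree of [x]. *)
Lemma phi_simplicial e V x : symmetric e -> x \notin V -> simplicial e V x ->
  phi e set0 (x |: V) = phi e set0 V + wt 1 #|V :&: nbr e x|.
Proof.
move=> e_sym xV simp; set N := V :&: nbr e x in simp *.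
have NV : N \subset V by apply: subsetIl.
apply/eqP; rewrite addrC -subr_eq; apply/eqP.
rewrite -(addn0 #|N|) -(sum_wt_disjoint 1 0 NV) /phi !setD0.
rewrite big_subset_setU1 // -sumrB [RHS]big_mkcondr /=; apply: eq_bigr => X XV.
have xX : x \notin X by apply: contra xV; apply: subsetP.
rewrite !setU0 cardsU1D // cardsU1DU1 // cardsU1 xX add1n addn0 addn1.
rewrite -(wt_split #|X| #|V :\: X|).
have kE : kappa e (nbr e x) X = ~~ [disjoint X & N].
  rewrite /kappa; have [dXN|/meetP[y yX yN]] /= := boolP [disjoint X & N].
    apply/eqP; rewrite cards_eq0; apply/eqP/setP=> K; rewrite !inE.
    apply/negbTE/negP => /andP[/(compsP e_sym)[_ KX _ _] /meetP[z zK zx]].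
    have zX := subsetP KX _ zK.
    by have := disjointFr dXN zX; rewrite inE (subsetP XV) ?zx.
  suff -> : [set K in comps e X | ~~ [disjoint K & nbr e x]] =
      [set component e X y] by rewrite cards1.
  apply/setP=> K; rewrite !inE; apply/andP/eqP => [[Kc /meetP[z zK zx]]|->].
    have /(compsP e_sym)[_ KX _ Kcl] := Kc.
    apply: (comps_eq e_sym Kc (comp_comps e yX) _ (mem_comp e yX)).
    have [<-//|zy] := eqVneq z y.
    apply: (Kcl z) => //; apply: simp => //.
    by rewrite inE zx (subsetP XV) ?(subsetP KX).
  split; first exact: comp_comps.
  by apply/meetP; exists y; rewrite ?mem_comp //; move: yN; rewrite inE => /andP[].
have := congr1 (fun n : nat => n%:R : rat) (card_comps_setU1 e_sym xX).
rewrite /= !natrD kE => h.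
have {h} -> : #|comps e (x |: X)|%:R =
   #|comps e X|%:R + 1 - (~~ [disjoint X & N])%:R :> rat by rewrite -h addrK.
by case: [disjoint X & N] => /=; ring.
Qed.

End Simplicial.

(** * Growth along a minimal cycle *)

Section Spanning.

Variables (T : finType) (d : nat) (R : {set T}).
Hypotheses (d_ge3 : (3 <= d)%N) (R_le1 : (#|R| <= 1)%N).
Implicit Types (e : rel T) (U V X K N F : {set T}) (C P : {set {set T}}).
Implicit Types (u v x y : T).

(** The invariant of the growth argument. [R] is the set of forced vertices: empty for interior
    vertices, the apex for boundary vertices. Chordality is tracked in the first case. *)
Definition extends e U V : Prop :=
  [/\ U \subset V, phi e R V <= phi e R U + wt 1 d * #|V :\: U|%:R
    & R = set0 -> phi e R V = phi e R U + wt 1 d * #|V :\: U|%:R ->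
      chordal e U -> chordal e V].

Lemma extends_refl e U : extends e U U.
Proof. by split; rewrite ?setDv ?cards0 ?mulr0 ?addr0. Qed.

Lemma extends_trans e U V W : extends e U V -> extends e V W -> extends e U W.
Proof.
move=> [UV le1 ch1] [VW le2 ch2].
have cE : #|W :\: U|%:R = #|V :\: U|%:R + #|W :\: V|%:R :> rat.
  rewrite -natrD; congr _%:R; rewrite -(cardsID V (W :\: U)).
  congr (#|(_ : {set T})| + #|(_ : {set T})|)%N; apply/setP=> x; rewrite !inE.
    by case: (boolP (x \in V)) => [/(subsetP VW)->|]; rewrite ?andbT ?andbF.
  by case: (boolP (x \in V)) => //= xV; case: (boolP (x \in U)) => // /(subsetP UV) h; rewrite h in xV.
split; first exact: subset_trans VW.
  by rewrite cE mulrDr addrA; apply: le_trans le2 _; rewrite lerD2r.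
rewrite cE mulrDr addrA => R0 eqW chU.
have eqV : phi e R V = phi e R U + wt 1 d * #|V :\: U|%:R.
  by apply/eqP; rewrite eq_le le1 -(lerD2r (wt 1 d * #|W :\: V|%:R)) -eqW.
by apply: ch2; rewrite ?eqV //; apply: ch1.
Qed.

(** Only one inclusion of edges: after contractions [e] keeps edges of cells that cancelled. *)
Definition complete_on e C : Prop :=
  forall F, F \in C -> {in F &, forall x y, x != y -> e x y}.

Section PieceGeometry.

Variables (e : rel T) (C P : {set {set T}}) (u v : T) (Fv : {set T}).
Hypotheses (e_sym : symmetric e) (uv : u != v).
Hypotheses (Cm : min_cycle d C) (eC : complete_on e C).
Hypotheses (FvC : Fv \in C) (uFv : u \in Fv) (vFv : v \in Fv).
Hypothesis PC : piece d u v C P.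

Let Pc : mod2_cycle d P.
Proof. by have [/min_cycleP[]] := PC. Qed.

(** Otherwise all cells of [P] are in [C], minimality gives [P = C], and [Fv] contains both [u] and
    [v]. *)
Lemma piece_has_pair : exists2 K, K \in P & (u \in K) && (v \in K).
Proof.
have [Pm PsC _] := PC; have /min_cycleP[_ P0 _] := Pm.
apply/exists_inP; apply: contraT; rewrite negb_exists_in => /forall_inP noK.
have /min_cycleP[_ _ Cmin] := Cm.
have PC' : P = C.
  apply: Cmin => //; apply/subsetP=> K KP; apply: (subsetP PsC).
  by rewrite inE KP noK.
by have := noK Fv; rewrite PC' FvC uFv vFv => /(_ isT).
Qed.

(** A cell of [P] through [u] and [v] may be missing from [C], but its edges are not: exchanging
    whichever of [u] and [v] is not an end of the edge gives a nondegenerate cell, and the edge [uv]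
    lies in [Fv]. *)
Lemma piece_pair_in K x y : K \in P -> x \in K -> y \in K ->
  exists2 F, F \in C & (x \in F) && (y \in F).
Proof.
have [_ PsC _] := PC.
suff main w : w \in [set u; v] -> K \in P -> u \in K -> v \in K -> x \in K -> y \in K ->
    x != w -> y != w -> exists2 F, F \in C & (x \in F) && (y \in F).
  move=> KP xK yK; have [/andP[uK vK]|nK] := boolP ((u \in K) && (v \in K)); last first.
    by exists K; rewrite ?xK ?yK //; apply: (subsetP PsC); rewrite inE KP nK.
  have [xyu|] := boolP ((x != u) && (y != u)).
    by case/andP: xyu => xu yu; apply: (main u) => //; rewrite set21.
  have [xyv|] := boolP ((x != v) && (y != v)).
    by case/andP: xyv => xv yv _; apply: (main v) => //; rewrite set22.
  rewrite !negb_and !negbK => h1 h2; exists Fv => //.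
  case/orP: h1 => /eqP E1; case/orP: h2 => /eqP E2;
    by [case/eqP: uv; rewrite -E1 -E2 | rewrite E1 E2 uFv vFv].
move=> wuv KP uK vK xK yK xw yw.
have wK : w \in K by case/set2P: wuv => ->.
have [z zK zP] := cycle_ridge Pc KP wK.
exists (z |: (K :\ w)); last by rewrite !inE xw xK yw yK !orbT.
apply: (subsetP PsC); rewrite inE zP /=; apply/negP => /andP[].
have zw : w != z by apply: contraNneq zK => <-.
by case/set2P: wuv zw => -> zw; rewrite !inE eqxx (negPf zw) /= ?andbF.
Qed.

Lemma piece_complete : complete_on e P.
Proof.
move=> K KP x y xK yK xy.
by have [F FC /andP[xF yF]] := piece_pair_in KP xK yK; apply: eC FC _ _ xF yF xy.
Qed.

Lemma piece_cover : cover P \subset cover C.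
Proof.
apply/bigcupsP=> K KP; apply/subsetP=> x xK.
have [F FC /andP[xF _]] := piece_pair_in KP xK xK.
by apply/bigcupP; exists F.
Qed.

(** A cell through [u] and [v] provides [d - 2] common neighbours; exchanging one of them, which
    exists as [d >= 3], provides one more. *)
Lemma piece_common_nbrs : exists N,
  [/\ N \subset cover P, u \notin N, v \notin N,
      {in N, forall y, e u y && e v y} & (d <= #|N|.+1)%N].
Proof.
have [K KP /andP[uK vK]] := piece_has_pair.
have Kd : #|K| = d by have /mod2_cycleP[Pd _] := Pc; apply: Pd.
have vKu : v \in K :\ u by rewrite !inE eq_sym uv.
have Kuv : #|K :\ u :\ v|.+2 = d.
  by rewrite -Kd (cardsD1 u K) uK (cardsD1 v (K :\ u)) vKu.
have /card_gt0P[x] : (0 < #|K :\ u :\ v|)%N by move: d_ge3; rewrite -Kuv.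
rewrite !inE => /and3P[xv xu xK].
have [y yK yP] := cycle_ridge Pc KP xK.
have eK := piece_complete KP; have eY := piece_complete yP.
have uY : u \in y |: (K :\ x) by rewrite !inE [u == x]eq_sym xu uK orbT.
have vY : v \in y |: (K :\ x) by rewrite !inE [v == x]eq_sym xv vK orbT.
have [yu yv] : y != u /\ y != v by split; apply: contraNneq yK => ->.
exists (y |: (K :\ u :\ v)); split.
- rewrite subUset sub1set; apply/andP; split.
    by apply/bigcupP; exists (y |: (K :\ x)); rewrite ?setU11.
  apply: subset_trans (subset_trans (subsetDl _ _) (subsetDl _ _)) _.
  exact: bigcup_sup KP.
- by rewrite !inE eq_sym (negPf yu) eqxx andbF.
- by rewrite !inE eq_sym (negPf yv) eqxx.
- move=> z /setU1P[->|].
    by rewrite (eY u y) ?(eY v y) ?setU11 // eq_sym.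
  by rewrite !inE => /and3P[zv zu zK]; rewrite (eK u z) ?(eK v z) // eq_sym.
by rewrite cardsU1 !inE (negPf yK) !andbF /= add1n Kuv.
Qed.

Lemma piece_fold_complete :
  complete_on (contract e u v) [set fold_face u v F | F in split_cells u v P].
Proof.
move=> _ /imsetP[F FP ->] x y.
have eF : {in F &, forall x y, x != y -> e x y}.
  by apply: piece_complete; move: FP; rewrite inE => /andP[].
rewrite /fold_face; case: ifP => vF; last first.
  by move=> xF yF xy; rewrite /contract /= eF.
rewrite !inE => /orP[/eqP->|/andP[xv xF]] /orP[/eqP->|/andP[yv yF]] xy.
- by rewrite eqxx in xy.
- by rewrite eq_sym in yv; rewrite /contract /= eqxx (eF v y vF yF yv) orbT.
- by rewrite /contract /= eqxx (eF x v xF vF xv) !orbT.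
by rewrite /contract /= eF.
Qed.

Lemma piece_fold_cover :
  cover [set fold_face u v F | F in split_cells u v P] = cover P :\ v.
Proof.
apply/setP=> x; rewrite in_setD1; apply/bigcupP/andP => [[_ /imsetP[F FP ->]]|].
  move=> xF; have xv : x != v by apply: contraTneq xF => ->; apply: fold_face_notin.
  have FP' : F \in P by move: FP; rewrite inE => /andP[].
  split=> //; move: xF; rewrite /fold_face; case: ifP => _ xF; last first.
    by apply/bigcupP; exists F.
  move: xF; rewrite !inE => /orP[/eqP->|/andP[_ xF]]; last by apply/bigcupP; exists F.
  by have [K KP /andP[uK _]] := piece_has_pair; apply/bigcupP; exists K.
move=> [xv /bigcupP[K KP xK]].
have [K' [K'P xK' nK']] : exists K', [/\ K' \in P, x \in K' & ~~ ((u \in K') && (v \in K'))].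
  have [/andP[uK vK]|nK] := boolP ((u \in K) && (v \in K)); last by exists K.
  have [z zK zP] := cycle_ridge Pc KP vK.
  exists (z |: (K :\ v)); split=> //; first by rewrite !inE xv xK orbT.
  have vz : v != z by apply: contraNneq zK => <-.
  by rewrite !inE eqxx (negPf vz) andbF.
exists (fold_face u v K'); first by rewrite imset_f // inE K'P.
by rewrite /fold_face; case: ifP => // _; rewrite !inE xv xK' orbT.
Qed.

End PieceGeometry.

Section Step.

Variables (e : rel T) (V N : {set T}) (u v : T).
Hypothesis e_sym : symmetric e.
Hypotheses (uV : u \in V :\: R) (vV : v \in V :\: R) (uv : u != v) (euv : e u v).
Hypotheses (NV : N \subset V) (uN : u \notin N) (vN : v \notin N).
Hypotheses (eN : {in N, forall y, e u y && e v y}) (dN : (d <= #|N|.+1)%N).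

(** By equality a set has one bridge if it meets [N] and none otherwise. So a connected set touching
    both ends meets [N], and two nonadjacent common neighbours, which would be two bridges, cannot
    exist. *)
Lemma chordal_contract_eq : R = set0 ->
    phi e R V = phi (contract e u v) R (V :\ v) + wt 1 d ->
  chordal (contract e u v) (V :\ v) -> chordal e V.
Proof.
move=> R0 eqphi.
have [uV' vV'] : u \in V /\ v \in V by move: uV vV; rewrite R0 setD0.
have br X : X \subset V :\: [set u; v] -> bridges e u v X = ~~ [disjoint X & N].
  move=> XV; rewrite -(setU0 X) -R0.
  have := phi_contract_eq e_sym uV vV uv euv NV uN vN eN dN _ eqphi.
  by apply; rewrite R0 setD0.
apply: chordal_uncontract => // [X XV Xc /meetP[x xX xu] /meetP[y yX yv]|y z].
  have := br X XV; have X0 : X != set0 by apply/set0Pn; exists x.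
  rewrite /bridges comps_conn //.
  have [dXN|/meetP[w wX wN] _] := boolP [disjoint X & N].
    move=> /eqP; rewrite cards_eq0 => /eqP/setP/(_ X); rewrite !inE eqxx /=.
    have -> : ~~ [disjoint X & nbr e u] by apply/meetP; exists x.
    by have -> : ~~ [disjoint X & nbr e v] by apply/meetP; exists y.
  by apply/meetP; exists w; rewrite // !inE eN.
rewrite !in_setI => /andP[yV /andP[yu yv]] /andP[zV /andP[zu zv]] yz.
apply: contraT => nyz.
have yzV : [set y; z] \subset V :\: [set u; v] by apply/subsetP=> w /set2P[]->.
have := br _ yzV; suff -> : bridges e u v [set y; z] = 2 by case: [disjoint _ & _].
transitivity #|comps e [set y; z]|; last exact: card_comps_pair.
apply: eq_card => K; rewrite inE.
case: (boolP (K \in comps e [set y; z])) => //= /(compsP e_sym)[/set0Pn[w wK] KX _ _].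
have [wu wv] : w \in nbr e u /\ w \in nbr e v.
  by have /set2P[->|->] := subsetP KX _ wK.
by apply/andP; split; apply/meetP; exists w.
Qed.

(** Contraction can only add edges inside [U], hence lower [phi] there. Equality overall forbids any
    such edge, so chordality of [U] passes to the contracted graph, grows there, and is lifted
    back. *)
Lemma extends_contract U : R \subset U -> U \subset V :\ v ->
  extends (contract e u v) U (V :\ v) -> extends e U V.
Proof.
move=> RU UV [_ le ch]; have UV' := subset_trans UV (subsetDl _ _).
have vV' : v \in V by move: vV; rewrite inE => /andP[].
have vU : v \notin U by apply/negP => /(subsetP UV); rewrite !inE eqxx.
have e'_sym := contract_sym e_sym u v.
have ee' : {in U &, forall x y, x != y -> e x y -> contract e u v x y}.
  by move=> x y _ _ _ exy; rewrite /contract /= exy.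
have leU : phi (contract e u v) R U <= phi e R U by apply: le_phi.
have leV := phi_contract_le e_sym uV vV uv euv NV uN vN eN dN.
have cE : #|V :\: U|%:R = #|V :\ v :\: U|%:R + 1 :> rat.
  rewrite (cardsD1 v (V :\: U)) inE vU vV' natrD addrC; congr (_%:R + _).
  by apply: eq_card => x; rewrite !inE andbCA.
split=> //.
  rewrite cE mulrDr mulr1 addrA; apply: le_trans leV _; rewrite lerD2r.
  by apply: le_trans le _; rewrite lerD2r.
rewrite cE mulrDr mulr1 addrA => R0 eqV chU.
have eqU : phi (contract e u v) R U = phi e R U by move: (_ * _) le eqV leV leU => *; lra.
have eqV' : phi e R V = phi (contract e u v) R (V :\ v) + wt 1 d.
  by move: (_ * _) le eqV leV leU => *; lra.
apply: (chordal_contract_eq R0 eqV'); apply: (ch R0).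
  by move: (_ * _) le eqV leV leU eqV' => *; lra.
move: eqU; rewrite R0 => eqU.
exact: eq_chordal (eq_phi_rel e_sym e'_sym ee' eqU) chU.
Qed.

End Step.

(** Induction on the vertices of [C] outside [U]. A piece through [F] is reached by contracting
    [uv]; the other pieces are then attached in the graph [e] itself, [v] being already reached. *)
Lemma extends_cycle e U C F : symmetric e -> min_cycle d C ->
    complete_on e C -> R \subset U -> F \in C -> F \subset U ->
  extends e U (U :|: cover C).
Proof.
have [n] := ubnP #|cover C :\: U|.
elim: n => // n IH in e U C F * => Cn e_sym Cm eC RU FC FU.
have [CU|/subsetPn[v]] := boolP (cover C \subset U).
  by rewrite (setUidPl CU); apply: extends_refl.
move=> /bigcupP[Fv FvC vFv] vU.
have /min_cycleP[Cc _ Cmin] := Cm; have /mod2_cycleP[Cd _] := Cc.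
have vC : v \in cover C by apply/bigcupP; exists Fv.
(* [Fv :\ v] has at least two vertices and [R] at most one. *)
have [u uFv /andP[uv uR]] : exists2 u, u \in Fv & (u != v) && (u \notin R).
  have : (0 < #|Fv :\ v :\: R|)%N.
    rewrite cardsD subn_gt0; apply: leq_ltn_trans (subset_leq_card (subsetIr _ _)) _.
    apply: leq_ltn_trans R_le1 _; have := d_ge3.
    by rewrite -(Cd _ FvC) (cardsD1 v Fv) vFv.
  by case/card_gt0P=> u; rewrite !inE => /and3P[uR uv uF]; exists u; rewrite ?uv.
have vF : v \notin F by apply: contra vU; apply: subsetP.
have euv : e u v by apply: (eC Fv).
have grow (W : {set T}) : v \in W -> W \subset U :|: cover C -> extends e U W ->
    extends e U (U :|: cover C).
  have [m] := ubnP #|cover C :\: W|.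
  elim: m => // m IHm in W * => Wm vW WUC UW.
  have [UsW _ _] := UW.
  pose S := [set G : {set T} | G \subset W].
  have [/existsP[P /and3P[/pieceP PC /exists_inP[K KP KW] nPW]]|noP] := boolP
    [exists P : {set {set T}}, [&& is_piece d u v C P,
      [exists K in P, K \subset W] & ~~ (cover P \subset W)]].
    have Pcov := piece_cover uv FvC uFv vFv PC.
    have [Pm _ _] := PC.
    apply: (IHm (W :|: cover P)).
    - rewrite -ltnS; apply: leq_trans Wm; rewrite ltnS; apply: proper_card.
      rewrite properE setDS ?subsetUl //=; apply/subsetPn.
      have /subsetPn[x xP xW] := nPW; exists x.
        by rewrite in_setD xW (subsetP Pcov).
      by rewrite in_setD in_setU xP orbT.
    - by rewrite inE vW.
    - by rewrite subUset WUC (subset_trans Pcov) ?subsetUr.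
    apply: extends_trans UW _; apply: (IH e W P K) => //.
    - apply: leq_trans (_ : #|cover C :\: U| <= n)%N; last by rewrite -ltnS.
      apply: proper_card; rewrite properE setDSS //=; apply/subsetPn; exists v.
        by rewrite inE vU vC.
      by rewrite inE vW.
    - exact: (piece_complete uv eC FvC uFv vFv PC).
    - exact: subset_trans UsW.
  (* No piece is partly reached: each has all its cells inside [W] or none. Hence the cells of [C]
     inside [W] form a nonempty cycle, which is [C]. *)
  have CS : mod2_cycle d (C :&: S).
    apply: cycle_restrict_pieces uv _ _ Cc _ => P PC.
    have [/subsetP PW|nPW] := boolP (cover P \subset W).
      have -> : P :&: S = P.
        apply/setIidPl/subsetP=> K KP; rewrite inE; apply/subsetP=> x xK.
        by apply: PW; apply/bigcupP; exists K.
      by have [/min_cycleP[]] := PC.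
    have -> : P :&: S = set0.
      apply/setP=> K; rewrite !inE; apply/negbTE; apply: contra noP => /andP[KP KW].
      apply/existsP; exists P; rewrite nPW andbT; apply/andP; split; first exact/pieceP.
      by apply/exists_inP; exists K.
    apply/mod2_cycleP; split=> [G|Q _]; first by rewrite inE.
    by rewrite /bd2 big1 // => x _; rewrite inE.
  have CSE : C :&: S = C.
    apply: Cmin (subsetIl _ _) CS _; apply/set0Pn; exists F.
    by rewrite !inE FC (subset_trans FU).
  suff -> : U :|: cover C = W by [].
  apply/eqP; rewrite eqEsubset WUC subUset UsW andbT; apply/bigcupsP=> K KC.
  by move: KC; rewrite -CSE !inE => /andP[].
have [P PC FP] : exists2 P, piece d u v C P & F \in P.
  suff /existsP[P /andP[/pieceP PC FP]] :
    [exists P : {set {set T}}, is_piece d u v C P && (F \in P)].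
    by exists P.
  (* If no piece contained [F], restriction to [[set F]] would make the single cell [F] a cycle. *)
  apply: contraT => noP.
  have CS : mod2_cycle d (C :&: [set F]).
    apply: cycle_restrict_pieces uv _ _ Cc _ => P PC.
    have -> : P :&: [set F] = set0.
      apply/setP=> K; rewrite !inE; apply/negbTE; apply: contra noP => /andP[KP /eqP KF].
      by apply/existsP; exists P; rewrite -KF KP andbT; apply/pieceP.
    apply/mod2_cycleP; split=> [G|Q _]; first by rewrite inE.
    by rewrite /bd2 big1 // => x _; rewrite inE.
  have FS : F \in C :&: [set F] by rewrite !inE FC eqxx.
  have /card_gt0P[x xF] : (0 < #|F|)%N by rewrite Cd //; apply: leq_trans d_ge3.
  have [y yF] := cycle_ridge CS FS xF.
  by rewrite !inE => /andP[_ /eqP E]; rewrite -E setU11 in yF.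
have Pcov := piece_cover uv FvC uFv vFv PC.
have [K KP /andP[uK vK]] := piece_has_pair Cm FvC uFv vFv PC.
have [uP vP] : u \in cover P /\ v \in cover P by split; apply/bigcupP; exists K.
have [N [NP uN vN eN dN]] := piece_common_nbrs uv Cm eC FvC uFv vFv PC.
have vR : v \notin R by apply: contra vU; apply: subsetP.
apply: (grow (U :|: cover P)).
- by rewrite inE vP orbT.
- by rewrite subUset subsetUl (subset_trans Pcov) ?subsetUr.
have UPv : U :|: cover P :\ v = (U :|: cover P) :\ v.
  by apply/setP=> x; rewrite !inE; have [->|] //= := eqVneq x v; rewrite (negPf vU).
have step : extends (contract e u v) U ((U :|: cover P) :\ v).
  rewrite -UPv; have [Pm PsC [[Q [uQ vQ Qd PQ]]|Bm]] := PC.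
    have -> : cover P :\ v = Q :\ v.
      congr (_ :\ v); apply/eqP; rewrite eqEsubset PQ; apply/andP; split.
        by apply/bigcupsP=> G; rewrite inE => /andP[].
      apply/subsetP=> x xQ; apply/bigcupP.
      have [->|xv] := eqVneq x v.
        exists (Q :\ u); last by rewrite in_setD1 vQ eq_sym uv.
        by apply/(simplex_cell_subP _ Qd); exists u.
      exists (Q :\ v); last by rewrite in_setD1 xQ xv.
      by apply/(simplex_cell_subP _ Qd); exists v.
    (* [F] avoids [v], so it is the facet of the simplex opposite to [v]; after contraction the
       piece has no vertex outside [U]. *)
    move: FP; rewrite PQ => /(simplex_cell_subP _ Qd)[x xQ FE].
    have xv : x = v by apply: contraNeq vF => xv; rewrite FE !inE vQ eq_sym xv.
    by rewrite -xv -FE (setUidPl FU); apply: extends_refl.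
  rewrite -(piece_fold_cover uv Cm FvC uFv vFv PC).
  apply: (IH _ _ _ F) => //.
  - rewrite (piece_fold_cover uv Cm FvC uFv vFv PC).
    apply: leq_trans (_ : #|cover C :\: U| <= n)%N; last by rewrite -ltnS.
    apply: proper_card; rewrite properE; apply/andP; split.
      by apply: setSD; apply: subset_trans (subsetDl _ _) Pcov.
    by apply/subsetPn; exists v; rewrite !inE ?eqxx ?andbF ?vU.
  - exact: contract_sym.
  - exact: (piece_fold_complete uv eC FvC uFv vFv PC).
  apply/imsetP; exists F; last by rewrite /fold_face (negPf vF).
  by rewrite inE FP (negPf vF) andbF.
have NV : N \subset U :|: cover P by apply: subset_trans NP (subsetUr _ _).
apply: (extends_contract (u := u) (v := v) (N := N)) => //.
- by rewrite !inE uR uP orbT.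
- by rewrite !inE vR vP orbT.
by rewrite -UPv subsetUl.
Qed.

End Spanning.

(** * Minimal cycles attaining the bound, and their simplicial vertices *)

Section CellGraph.

Variable T : finType.
Implicit Types (C D Z : {set {set T}}) (F G N : {set T}) (x y z : T).

Definition cell_graph C : rel T :=
  [rel x y | (x != y) && [exists F in C, (x \in F) && (y \in F)]].

Definition subcells C : {set {set T}} :=
  [set A : {set T} | [exists F in C, A \subset F]].

Lemma cell_graphP C x y :
  reflect (x != y /\ exists2 F, F \in C & (x \in F) && (y \in F))
          (cell_graph C x y).
Proof.
by apply: (iffP andP) => -[xy /exists_inP h]; split=> //; apply/exists_inP.
Qed.

Lemma cell_graph_sym C : symmetric (cell_graph C).
Proof.
by move=> x y; apply/cell_graphP/cell_graphP => -[xy [F FC /andP[xF yF]]]; split;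
  rewrite 1?eq_sym //; exists F; rewrite ?xF ?yF.
Qed.

Lemma cell_graph_irr C : irreflexive (cell_graph C).
Proof. by move=> x; rewrite /cell_graph /= eqxx. Qed.

Lemma cell_graph_complete C : complete_on (cell_graph C) C.
Proof. by move=> F FC x y xF yF xy; apply/cell_graphP; split=> //; exists F; rewrite ?xF. Qed.

Lemma subcellsP C (A : {set T}) :
  reflect (exists2 F, F \in C & A \subset F) (A \in subcells C).
Proof. by rewrite inE; apply: exists_inP. Qed.

(** The value for a clique on [d] vertices plus [wt 1 d] for each further vertex. *)
Definition stacked_bound (d n : nat) : rat :=
  1 - d.+1%:R^-1 + wt 1 d * (n%:R - d%:R).

Lemma phi_clique e N : symmetric e -> {in N &, forall x y, x != y -> e x y} ->
  phi e set0 N = 1 - #|N|.+1%:R^-1.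
Proof.
move=> e_sym eN; apply: phi_conn => // W WN _ x y xW yW.
have [->|xy] := eqVneq x y; first exact: connect0.
by apply: connect1; rewrite /within /= xW yW eN // (subsetP WN).
Qed.

Section MinCycle.

Variables (d : nat) (C : {set {set T}}).
Hypotheses (d_ge3 : (3 <= d)%N) (Cm : min_cycle d C).

Let e := cell_graph C.
Let V := cover C.
Let e_sym : symmetric e := @cell_graph_sym C.

Let Cc : mod2_cycle d C.
Proof. by have /min_cycleP[] := Cm. Qed.

Let Cd F : F \in C -> #|F| = d.
Proof. by have /mod2_cycleP[h _] := Cc; apply: h. Qed.

Let C_extends : exists2 F, F \in C & extends d set0 e F V.
Proof.
have /min_cycleP[_ /set0Pn[F FC] _] := Cm; exists F => //.
have FV : F \subset V by apply: bigcup_sup FC.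
rewrite -(setUidPr FV); apply: extends_cycle FC _ => //; rewrite ?cards0 ?sub0set //.
exact: cell_graph_complete.
Qed.

Let boundE F : F \in C ->
  stacked_bound d #|V| = phi e set0 F + wt 1 d * #|V :\: F|%:R.
Proof.
move=> FC; have FV : F \subset V by apply: bigcup_sup FC.
rewrite phi_clique //; last exact: cell_graph_complete FC.
by rewrite cardsD (setIidPr FV) natrB ?subset_leq_card // (Cd FC).
Qed.

Lemma phi_min_cycle_le : phi e set0 V <= stacked_bound d #|V|.
Proof. by have [F FC [_ le _]] := C_extends; rewrite (boundE FC). Qed.

Lemma min_cycle_chordal : phi e set0 V = stacked_bound d #|V| -> chordal e V.
Proof.
have [F FC [_ _ ch]] := C_extends; rewrite (boundE FC) => eqV; apply: ch => //.
apply: chordal_clique; exact: cell_graph_complete FC.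
Qed.

Section Simplicial.

Variables (x : T) (N : {set T}).
Hypotheses (xV : x \in V) (N_nbr : forall y, (y \in N) = e x y).
Hypothesis N_clique : {in N &, forall y z, y != z -> e y z}.

Let V' := V :\ x.

Let xN : x \notin N.
Proof. by rewrite N_nbr /e cell_graph_irr. Qed.

Let NV y : y \in N -> y \in V.
Proof.
rewrite N_nbr => /cell_graphP[_ [F FC /andP[_ yF]]].
by apply/bigcupP; exists F.
Qed.

Let star_N F : F \in C -> x \in F -> F :\ x \subset N.
Proof.
move=> FC xF; apply/subsetP=> y; rewrite !inE => /andP[yx yF].
have exy : e x y by apply/cell_graphP; rewrite eq_sym; split=> //; exists F; rewrite ?xF.
by rewrite N_nbr.
Qed.

(** A cell at [x] provides [d - 1] neighbours, and an exchange in it one more. *)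
Let N_ge : (d <= #|N|)%N.
Proof.
have /bigcupP[F FC xF] := xV.
have /card_gt0P[y] : (0 < #|F :\ x|)%N.
  by have := Cd FC; rewrite (cardsD1 x F) xF => E; move: d_ge3; rewrite -E; case: #|_|.
rewrite !inE => /andP[yx yF]; have [z zF zC] := cycle_ridge Cc FC yF.
have xz : x != z by apply: contraNneq zF => <-.
have xzF : x \in z |: (F :\ y) by rewrite !inE [x == y]eq_sym yx xF orbT.
rewrite -(Cd FC) (cardsD1 x F) xF add1n.
suff s : z |: (F :\ x) \subset N.
  by have := subset_leq_card s; rewrite cardsU1 !inE (negPf zF) andbF.
rewrite subUset sub1set star_N // andbT; apply: (subsetP (star_N zC xzF)).
by rewrite !inE eqxx eq_sym xz.
Qed.

(** Identify [x] with a neighbour [u]. The new cells lie inside the clique [N], so no edge is added.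
    A minimal subcycle of the image has a cell inside [N], since otherwise it would be [C], which
    contains [x]; thus everything grows from [N]. *)
Let V'_le : phi e set0 V' <= phi e set0 N + wt 1 d * #|V' :\: N|%:R.
Proof.
have /card_gt0P[u uN] : (0 < #|N|)%N by apply: leq_trans N_ge; apply: leq_trans d_ge3.
have ux : u != x by apply: contraNneq xN => <-.
pose C' := fold u x C.
have C'c : mod2_cycle d C' by apply: fold_cycle.
have C'x G : G \in C' -> x \notin G by rewrite inE => /andP[].
have C'cases G : G \in C' -> G \in C \/ G \subset N.
  rewrite inE => /andP[xG]; case: ifP => [uG|_]; last by left.
  have [GC _|_ /= xGC] := boolP (G \in C); [by left | right].
  have := star_N xGC (setU11 _ _); rewrite setU1K ?inE ?(negPf xG) ?andbF //.
  by move=> s; rewrite -(setD1K uG) subUset sub1set uN.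
have NV' : N \subset V'.
  apply/subsetP=> y yN; rewrite !inE; apply/andP; split; first by apply: contraNneq xN => <-.
  exact: NV.
have C'V' G : G \in C' -> G \subset V'.
  move=> GC'; have [GC|GN] := C'cases G GC'; last exact: subset_trans GN _.
  by rewrite subsetD1 C'x // (bigcup_sup G GC).
have V'C' y : y \in V' -> y \notin N -> exists2 G, G \in C' & y \in G.
  rewrite !inE => /andP[yx /bigcupP[F FC yF]] nyN.
  have xF : x \notin F.
    apply: contra nyN => xF; apply: (subsetP (star_N FC xF)).
    by rewrite !inE yx.
  exists F; rewrite // inE xF FC /=; case: ifP => // uF.
  suff /negPf-> : x |: (F :\ u) \notin C by [].
  have yu : y != u by apply: contraNneq nyN => ->.
  apply: contra nyN => /star_N; rewrite setU11 setU1K ?inE ?(negPf xF) ?andbF // => /(_ isT).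
  by move/subsetP/(_ y); rewrite !inE yu yF => /(_ isT).
have grow (W : {set T}) : N \subset W -> W \subset V' -> extends d set0 e N W ->
    extends d set0 e N V'.
  have [m] := ubnP #|V' :\: W|; elim: m => // m IHm in W * => Wm NW WV' NWe.
  have [/subsetP V'W|/subsetPn[y yV' yW]] := boolP (V' \subset W).
    by have -> : V' = W by apply/eqP; rewrite eqEsubset WV' andbT; apply/subsetP.
  have [G GC' yG] := V'C' y yV' (contra (subsetP NW y) yW).
  have [B Bm /andP[BC' GB]] := ex_min_cycle C'c GC'.
  have [H HB HN] : exists2 H, H \in B & H \subset N.
    have [BC|/subsetPn[H HB nHC]] := boolP (B \subset C).
      have /min_cycleP[_ _ Cmin] := Cm; have /min_cycleP[Bc B0 _] := Bm.
      have BE := Cmin B BC Bc B0; have /bigcupP[F FC xF] := xV.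
      by rewrite -BE in FC; have := C'x F (subsetP BC' _ FC); rewrite xF.
    by exists H => //; case: (C'cases H (subsetP BC' _ HB)) => // HC; rewrite HC in nHC.
  have BV' : cover B \subset V' by apply/bigcupsP=> K KB; apply: C'V'; apply: (subsetP BC').
  apply: (IHm (W :|: cover B)).
  - apply: leq_trans (_ : #|V' :\: W| <= m)%N; last by rewrite -ltnS.
    apply: proper_card; rewrite properE setDS ?subsetUl //=; apply/subsetPn; exists y.
      by rewrite in_setD yW.
    rewrite in_setD in_setU negb_and negbK; apply/orP; left; apply/orP; right.
    by apply/bigcupP; exists G.
  - exact: subset_trans NW (subsetUl _ _).
  - by rewrite subUset WV'.
  apply: extends_trans NWe _.
  have eB : complete_on e B.
    move=> K KB; have [KC|KN] := C'cases K (subsetP BC' _ KB).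
      exact: cell_graph_complete KC.
    by move=> y' z /(subsetP KN) yK /(subsetP KN) zK; apply: N_clique.
  apply: (extends_cycle d_ge3 _ e_sym Bm eB _ HB); rewrite ?cards0 ?sub0set //.
  exact: subset_trans HN _.
by have [_ le _] := grow N (subxx _) NV' (extends_refl _ _ _ _).
Qed.

Let phiV : phi e set0 V = phi e set0 V' + wt 1 #|N|.
Proof.
have NE : V' :&: nbr e x = N.
  apply/setP=> y; rewrite in_setI in_setD1 in_set N_nbr.
  case: (boolP (e x y)) => [exy|]; rewrite ?andbF // andbT NV ?N_nbr // andbT.
  by apply: contraTneq exy => ->; rewrite /e cell_graph_irr.
have sV' : simplicial e V' x by rewrite /simplicial NE.
by have := phi_simplicial e_sym (negbT (setD11 x V)) sV'; rewrite setD1K // NE.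
Qed.

Lemma simplicial_degree : phi e set0 V = stacked_bound d #|V| ->
  #|N| = d /\ phi e set0 V' = stacked_bound d #|V'|.
Proof.
move=> eqV; have NV' : N \subset V'.
  apply/subsetP=> y yN; rewrite in_setD1 NV // andbT.
  by apply: contraNneq xN => <-.
have cV : #|V|%:R = #|V'|%:R + 1 :> rat by rewrite (cardsD1 x V) xV natrD addrC.
have qd : #|N| = d.
  apply/eqP; rewrite eqn_leq N_ge andbT leqNgt; apply/negP => dq.
  have := V'_le; rewrite (phi_clique e_sym N_clique) cardsD (setIidPr NV') natrB ?subset_leq_card //.
  move: phiV; rewrite eqV /stacked_bound cV => eq1 le1.
  have {}le1 : 1 - d.+1%:R^-1 + wt 1 d * (#|V'|%:R + 1 - d%:R) - wt 1 #|N| <=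
      1 - (#|N|.+1)%:R^-1 + wt 1 d * (#|V'|%:R - #|N|%:R) :> rat.
    by rewrite eq1 addrK.
  move: le1; rewrite !wt1E !natrM -!natr1.
  move: dq; rewrite -(ler_nat rat) -natr1.
  have : 0 <= d%:R :> rat by rewrite ler0n.
  move: (#|V'|%:R : rat) (#|N|%:R : rat) (d%:R : rat) => v q D D0 qD.
  rewrite -subr_ge0.
  have q0 : 0 <= q by lra.
  (* A degree [q > d] would miss the bound by this positive amount. *)
  have -> : 1 - (q + 1)^-1 + ((D + 1) * (D + 1 + 1))^-1 * (v - q) -
      (1 - (D + 1)^-1 + ((D + 1) * (D + 1 + 1))^-1 * (v + 1 - D) -
       ((q + 1) * (q + 1 + 1))^-1) =
      - (((q - D) * (q - D + 1)) / ((D + 1) * (D + 2) * (q + 2))).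
    by field; rewrite ?lt0r_neq0 //=; lra.
  rewrite oppr_ge0; apply/negP; rewrite -ltNge divr_gt0 // ?mulr_gt0 //; lra.
split=> //; move: phiV; rewrite eqV /stacked_bound cV qd => /esym/eqP.
by rewrite -subr_eq => /eqP <-; ring.
Qed.

Hypothesis Nd : #|N| = d.

(** A cell at [x] omits one vertex [y0] of [N]; exchanging [y] in it can only bring in [y0]. *)
Let star_facet y : y \in N -> x |: (N :\ y) \in C.
Proof.
have /bigcupP[F FC xF] := xV; move=> yN.
have FN := star_N FC xF.
have Fx : x |: (F :\ x) = F by rewrite setD1K.
have Fd : #|F :\ x|.+1 = d by rewrite -(Cd FC) (cardsD1 x F) xF.
have /(simplex_cell_subP _ (_ : #|N| = #|F :\ x|.+1))[|y0 y0N FE] :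
    F :\ x \in simplex_cells #|F :\ x| N by rewrite inE FN eqxx.
  by rewrite Nd Fd.
have [->|yy0] := eqVneq y y0; first by rewrite -FE Fx.
have yF : y \in F.
  have : y \in F :\ x by rewrite FE in_setD1 yy0.
  by rewrite in_setD1 => /andP[].
have yx : y != x by apply: contraNneq xN => <-.
have [z zF zC] := cycle_ridge Cc FC yF.
have xz : x != z by apply: contraNneq zF => <-.
have xzF : x \in z |: (F :\ y) by rewrite in_setU1 in_setD1 xF [x == y]eq_sym yx orbT.
have zN : z \in N.
  by apply: (subsetP (star_N zC xzF)); rewrite in_setD1 eq_sym xz setU11.
have zy0 : z = y0.
  apply: contraNeq zF => zy0; have : z \in F :\ x by rewrite FE in_setD1 zy0.
  by rewrite in_setD1 => /andP[].
suff -> : x |: (N :\ y) = z |: (F :\ y) by [].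
apply/setP=> w; rewrite -Fx FE zy0 !(in_setU1, in_setD1).
have [->|wx] /= := eqVneq w x; first by rewrite [x == y]eq_sym yx orbT.
have [->|wy0] /= := eqVneq w y0; first by rewrite [y0 == y]eq_sym yy0 y0N.
by [].
Qed.

Let Qd : #|x |: N| = d.+1.
Proof. by rewrite cardsU1 xN Nd. Qed.

Let D := simplex_cells d (x |: N).

Let DP G : reflect (G = N \/ exists2 y, y \in N & G = x |: (N :\ y)) (G \in D).
Proof.
have E y : y \in N -> (x |: N) :\ y = x |: (N :\ y).
  move=> yN; apply/setP=> w; rewrite !(in_setU1, in_setD1).
  have [->|] //= := eqVneq w x; rewrite ?orbT ?andbT.
  by apply/eqP => xy; move: xN; rewrite xy yN.
apply: (iffP (simplex_cell_subP _ Qd)) => [[y]|].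
  rewrite in_setU1 => /orP[/eqP->|yN] ->; first by left; rewrite setU1K.
  by right; exists y; rewrite ?E.
case=> [->|[y yN ->]]; first by exists x; rewrite ?setU11 ?setU1K.
by exists y; rewrite ?E // in_setU1 yN orbT.
Qed.

Lemma simplicial_base : N \in C -> C = simplex_cells d (x |: N).
Proof.
move=> NC; have /min_cycleP[_ _ Cmin] := Cm; apply/esym.
have /min_cycleP[Dc D0 _] := simplex_cells_min Qd.
apply: Cmin => //; apply/subsetP=> G /DP[->//|[y yN ->]]; exact: star_facet.
Qed.

Hypothesis NC : N \notin C.

(** Adding the boundary of the simplex on [x |: N] replaces the star of [x] by the single cell
    [N]. *)
Let C1 := symdiff C D.

Let C1P G : reflect (G = N \/ G \in C /\ x \notin G) (G \in C1).
Proof.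
rewrite [G \in C1]in_set; apply: (iffP idP).
  have [GC /= GD|GC /= /DP[->|[y yN E]]] := boolP (G \in C); last 2 first.
  - by left.
  - by move: GC; rewrite E star_facet.
  right; split=> //; apply: contra GD => xG; rewrite inE (Cd GC) eqxx andbT.
  by rewrite -(setD1K xG) setUS // star_N.
case=> [->|[GC xG]]; first by rewrite (negPf NC) /=; apply/DP; left.
rewrite GC /=; apply/negP => /DP[GN|[y yN E]]; first by move: NC; rewrite -GN GC.
by rewrite E setU11 in xG.
Qed.

(** A subcycle [Z] of [C1] without [N] lies in [C], hence equals [C] and meets [x], a contradiction;
    if it contains [N], adding the simplex boundary back gives [C], so [Z] is [C1]. *)
Lemma simplicial_reduce :
  [/\ min_cycle d C1, cover C1 = V', N \in C1,
      {in V' &, forall y z, y != z -> cell_graph C1 y z = e y z}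
    & forall G, G \in C <-> (G \in C1 /\ G <> N)
         \/ exists2 y, y \in N & G = x |: (N :\ y)].
Proof.
have /min_cycleP[Dc D0 _] := simplex_cells_min Qd.
have /min_cycleP[_ _ Cmin] := Cm.
have NC1 : N \in C1 by apply/C1P; left.
have ND : N \in D by apply/DP; left.
have /card_gt0P[y0 y0N] : (0 < #|N|)%N by rewrite Nd; apply: leq_trans d_ge3.
have C1x G : G \in C1 -> x \notin G by move=> /C1P[->|[]].
have covC1 : cover C1 = V'.
  apply/setP=> y; apply/bigcupP/idP => [[G GC1 yG]|].
    rewrite in_setD1; apply/andP; split; first by apply: contraTneq yG => ->; apply: C1x.
    by have /C1P[GN|[GC _]] := GC1; [apply: NV; rewrite -GN | apply/bigcupP; exists G].
  rewrite in_setD1 => /andP[yx /bigcupP[F FC yF]].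
  have [xF|xF] := boolP (x \in F); last by exists F => //; apply/C1P; right.
  by exists N => //; apply: (subsetP (star_N FC xF)); rewrite in_setD1 yx.
split=> //.
- apply/min_cycleP; split; first exact: cycle_symdiff.
    by apply/set0Pn; exists N.
  move=> Z ZC1 Zc Z0; have [NZ|NZ] := boolP (N \in Z); last first.
    have ZC : Z \subset C.
      apply/subsetP=> G GZ; have /C1P[GN|[]//] := subsetP ZC1 _ GZ.
      by rewrite -GN GZ in NZ.
    have ZE := Cmin Z ZC Zc Z0; have /bigcupP[F FC xF] := xV.
    by rewrite -ZE in FC; have := C1x F (subsetP ZC1 _ FC); rewrite xF.
  have ZD : symdiff Z D = C.
    apply: Cmin; last 2 first.
    - exact: cycle_symdiff.
    - apply/set0Pn; exists (x |: (N :\ y0)).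
      have -> : (x |: N :\ y0 \in symdiff Z D) = true; last by [].
      rewrite in_set; have -> : x |: N :\ y0 \in D by apply/DP; right; exists y0.
      rewrite addbT; apply/negP => /(subsetP ZC1)/C1x; by rewrite setU11.
    apply/subsetP=> G; rewrite in_set; have [GZ /= GD|GZ /= /DP[GN|[y yN ->]]] := boolP (G \in Z).
    - have /C1P[GN|[]//] := subsetP ZC1 _ GZ.
      by rewrite GN ND in GD.
    - by rewrite GN NZ in GZ.
    - exact: star_facet.
  rewrite /C1 -ZD; apply/setP=> G; rewrite !in_set.
  by rewrite -addbA addbb addbF.
- move=> y z yV' zV' yz; apply/cell_graphP/cell_graphP => -[_ [F FC /andP[yF zF]]].
    have /C1P[FN|[FC' _]] := FC; last by split=> //; exists F; rewrite ?yF.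
    by apply/cell_graphP; apply: N_clique; rewrite -?FN.
  split=> //; have [xF|xF] := boolP (x \in F); last first.
    by exists F; rewrite ?yF ?zF //; apply/C1P; right.
  have yx : y != x by move: yV'; rewrite in_setD1 => /andP[].
  have zx : z != x by move: zV'; rewrite in_setD1 => /andP[].
  exists N => //; have /subsetP FN := star_N FC xF.
  by rewrite !FN // in_setD1 ?yx ?zx.
move=> G; split=> [GC|[[/C1P[//|[]//]]|[y yN ->]]]; last exact: star_facet.
have [xG|xG] := boolP (x \in G); last first.
  left; split; first by apply/C1P; right.
  by move=> GN; move: NC; rewrite -GN GC.
right; have GQ : G \in D.
  by rewrite inE (Cd GC) eqxx andbT -(setD1K xG) setUS // star_N.
have /DP[GN|//] := GQ; by move: NC; rewrite -GN GC.
Qed.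

End Simplicial.

End MinCycle.

End CellGraph.

(** * Stacked spheres *)

Section Stacking.

Variables (T : finType) (d : nat).
Hypothesis d_gt0 : (0 < d)%N.
Implicit Types (C D : {set {set T}}) (A F G N : {set T}) (x y z : T).

Lemma subcells_facet C N : (forall F, F \in C -> #|F| = d) -> N \in C ->
  facet (subcells C) N.
Proof.
move=> Cd NC; apply/maxsetP; split; first by apply/subcellsP; exists N.
move=> B /subcellsP[F FC BF] NB; apply/esym/eqP; rewrite eqEcard NB /=.
by rewrite (Cd _ NC) -(Cd _ FC) subset_leq_card.
Qed.

Lemma subcells_simplex (Q : {set T}) : #|Q| = d.+1 ->
  subcells (simplex_cells d Q) = simplex_boundary Q.
Proof.
move=> Qd; apply/setP=> A; rewrite [RHS]inE; apply/subcellsP/properP.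
  move=> [F /(simplex_cell_subP _ Qd)[x xQ ->] AF]; split.
    exact: subset_trans AF (subsetDl _ _).
  by exists x => //; apply/negP => /(subsetP AF); rewrite !inE eqxx.
move=> [AQ [x xQ xA]]; exists (Q :\ x); last by rewrite subsetD1 AQ.
by apply/(simplex_cell_subP _ Qd); exists x.
Qed.

Variables (C C1 : {set {set T}}) (x : T) (N : {set T}).
Hypotheses (xN : x \notin N) (Nd : #|N| = d) (NC1 : N \in C1).
Hypotheses (C1d : forall F, F \in C1 -> #|F| = d) (xC1 : x \notin cover C1).
Hypothesis CE : forall G, G \in C <-> (G \in C1 /\ G <> N)
         \/ exists2 y, y \in N & G = x |: (N :\ y).

Let Qd : #|x |: N| = d.+1.
Proof. by rewrite cardsU1 xN Nd. Qed.

Let f (w : T + T) : T := match w with inl a => a | inr a => a end.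

Let CS := connected_sum (subcells C1) (simplex_boundary (x |: N)) N id.

Let f_glue A : f @: (glue N id @: A) = A.
Proof.
rewrite -imset_comp (eq_imset (g := id)) ?imset_id // => a /=.
by rewrite /glue; case: ifP.
Qed.

Let f_inr A : f @: (inr @: A) = A.
Proof. by rewrite -imset_comp (eq_imset (g := id)) // imset_id. Qed.

(** The connected sum lives on [T + T]; the map [f] forgetting the side brings it back to [T]. *)
Lemma stack_on_facet :
  stacked_sphere_dim d.-1 (subcells C1) -> stacked_sphere_dim d.-1 (subcells C).
Proof.
move=> st1.
have st2 : stacked_sphere_dim d.-1 (simplex_boundary (x |: N)).
  by apply: StackedSimplex; rewrite Qd prednK.
have facet1 : facet (subcells C1) N by apply: subcells_facet.
have facet2 : facet (simplex_boundary (x |: N)) (id @: N).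
  rewrite imset_id -subcells_simplex //; apply: subcells_facet.
    by move=> F; rewrite inE => /andP[_ /eqP].
  by apply/(simplex_cell_subP _ Qd); exists x; rewrite ?setU11 ?setU1K.
have st := StackedSum st1 st2 facet1 (in2W (fun a b (E : id a = id b) => E)) facet2.
have CSP (A' : {set (T + T)%type}) : A' \in CS ->
    A' != glue N id @: N /\
    ((exists2 A, A \in subcells C1 & A' = glue N id @: A) \/
     exists2 A, A \in simplex_boundary (x |: N) & A' = inr @: A).
  rewrite !inE => /andP[-> /orP[]/imsetP[A AD ->]]; split=> //; first by left; exists A.
  by right; exists A.
have inlP a : inl a \in vertices CS ->
    a \notin N /\ a \in cover C1.
  rewrite inE => /CSP[_ [[A /subcellsP[F FC1 AF] E]|[A _ E]]].
    have : inl a \in glue N id @: A by rewrite -E set11.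
    case/imsetP=> a' a'A; rewrite /glue; case: ifP => // /negbT a'N [->].
    by split=> //; apply/bigcupP; exists F => //; apply: (subsetP AF).
  have : inl a \in inr @: A by rewrite -E set11.
  by case/imsetP.
have inrP b : inr b \in vertices CS ->
    b \in x |: N.
  rewrite inE => /CSP[_ [[A _ E]|[A AD E]]].
    have : inr b \in glue N id @: A by rewrite -E set11.
    by case/imsetP=> a' a'A; rewrite /glue; case: ifP => // a'N [->]; rewrite setU1r.
  have : (inr b : (T + T)%type) \in inr @: A by rewrite -E set11.
  case/imsetP=> b' b'A [->]; move: AD; rewrite inE => /proper_sub/subsetP; exact.
(* [f] is injective on the vertices of the sum: left vertices are off [N] and differ from [x], while
   right vertices lie in [x |: N]. *)
have inlr a b : inl a \in vertices CS ->
    inr b \in vertices CS -> a != b.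
  move=> /inlP[aN aC] /inrP bN; apply: contraTneq bN => <-.
  by rewrite in_setU1 negb_or aN andbT; apply: contraNneq xC1 => <-.
suff -> : subcells C = image_complex f CS.
  apply: StackedIso st _ => -[a|a] [b|b] aV bV /= E.
  - by rewrite E.
  - by have := inlr _ _ aV bV; rewrite E eqxx.
  - by have := inlr _ _ bV aV; rewrite E eqxx.
  - by rewrite E.
have properN A : A \subset N -> A != N -> A \in subcells C.
  move=> AN AnN; have /properP[_ [y yN yA]] : A \proper N by rewrite properEneq AnN.
  apply/subcellsP; exists (x |: (N :\ y)); first by apply/CE; right; exists y.
  by apply: subset_trans (subsetUr _ _); rewrite subsetD1 AN.
have NnC : N \notin C.
  by apply/negP => /CE[[_ //]|[y _ E]]; move: xN; rewrite E setU11.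
apply/setP=> A; apply/idP/imsetP => [/subcellsP[F FC AF]|[A' /CSP[nA' AA'] ->]].
  have Fd : #|F| = d.
    have [[FC1 _]|[y yN ->]] := (CE F).1 FC; first exact: C1d.
    by rewrite cardsU1 !inE (negPf xN) andbF -Nd (cardsD1 y N) yN.
  have AN : A != N.
    apply: contraNneq NnC => AN; suff -> : N = F by [].
    by apply/eqP; rewrite -AN eqEcard AF AN Nd Fd /=.
  have fAN (A1 : {set (T + T)%type}) : f @: A1 = A -> A1 != glue N id @: N.
    by move=> E; apply: contraNneq AN => E1; rewrite -E E1 f_glue.
  have [[FC1 _]|[y yN FE]] := (CE F).1 FC.
    exists (glue N id @: A); last by rewrite f_glue.
    rewrite in_setD1 fAN ?f_glue //= in_setU; apply/orP; left.
    by apply: imset_f; apply/subcellsP; exists F.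
  exists (inr @: A); last by rewrite f_inr.
  rewrite in_setD1 fAN ?f_inr //= in_setU; apply/orP; right.
  apply: imset_f; rewrite inE; apply/properP; split.
    by apply: subset_trans AF _; rewrite FE setUS // subsetDl.
  exists y; first by rewrite in_setU1 yN orbT.
  apply/negP => /(subsetP AF); rewrite FE !inE eqxx orbF => /eqP yx.
  by move: xN; rewrite -yx yN.
case: AA' => -[B BD A'E]; rewrite A'E ?f_glue ?f_inr.
  have BN : B != N by apply: contraNneq nA' => BN; rewrite A'E BN.
  have /subcellsP[F FC1 BF] := BD; have [FN|FN] := eqVneq F N.
    by apply: properN => //; rewrite -FN.
  by apply/subcellsP; exists F => //; apply/CE; left; split=> //; apply/eqP.
have BN : B != N.
  apply: contraNneq nA' => BN; rewrite A'E BN; apply/eqP; apply: eq_in_imset => a aN.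
  by rewrite /glue aN.
move: BD; rewrite inE => /properP[BxN [y]]; rewrite in_setU1 => /orP[/eqP->|yN] yB.
  by apply: properN => //; rewrite -(setU1K xN) subsetD1 BxN.
apply/subcellsP; exists (x |: (N :\ y)); first by apply/CE; right; exists y.
apply/subsetP=> w wB; have := subsetP BxN _ wB; rewrite !inE => /orP[->//|->].
by rewrite andbT orbC; apply/orP; left; apply: contraNneq yB => <-.
Qed.

End Stacking.

Section MinCycleStacked.

Variables (T : finType) (d : nat).
Hypothesis d_ge3 : (3 <= d)%N.

Lemma min_cycle_stacked (C : {set {set T}}) : min_cycle d C ->
    phi (cell_graph C) set0 (cover C) = stacked_bound d #|cover C| ->
  stacked_sphere_dim d.-1 (subcells C).
Proof.
have d_gt0 : (0 < d)%N by apply: leq_trans d_ge3.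
have [n] := ubnP #|cover C|; elim: n => // n IH in C * => Cn Cm eqC.
have V0 : cover C != set0.
  have /min_cycleP[/mod2_cycleP[Cd _] /set0Pn[F FC] _] := Cm.
  have /card_gt0P[x xF] : (0 < #|F|)%N by rewrite Cd.
  by apply/set0Pn; exists x; apply/bigcupP; exists F.
have [x xV simp] := chordal_simplicial (@cell_graph_sym _ C) (@cell_graph_irr _ C)
  (min_cycle_chordal d_ge3 Cm eqC) V0.
have [N N_nbr] : exists N : {set T}, forall y, (y \in N) = cell_graph C x y.
  by exists (nbr (cell_graph C) x) => y; rewrite in_set.
have N_clique : {in N &, forall y z, y != z -> cell_graph C y z}.
  have NV y : y \in N -> y \in cover C :&: nbr (cell_graph C) x.
    move=> yN; rewrite in_setI in_set -N_nbr yN andbT.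
    move: yN; rewrite N_nbr => /cell_graphP[_ [F FC /andP[_ yF]]].
    by apply/bigcupP; exists F.
  by move=> y z /NV yN /NV zN; apply: simp.
have xN : x \notin N by rewrite N_nbr cell_graph_irr.
have [Nd eqV'] := simplicial_degree d_ge3 Cm xV N_nbr N_clique eqC.
have Qd : #|x |: N| = d.+1 by rewrite cardsU1 xN Nd.
have [NC|NC] := boolP (N \in C).
  rewrite (simplicial_base Cm xV N_nbr Nd NC) subcells_simplex //.
  by apply: StackedSimplex; rewrite Qd prednK.
have [C1m covC1 NC1 eqG CE] := simplicial_reduce d_ge3 Cm xV N_nbr N_clique Nd NC.
have /min_cycleP[/mod2_cycleP[C1d _] _ _] := C1m.
apply: (stack_on_facet d_gt0 xN Nd NC1 C1d _ CE); first by rewrite covC1 !inE eqxx.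
apply: IH => //; rewrite covC1.
  by move: Cn; rewrite (cardsD1 x (cover C)) xV.
rewrite -eqV'; apply: eq_phi => //; exact: sub0set.
Qed.

End MinCycleStacked.

Definition edge_graph (T : finType) (D : {set {set T}}) : rel T :=
  [rel x y | (x != y) && ([set x; y] \in D)].

Lemma edge_graph_sym (T : finType) (D : {set {set T}}) : symmetric (edge_graph D).
Proof. by move=> x y; rewrite /edge_graph /= eq_sym setUC. Qed.

(** * Trees of cliques and the expectation for stacked spheres *)

Section DTree.

Variables (T : finType) (d : nat).
Implicit Types (e : rel T) (A B V W : {set T}).

(** When [A] is a clique on [d] vertices these are the d-trees of graph theory; every step adds
    exactly [wt 1 d] to [phi]. *)
Inductive dtree e A : {set T} -> Prop :=
| DTreeBase : dtree e A A
| DTreeStep V x : dtree e A V -> x \notin V -> #|V :&: nbr e x| = d ->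
    simplicial e V x -> dtree e A (x |: V).

Lemma dtree_sub e A V : dtree e A V -> A \subset V.
Proof.
elim=> [|W x _ AW _ _ _]; first exact: subxx.
exact: subset_trans AW (subsetUr _ _).
Qed.

Lemma phi_dtree e A V : symmetric e -> dtree e A V ->
  phi e set0 V = phi e set0 A + wt 1 d * #|V :\: A|%:R.
Proof.
move=> e_sym; elim=> [|W x AW IH xW Wd sW]; first by rewrite setDv cards0 mulr0 addr0.
rewrite phi_simplicial // IH Wd -addrA; congr (_ + _).
have AsW := dtree_sub AW.
have -> : (x |: W) :\: A = x |: (W :\: A).
  apply/setP=> y; rewrite !inE; have [->|] //= := eqVneq y x.
  by rewrite andbT; apply: contra xW; apply: subsetP.
by rewrite cardsU1 !inE (negPf xW) andbF natrD mulrDr mulr1 addrC.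
Qed.

(** The steps building [W] from [B] can be repeated on top of [V], as the new vertices have no
    neighbours in [V] outside [B]. *)
Lemma dtree_glue e A B V W : dtree e A V -> dtree e B W -> B \subset V ->
    {in W :\: B, forall y, y \notin V /\ {in V :\: B, forall x, ~~ e y x}} ->
  dtree e A (V :|: W).
Proof.
move=> AV; elim=> [|W' x BW' IH xW' Wd sW] BV far; first by rewrite (setUidPl BV).
have BsW' := dtree_sub BW'.
have xB : x \notin B by apply: contra xW'; apply: subsetP.
have [xV nx] : x \notin V /\ {in V :\: B, forall y, ~~ e x y}.
  by apply: far; rewrite !inE eqxx xB.
rewrite setUCA; have NE : (V :|: W') :&: nbr e x = W' :&: nbr e x.
  apply/setP=> y; rewrite !inE; case: (boolP (y \in W')) => yW'; rewrite ?orbT ?orbF //.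
  apply/negbTE/negP => /andP[yV exy]; have := nx y; rewrite !inE yV andbT exy.
  by move/(_ (contra (subsetP BsW' y) yW')).
apply: DTreeStep; rewrite /simplicial ?NE //.
  apply: IH => // y; rewrite inE => /andP[yB yW']; apply: far.
  by rewrite !inE yB yW' orbT.
by rewrite inE negb_or xV.
Qed.

End DTree.

Lemma dtree_imset (T T' : finType) (d : nat) (e : rel T) (e' : rel T')
    (f : T -> T') (A V : {set T}) :
    dtree d e A V -> {in V &, injective f} ->
    {in V &, forall x y, e' (f x) (f y) = e x y} ->
  dtree d e' (f @: A) (f @: V).
Proof.
elim=> [|W x AW IH xW Wd sW] inj ee'; first exact: DTreeBase.
have WxW : {subset W <= x |: W} by move=> y yW; rewrite inE yW orbT.
have xxW : x \in x |: W by rewrite setU11.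
have NE : f @: W :&: nbr e' (f x) = f @: (W :&: nbr e x).
  apply/setP=> z; rewrite inE; apply/andP/imsetP => [[/imsetP[y yW ->]]|[y]].
    by rewrite inE (ee' x y xxW (WxW y yW)) => exy; exists y; rewrite // !inE yW.
  rewrite !inE => /andP[yW exy] ->; split; first exact: imset_f.
  by rewrite (ee' x y xxW (WxW y yW)).
rewrite imsetU1; apply: DTreeStep.
- by apply: IH => [y z yW zW|y z yW zW]; [apply: inj | apply: ee']; apply: WxW.
- apply/imsetP => -[y yW E]; move: xW.
  by rewrite (inj x y xxW (WxW y yW) E) yW.
- rewrite NE card_in_imset // => y z /setIP[yW _] /setIP[zW _]; apply: inj; exact: WxW.
rewrite /simplicial NE => _ _ /imsetP[y yN ->] /imsetP[z zN ->] yz.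
have [yW zW] : y \in W /\ z \in W by move: yN zN; rewrite !inE => /andP[-> _] /andP[-> _].
by rewrite (ee' y z (WxW y yW) (WxW z zW)); apply: sW => //; apply: contraNneq yz => ->.
Qed.

Lemma sub_imset (T T' : finType) (f : T -> T') (B : {set T}) (E : {set T'}) :
  E \subset f @: B -> exists2 B' : {set T}, B' \subset B & E = f @: B'.
Proof.
move=> EB; exists (B :&: f @^-1: E); first exact: subsetIl.
apply/setP=> z; apply/idP/imsetP => [zE|[y]].
  have /imsetP[y yB zy] := subsetP EB _ zE; by exists y; rewrite // !inE yB -zy zE.
by rewrite !inE => /andP[_ yE] ->.
Qed.

Section Stacked.

Variable k : nat.
Hypothesis k_ge2 : (2 <= k)%N.

(** Invariants of the inductive construction. A second facet over each smaller face ensures that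
    deleting the glued facet uncovers nothing. The tree can start at any facet because later sums
    may glue along any facet. With [k >= 2] edges are smaller than facets and survive the
    deletion. *)
Definition stacked_inv (T : finType) (D : {set {set T}}) : Prop :=
  [/\ simplicial_complex D, set0 \in D,
      forall A, A \in D -> (#|A| <= k.+1)%N,
      forall B A, B \in D -> (#|B| <= k)%N ->
        exists2 A', A' \in D & [/\ #|A'| = k.+1, B \subset A' & A' != A]
    & forall A, A \in D -> #|A| = k.+1 ->
        dtree k.+1 (edge_graph D) A (vertices D)].

Lemma stacked_inv_facet (T : finType) (D : {set {set T}}) A :
  stacked_inv D -> facet D A -> A \in D /\ #|A| = k.+1.
Proof.
move=> [_ _ le ext _] /maxsetP[AD Amax]; split=> //.
apply/eqP; rewrite eqn_leq le //= ltnNge; apply/negP => Ak.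
have [A' A'D [_ AA' nA]] := ext A A AD Ak.
by case/eqP: nA; apply: Amax.
Qed.

Lemma stacked_inv_simplex (T : finType) (Q : {set T}) :
  #|Q| = k.+2 -> stacked_inv (simplex_boundary Q).
Proof.
move=> Qk; have mem B : (B \in simplex_boundary Q) = (B \proper Q) by rewrite inE.
have small (B : {set T}) : B \subset Q -> (#|B| < k.+2)%N -> B \proper Q.
  by move=> BQ Bk; rewrite properEcard BQ Qk.
have edge x y : x \in Q -> y \in Q -> x != y -> edge_graph (simplex_boundary Q) x y.
  move=> xQ yQ xy; rewrite /edge_graph /= xy mem small //.
    by apply/subsetP=> z /set2P[]->.
  by rewrite cards2 xy ltnS; apply: leq_trans k_ge2 _; rewrite leqnSn.
have vQ : vertices (simplex_boundary Q) = Q.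
  apply/setP=> x; rewrite inE mem; apply/idP/idP => [/proper_sub|xQ].
    by rewrite sub1set.
  by rewrite small ?sub1set ?cards1.
split.
- by move=> A B; rewrite !mem => AQ BA; apply: sub_proper_trans AQ.
- by rewrite mem small ?sub0set ?cards0.
- by move=> A; rewrite mem => /proper_card; rewrite Qk.
- move=> B A; rewrite mem => /proper_sub BQ Bk.
  have : (1 < #|Q :\: B|)%N by rewrite cardsD (setIidPr BQ) Qk ltn_subRL addn1 !ltnS.
  case/card_gt1P => y [z [yQB zQB yz]].
  have face (w : T) : w \in Q :\: B -> Q :\ w \proper Q /\ (#|Q :\ w| = k.+1 /\ B \subset Q :\ w).
    rewrite inE => /andP[wB wQ]; split; first exact: properD1.
    by rewrite subsetD1 BQ wB; split=> //; move: Qk; rewrite (cardsD1 w) wQ => -[].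
  have [yp [yk yB]] := face y yQB; have [zp [zk zB]] := face z zQB.
  have [E|nE] := eqVneq (Q :\ y) A; last by exists (Q :\ y); rewrite ?mem.
  exists (Q :\ z); rewrite ?mem //; split=> //; rewrite -E.
  apply: contraNneq yz => /setP/(_ z); rewrite !inE eqxx /=.
  by move: zQB; rewrite inE => /andP[_ ->]; rewrite andbT => /esym/negbFE/eqP->.
move=> A; rewrite mem vQ => AQ Ak.
have /(simplex_cell_subP _ Qk)[x xQ AE] : A \in simplex_cells k.+1 Q.
  by rewrite inE Ak eqxx proper_sub.
have xA : x \notin A by rewrite AE !inE eqxx.
have AN : A :&: nbr (edge_graph (simplex_boundary Q)) x = A.
  apply/setIidPl/subsetP=> y yA; rewrite in_set; apply: edge => //.
    exact: (subsetP (proper_sub AQ)).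
  by apply: contraNneq xA => ->.
rewrite [X in dtree _ _ _ X](_ : Q = x |: A); last by rewrite AE setD1K.
apply: DTreeStep => //; rewrite /simplicial ?AN //; first exact: DTreeBase.
by move=> y z yA zA; apply: edge; apply: (subsetP (proper_sub AQ)).
Qed.

Lemma stacked_inv_iso (T T' : finType) (D : {set {set T}}) (f : T -> T') :
    stacked_inv D -> {in vertices D &, injective f} ->
  stacked_inv (image_complex f D).
Proof.
move=> [sc D0 le ext tree] inj.
have sub B : B \in D -> B \subset vertices D.
  by move=> BD; apply/subsetP=> x xB; rewrite inE; apply: sc BD _; rewrite sub1set.
have cardf B : B \in D -> #|f @: B| = #|B|.
  move=> BD; apply: card_in_imset => x y xB yB; apply: inj; exact: (subsetP (sub B BD)).
have injf (A B : {set T}) : A \in D -> B \subset vertices D -> f @: A = f @: B -> A = B.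
  move=> AD BV E; apply/eqP; rewrite eqEsubset; apply/andP; split; apply/subsetP=> x xA.
    have : f x \in f @: B by rewrite -E imset_f.
    by case/imsetP=> y yB /inj -> //; [apply: (subsetP (sub A AD)) | apply: (subsetP BV)].
  have : f x \in f @: A by rewrite E imset_f.
  by case/imsetP=> y yB /inj -> //; [apply: (subsetP BV) | apply: (subsetP (sub A AD))].
have vE : vertices (image_complex f D) = f @: vertices D.
  apply/setP=> z; rewrite inE; apply/imsetP/imsetP => [[B BD E]|[x xV ->]].
    have : z \in f @: B by rewrite -E set11.
    by case/imsetP=> x xB ->; exists x => //; apply: (subsetP (sub B BD)).
  by exists [set x]; rewrite ?imset_set1 //; move: xV; rewrite inE.
split.
- move=> _ B /imsetP[A AD ->] /sub_imset[B' B'A ->].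
  by apply: imset_f; apply: sc AD B'A.
- by apply/imsetP; exists set0; rewrite ?imset0.
- by move=> _ /imsetP[A AD ->]; rewrite cardf // le.
- move=> _ X /imsetP[B BD ->]; rewrite cardf // => Bk.
  have [A' A'D [A'k BA' nA']] := ext B (vertices D :&: f @^-1: X) BD Bk.
  exists (f @: A'); [exact: imset_f | split; [by rewrite cardf | exact: imsetS |]].
  apply: contraNneq nA' => E; rewrite eqEsubset subsetI sub //= -E.
  apply/andP; split; first by apply/subsetP=> x xA; rewrite inE imset_f.
  apply/subsetP=> x; rewrite !inE => /andP[xV /imsetP[y yA /inj ->]] //.
    by rewrite inE.
  exact: (subsetP (sub A' A'D)).
move=> _ /imsetP[A AD ->]; rewrite cardf // => Ak; rewrite vE.
apply: dtree_imset; [exact: tree | exact: inj |].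
move=> x y xV yV; rewrite /edge_graph /= (inj_in_eq inj) //; congr andb.
have -> : [set f x; f y] = f @: [set x; y] by rewrite imsetU1 imset_set1.
apply/imsetP/idP => [[B BD /esym E]|xyD]; last by exists [set x; y].
rewrite -(injf _ _ BD _ E) //; apply/subsetP=> z /set2P[]->//.
Qed.

Section Sum.

Variables (T1 T2 : finType) (D1 : {set {set T1}}) (D2 : {set {set T2}}).
Variables (A : {set T1}) (phi : T1 -> T2).
Hypotheses (inv1 : stacked_inv D1) (inv2 : stacked_inv D2).
Hypotheses (AD1 : A \in D1) (Ak : #|A| = k.+1) (phi_inj : {in A &, injective phi}).
Hypothesis AD2 : phi @: A \in D2.

Let g := glue A phi.
Let D := connected_sum D1 D2 A phi.
Let i2 (y : T2) : T1 + T2 := inr y.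

Let sc1 : simplicial_complex D1. Proof. by case: inv1. Qed.
Let sc2 : simplicial_complex D2. Proof. by case: inv2. Qed.

Let g_inj : injective g.
Proof.
move=> x y; rewrite /g /glue; case: ifP => xA; case: ifP => yA // [] //.
exact: phi_inj.
Qed.

Let i2_inj : injective i2. Proof. by move=> x y []. Qed.

Let gA (B : {set T1}) : B \subset A -> g @: B = i2 @: (phi @: B).
Proof.
move=> BA; rewrite -imset_comp; apply: eq_in_imset => x xB.
by rewrite /g /glue (subsetP BA).
Qed.

Let g_i2 (B1 : {set T1}) (B2 : {set T2}) : g @: B1 = i2 @: B2 ->
  B1 \subset A /\ B2 = phi @: B1.
Proof.
move=> E; have B1A : B1 \subset A.
  apply/subsetP=> x xB; have : g x \in i2 @: B2 by rewrite -E imset_f.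
  by case/imsetP=> y _; rewrite /g /glue; case: ifP.
split=> //; apply: (imset_inj i2_inj); by rewrite -gA.
Qed.

Let DP (X : {set (T1 + T2)%type}) : reflect (X != g @: A /\
    ((exists2 B1, B1 \in D1 & X = g @: B1) \/ exists2 B2, B2 \in D2 & X = i2 @: B2))
  (X \in D).
Proof.
rewrite in_setD1 in_setU; apply: (iffP andP) => -[XA XD]; split=> //.
  by case/orP: XD => /imsetP[B BD ->]; [left|right]; exists B.
by case: XD => -[B BD ->]; apply/orP; [left|right]; apply: imset_f.
Qed.

Let le_D (X : {set (T1 + T2)%type}) : X \in D -> (#|X| <= k.+1)%N.
Proof.
move=> /DP[_ [[B BD ->]|[B BD ->]]].
  by rewrite card_imset //; case: inv1 => _ _ le _ _; apply: le.
by rewrite card_imset //; case: inv2 => _ _ le _ _; apply: le.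
Qed.

Let gA_k : #|g @: A| = k.+1. Proof. by rewrite card_imset. Qed.

Let sc : simplicial_complex D.
Proof.
move=> X Y XD YX; apply/DP; split.
  have XA : X != g @: A by have /DP[] := XD.
  apply: contraNneq XA => YA; rewrite eq_sym eqEcard -YA YX YA gA_k.
  exact: le_D.
have /DP[_ [[B BD XE]|[B BD XE]]] := XD; move: YX; rewrite XE => /sub_imset[B' B'B ->].
  by left; exists B'; rewrite ?(sc1 BD).
by right; exists B'; rewrite ?(sc2 BD).
Qed.

Let small_D1 (B : {set T1}) : B \in D1 -> (#|B| <= k)%N -> g @: B \in D.
Proof.
move=> BD Bk; apply/DP; split; last by left; exists B.
by apply: contraTneq Bk => E; rewrite -(card_imset _ g_inj) E gA_k ltnn.
Qed.

Let small_D2 (B : {set T2}) : B \in D2 -> (#|B| <= k)%N -> i2 @: B \in D.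
Proof.
move=> BD Bk; apply/DP; split; last by right; exists B.
by apply: contraTneq Bk => E; rewrite -(card_imset _ i2_inj) E gA_k ltnn.
Qed.

Let vD : vertices D = g @: vertices D1 :|: i2 @: vertices D2.
Proof.
have k_gt0 : (0 < k)%N by apply: leq_trans k_ge2.
apply/setP=> w; rewrite inE in_setU; apply/DP/orP => [[_ [[B BD E]|[B BD E]]]|].
- have : w \in g @: B by rewrite -E set11.
  case/imsetP=> x xB ->; left; apply: imset_f; rewrite inE.
  by apply: sc1 BD _; rewrite sub1set.
- have : w \in i2 @: B by rewrite -E set11.
  case/imsetP=> x xB ->; right; apply: imset_f; rewrite inE.
  by apply: sc2 BD _; rewrite sub1set.
case=> /imsetP[x]; rewrite inE => xD ->; apply/DP; rewrite -imset_set1.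
  by apply: small_D1; rewrite ?cards1.
by apply: small_D2; rewrite ?cards1.
Qed.

Let edge1 x y : edge_graph D (g x) (g y) = edge_graph D1 x y.
Proof.
rewrite /edge_graph /= (inj_eq g_inj); case: eqP => //= /eqP xy.
have -> : [set g x; g y] = g @: [set x; y] by rewrite imsetU1 imset_set1.
apply/idP/idP => [/DP[_ [[B BD /(imset_inj g_inj)->//]|[B BD /g_i2[xyA _]]]]|xyD].
  exact: sc1 AD1 _.
by apply: small_D1; rewrite ?cards2 ?xy.
Qed.

Let edge2 x y : edge_graph D (i2 x) (i2 y) = edge_graph D2 x y.
Proof.
rewrite /edge_graph /= (inj_eq i2_inj); case: eqP => //= /eqP xy.
have -> : [set i2 x; i2 y] = i2 @: [set x; y] by rewrite imsetU1 imset_set1.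
apply/idP/idP => [/DP[_ [[B BD /esym/g_i2[BA ->]]|[B BD /(imset_inj i2_inj)->//]]]|xyD].
  by apply: sc2 AD2 _; apply: imsetS.
by apply: small_D2; rewrite ?cards2 ?xy.
Qed.

Let edge12 x y : x \notin A -> y \notin phi @: A -> ~~ edge_graph D (g x) (i2 y).
Proof.
move=> xA yA; apply/negP => /andP[_ /DP[_ [[B BD E]|[B BD E]]]].
  have : i2 y \in g @: B by rewrite -E !inE eqxx orbT.
  case/imsetP=> z _; rewrite /g /glue; case: ifP => // zA [yz].
  by rewrite yz imset_f in yA.
have : g x \in i2 @: B by rewrite -E !inE eqxx.
by case/imsetP=> z _; rewrite /g /glue (negPf xA).
Qed.

Let ext_A (B : {set T1}) (X : {set (T1 + T2)%type}) : B \in D1 -> (#|B| <= k)%N ->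
  B \subset A ->
  exists2 A', A' \in D & [/\ #|A'| = k.+1, g @: B \subset A' & A' != X].
Proof.
move=> BD Bk BA.
have [_ _ _ ext1 _] := inv1; have [_ _ _ ext2 _] := inv2.
have [A1 A1D [A1k BA1 nA1]] := ext1 B A BD Bk.
have BD2 : phi @: B \in D2 by apply: sc2 AD2 _; apply: imsetS.
have Bk2 : (#|phi @: B| <= k)%N.
  by rewrite card_in_imset // => x y xB yB; apply: phi_inj; apply: (subsetP BA).
have [A2 A2D [A2k BA2 nA2]] := ext2 _ (phi @: A) BD2 Bk2.
have E1D : g @: A1 \in D.
  by apply/DP; split; [rewrite (inj_eq (imset_inj g_inj)) | left; exists A1].
have E2D : i2 @: A2 \in D.
  by apply/DP; split; [rewrite gA // (inj_eq (imset_inj i2_inj)) | right; exists A2].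
have [E|nE] := eqVneq (g @: A1) X; last first.
  by exists (g @: A1) => //; split=> //; [rewrite card_imset | apply: imsetS].
exists (i2 @: A2) => //; split; first by rewrite card_imset.
  by rewrite gA //; apply: imsetS.
rewrite -E; apply: contraNneq nA1 => /esym/g_i2[A1A _].
by rewrite eqEcard A1A A1k Ak /=.
Qed.

(** A facet of the sum comes from one summand; its tree there is continued by the tree of the other
    summand started at the glued facet. No edge joins the two sides off that facet. *)
Lemma stacked_inv_sum : stacked_inv D.
Proof.
have [_ D10 le1 ext1 tree1] := inv1; have [_ D20 le2 ext2 tree2] := inv2.
split.
- exact: sc.
- by rewrite -(imset0 g); apply: small_D1; rewrite ?cards0.
- exact: le_D.
- move=> _ X /DP[_ [[B BD ->]|[B BD ->]]].
    rewrite card_imset // => Bk; have [BA|BA] := boolP (B \subset A); first exact: ext_A.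
    have [A' A'D [A'k BA' nA']] := ext1 B (g @^-1: X) BD Bk.
    exists (g @: A'); last split; [| by rewrite card_imset | exact: imsetS |].
      apply/DP; split; last by left; exists A'.
      by rewrite (inj_eq (imset_inj g_inj)); apply: contraNneq BA => <-.
    apply: contraNneq nA' => <-; apply/eqP/setP=> x.
    by rewrite inE (mem_imset _ _ g_inj).
  rewrite card_imset // => Bk.
  have [/sub_imset[B' B'A BE]|BA] := boolP (B \subset phi @: A).
    rewrite BE -gA //; apply: ext_A => //; first exact: sc1 AD1 _.
    rewrite -(card_in_imset (f := phi) (D := B')) -?BE // => x y xB yB.
    by apply: phi_inj; apply: (subsetP B'A).
  have [A' A'D [A'k BA' nA']] := ext2 B (i2 @^-1: X) BD Bk.
  exists (i2 @: A'); last split; [| by rewrite card_imset | exact: imsetS |].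
    apply/DP; split; last by right; exists A'.
    by rewrite gA // (inj_eq (imset_inj i2_inj)); apply: contraNneq BA => <-.
  apply: contraNneq nA' => <-; apply/eqP/setP=> x.
  by rewrite inE (mem_imset _ _ i2_inj).
have Av1 : A \subset vertices D1.
  by apply/subsetP=> x xA; rewrite inE; apply: sc1 AD1 _; rewrite sub1set.
have Av2 : phi @: A \subset vertices D2.
  by apply/subsetP=> x xA; rewrite inE; apply: sc2 AD2 _; rewrite sub1set.
have map1 (B : {set T1}) : B \in D1 -> #|B| = k.+1 ->
    dtree k.+1 (edge_graph D) (g @: B) (g @: vertices D1).
  move=> BD Bk; apply: dtree_imset; first exact: tree1.
    by move=> x y _ _; apply: g_inj.
  by move=> x y _ _; apply: edge1.
have map2 (B : {set T2}) : B \in D2 -> #|B| = k.+1 ->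
    dtree k.+1 (edge_graph D) (i2 @: B) (i2 @: vertices D2).
  move=> BD Bk; apply: dtree_imset; first exact: tree2.
    by move=> x y _ _; apply: i2_inj.
  by move=> x y _ _; apply: edge2.
have phiAk : #|phi @: A| = k.+1 by rewrite card_in_imset.
move=> _ /DP[_ [[B BD ->]|[B BD ->]]]; rewrite card_imset // => Bk; rewrite vD.
  apply: (dtree_glue (map1 B BD Bk) (map2 _ AD2 phiAk)); rewrite -gA ?imsetS //.
  move=> w; rewrite in_setD => /andP[wA /imsetP[y yV wE]].
  have yA : y \notin phi @: A.
    by apply: contra wA => yA; rewrite wE gA // imset_f.
  rewrite wE; split.
    apply/imsetP=> -[x xV]; rewrite /g /glue; case: ifP => // xA [yE].
    by rewrite yE imset_f in yA.
  move=> x'; rewrite in_setD => /andP[x'A /imsetP[x xV xE]].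
  rewrite xE edge_graph_sym; apply: edge12 => //.
  by apply: contra x'A => xA; rewrite xE imset_f.
rewrite setUC; apply: (dtree_glue (map2 B BD Bk) (map1 _ AD1 Ak)).
  by rewrite gA ?imsetS.
move=> w; rewrite in_setD => /andP[wA /imsetP[x xV wE]].
have xA : x \notin A by apply: contra wA => xA; rewrite wE imset_f.
rewrite wE; split.
  by apply/imsetP=> -[y yV]; rewrite /g /glue (negPf xA).
move=> y'; rewrite in_setD => /andP[y'A /imsetP[y yV yE]].
rewrite yE; apply: edge12 => //.
by apply: contra y'A => yA; rewrite yE gA // imset_f.
Qed.

End Sum.

Lemma stacked_sphere_inv (T : finType) (D : {set {set T}}) :
  stacked_sphere_dim k D -> stacked_inv D.
Proof.
elim=> {T D} [T Q Qk|T1 T2 D1 D2 A phi _ inv1 _ inv2 A1 phi_inj A2|T T' D f _ inv inj].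
- exact: stacked_inv_simplex.
- have [AD1 Ak] := stacked_inv_facet inv1 A1.
  have [AD2 _] := stacked_inv_facet inv2 A2.
  exact: stacked_inv_sum.
exact: stacked_inv_iso.
Qed.

Lemma phi_stacked_sphere (T : finType) (D : {set {set T}}) :
    stacked_sphere_dim k D ->
  phi (edge_graph D) set0 (vertices D) = stacked_bound k.+1 #|vertices D|.
Proof.
move=> /stacked_sphere_inv[sc D0 le ext tree].
have := ext set0 set0 D0; rewrite cards0 => /(_ isT)[A AD [Ak _ _]].
have dt := tree A AD Ak; have AV := dtree_sub dt.
rewrite (phi_dtree (@edge_graph_sym _ D) dt) phi_clique; last 2 first.
- exact: edge_graph_sym.
- move=> x y xA yA xy; rewrite /edge_graph /= xy /=; apply: sc AD _.
  by apply/subsetP=> z /set2P[]->.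
by rewrite cardsD (setIidPr AV) natrB ?subset_leq_card // Ak.
Qed.

End Stacked.

(** * Homology in degrees 0 and -1 *)

Section Chains.

Variables (F : fieldType) (T : finType).
Implicit Types (s : seq {set T}) (c : chain T F) (A B K : {set T}) (x y : T).
Implicit Types (D G S : {set {set T}}).

Let fc A : chain T F := face_chain F A.

Lemma chain_sum c : c = \sum_A c A *: fc A.
Proof.
apply/ffunP=> B; rewrite sum_ffunE (bigD1 B) //= !ffunE eqxx /=.
rewrite big1 ?addr0 => [|A AB]; first by rewrite -[LHS]mulr1.
by rewrite !ffunE eq_sym (negPf AB) scaler0.
Qed.

Lemma mem_face_span s c :
  reflect (forall A, A \notin s -> c A = 0) (c \in <<[seq fc A | A <- s]>>%VS).
Proof.
apply: (iffP idP) => [cs A As|cs].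
  have -> : c = \sum_(i < size (in_tuple [seq fc A | A <- s]))
     coord (in_tuple [seq fc A | A <- s]) i c *: (in_tuple [seq fc A | A <- s])`_i.
    exact: coord_span.
  rewrite sum_ffunE big1 // => i _; rewrite !ffunE.
  have := mem_nth 0 (ltn_ord i); rewrite /= => /mapP[B Bs ->].
  by rewrite !ffunE; case: eqP => [E|_]; rewrite ?scaler0 //; rewrite E Bs in As.
rewrite (chain_sum c); apply: memv_suml => A _.
have [As|As] := boolP (A \in s); last by rewrite cs // scale0r mem0v.
by apply: memvZ; apply: memv_span; apply: map_f.
Qed.

Lemma dim_face_span s : uniq s -> \dim <<[seq fc A | A <- s]>>%VS = size s.
Proof.
move=> us; rewrite -(size_map fc s); apply/eqP; rewrite -/(free _).
elim: s us => [|A s IH] /=; first by rewrite nil_free.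
move=> /andP[As us]; rewrite free_cons IH // andbT; apply/negP => /mem_face_span/(_ A As).
by rewrite ffunE eqxx => /eqP; rewrite oner_eq0.
Qed.

Lemma chainsE (k : int) (n : nat) D : k + 1 = n%:Z ->
  chains F k D = <<[seq fc A | A <- enum D & #|A| == n]>>%VS.
Proof.
by move=> kn; rewrite /chains kn.
Qed.

Lemma mem_chains (k : int) (n : nat) D c : k + 1 = n%:Z ->
  reflect (forall A, ~~ ((A \in D) && (#|A| == n)) -> c A = 0) (c \in chains F k D).
Proof.
move=> kn; rewrite (chainsE D kn); apply: (iffP (mem_face_span _ _)) => h A nA.
  by apply: h; rewrite mem_filter mem_enum andbC.
by apply: h; move: nA; rewrite mem_filter mem_enum andbC.
Qed.

Lemma bdE c : bd T F c = \sum_A c A *: \sum_(x in A) face_sign F A x *: fc (A :\ x).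
Proof. by rewrite lfunE. Qed.

Lemma bd_face A : bd T F (fc A) = \sum_(x in A) face_sign F A x *: fc (A :\ x).
Proof.
rewrite bdE (bigD1 A) //= ffunE eqxx scale1r [X in _ + X]big1 ?addr0 // => B BA.
by rewrite ffunE (negPf BA) scale0r.
Qed.

Lemma bd_vertex x : bd T F (fc [set x]) = fc set0.
Proof.
rewrite bd_face big_set1 setDv /face_sign.
suff -> : [set y in [set x] | (enum_rank y < enum_rank x)%N] = set0.
  by rewrite cards0 expr0 scale1r.
by apply/setP=> y; rewrite !inE; case: eqP => //= ->; rewrite ltnn.
Qed.

Lemma bd_edge x y : x != y -> exists a : F, a != 0 /\
  bd T F (fc [set x; y]) = a *: (fc [set x] - fc [set y]).
Proof.
wlog lt : x y / (enum_rank x < enum_rank y)%N.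
  move=> h xy; have [lt|lt|E] := ltngtP (enum_rank x) (enum_rank y); first exact: h.
    rewrite eq_sym in xy; have [a [a0 E]] := h y x lt xy.
    by exists (- a); rewrite oppr_eq0 setUC E scaleNr -scalerN opprB.
  by case/eqP: xy; apply: enum_rank_inj; apply: val_inj.
move=> xy; exists (-1); rewrite oppr_eq0 oner_eq0; split=> //.
rewrite bd_face big_setU1 ?inE //= big_set1.
have -> : [set x; y] :\ x = [set y].
  by rewrite setU1K ?inE.
have -> : [set x; y] :\ y = [set x].
  by rewrite setUC setU1K ?inE // eq_sym.
have -> : face_sign F [set x; y] x = 1.
  rewrite /face_sign; suff -> : [set z in [set x; y] | (enum_rank z < enum_rank x)%N] = set0.
    by rewrite cards0 expr0.
  apply/setP=> z; rewrite !inE; apply/negbTE; rewrite negb_and.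
  have [->|/=] := eqVneq z x; first by rewrite ltnn orbT.
  by have [->|//] := eqVneq z y; rewrite -leqNgt ltnW.
have -> : face_sign F [set x; y] y = -1.
  rewrite /face_sign; suff -> : [set z in [set x; y] | (enum_rank z < enum_rank y)%N] = [set x].
    by rewrite cards1 expr1.
  apply/setP=> z; rewrite !inE; have [->|/=] := eqVneq z x; first by rewrite lt.
  by have [->|//] := eqVneq z y; rewrite ltnn.
by rewrite scale1r !scaleN1r opprB.
Qed.

Section Betti0.

Variables D G : {set {set T}}.
Hypotheses (D_sc : simplicial_complex D) (GD : G \subset D).
Let V := vertices D.
Let e := edge_graph D.

Let e_sym : symmetric e := @edge_graph_sym _ D.

Lemma mem_chains0 c (H : {set {set T}}) : reflect (forall A, ~~ ((A \in H) && (#|A| == 1%N)) -> c A = 0)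
   (c \in chains F 0 H).
Proof. exact: mem_chains. Qed.

Lemma chains0_sum c : c \in chains F 0 D -> c = \sum_(x in V) c [set x] *: fc [set x].
Proof.
move=> /mem_chains0 cD; apply/ffunP=> B; rewrite sum_ffunE.
have [/andP[BD /cards1P[y BE]]|nB] := boolP ((B \in D) && (#|B| == 1%N)).
  have yV : y \in V by rewrite inE -BE.
  rewrite (bigD1 y) //= !ffunE BE eqxx big1 => [|x /andP[_ xy]].
    by rewrite addr0 -[LHS]mulr1.
  by rewrite !ffunE (inj_eq set1_inj) eq_sym (negPf xy) scaler0.
rewrite cD // big1 // => x; rewrite inE => xD; rewrite !ffunE.
case: eqP => [E|_]; last by rewrite scaler0.
by rewrite E xD cards1 eqxx in nB.
Qed.

Lemma vertex_chain x (H : {set {set T}}) : [set x] \in H -> fc [set x] \in chains F 0 H.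
Proof.
move=> xH; apply/mem_chains0 => A; rewrite ffunE; case: (A =P [set x]) => // ->.
by rewrite xH cards1 eqxx.
Qed.

Lemma bd_chains0 c : c \in chains F 0 D ->
  bd T F c = (\sum_(x in V) c [set x]) *: fc set0.
Proof.
move=> cD; rewrite {1}(chains0_sum cD) linear_sum scaler_suml.
by apply: eq_bigr => x _; rewrite linearZ /= bd_vertex.
Qed.

Lemma edge_boundary x y : e x y ->
  fc [set x] - fc [set y] \in (bd T F @: chains F 1 D)%VS.
Proof.
move=> /andP[xy xyD]; have [a [a0 E]] := bd_edge xy.
have -> : fc [set x] - fc [set y] = bd T F (a^-1 *: fc [set x; y]).
  by rewrite linearZ /= E scalerA mulVf // scale1r.
apply/memv_img/memvZ; apply/(@mem_chains 1 2) => // A; rewrite ffunE.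
by case: (A =P [set x; y]) => // ->; rewrite xyD cards2 xy.
Qed.

Lemma connect_boundary x y W : connect (within e W) x y ->
  fc [set x] - fc [set y] \in (bd T F @: chains F 1 D)%VS.
Proof.
move=> /connectP[p]; elim: p x => [|z p IH] x /=; first by move=> _ ->; rewrite subrr mem0v.
move=> /andP[/and3P[_ _ exz] zp] yE.
rewrite -(subrKA (fc [set z])); apply: memvD; [exact: edge_boundary | exact: IH].
Qed.

(** Records, for each component in [S], the total coefficient of a 0-chain on it. The index [K] is a
    set of vertices, so the result can again be stored as a chain. *)
Definition comp_sums (S : {set {set T}}) (c : chain T F) : chain T F :=
  [ffun K : {set T} => if K \in S then \sum_(x in K) c [set x] else 0].

Lemma comp_sums_is_linear S : linear (comp_sums S).
Proof.
move=> a u v; apply/ffunP=> K; rewrite !ffunE; case: ifP => _; last by rewrite scaler0 addr0.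
by rewrite scaler_sumr -big_split /=; apply: eq_bigr => x _; rewrite !ffunE.
Qed.

HB.instance Definition _ S :=
  GRing.isLinear.Build F (chain T F) (chain T F) *:%R (comp_sums S) (comp_sums_is_linear S).

(** Modulo boundaries of edges the chain can be concentrated at one vertex per component, where its
    coefficient is zero or the vertex is in [G]. *)
Lemma mem_boundary0 c : c \in chains F 0 D ->
    (forall K, K \in comps e V -> exists2 r, r \in K &
       (\sum_(x in K) c [set x] == 0) || ([set r] \in G)) ->
  c \in rel_boundaries F 0 D G.
Proof.
move=> cD sumK; rewrite (chains0_sum cD).
have [V0|/set0Pn[x0 x0V]] := eqVneq V set0; first by rewrite V0 big_set0 mem0v.
pose rep K :=
  odflt x0 [pick r in K | (\sum_(x in K) c [set x] == 0) || ([set r] \in G)].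
have {}sumK K : K \in comps e V ->
    rep K \in K /\ (\sum_(x in K) c [set x] == 0) || ([set rep K] \in G).
  move=> /sumK[r rK rG]; rewrite /rep; case: pickP => [r' /andP[]//|/(_ r)].
  by rewrite rK rG.
have -> : \sum_(x in V) c [set x] *: fc [set x] =
    \sum_(x in V) c [set x] *: (fc [set x] - fc [set rep (component e V x)]) +
    \sum_(x in V) c [set x] *: fc [set rep (component e V x)].
  by rewrite -big_split /=; apply: eq_bigr => x _; rewrite -scalerDr subrK.
apply: memv_add.
  rewrite add0r; apply: memv_suml => x xV; apply: memvZ.
  apply: (@connect_boundary _ _ V).
  by have [+ _] := sumK _ (comp_comps e xV); rewrite inE => /andP[].
rewrite (partition_big (component e V) (mem (comps e V))) /= => [|x xV]; last exact: comp_comps.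
apply: memv_suml => K Kc.
have KE x : (x \in V) && (component e V x == K) = (x \in K).
  apply/andP/idP => [[xV /eqP<-]|xK]; first exact: mem_comp.
  have /(compsP e_sym)[_ /subsetP KV _ _] := Kc.
  split; first exact: KV.
  by rewrite (comps_eq e_sym (comp_comps e (KV _ xK)) Kc (mem_comp e (KV _ xK)) xK).
rewrite (eq_bigl _ _ KE).
rewrite (eq_bigr (fun x => c [set x] *: fc [set rep K])) => [|x xK]; last first.
  by move: xK; rewrite -KE => /andP[_ /eqP->].
rewrite -scaler_suml; have [_ /orP[/eqP->|rG]] := sumK K Kc; first by rewrite scale0r mem0v.
by apply: memvZ; apply: vertex_chain.
Qed.

Lemma comp_sum_bd K c : K \in comps e V -> c \in (bd T F @: chains F 1 D)%VS ->
  \sum_(x in K) c [set x] = 0.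
Proof.
move=> Kc; have /(compsP e_sym)[_ _ _ Kcl] := Kc.
rewrite (@chainsE 1 2) // limg_span => cB.
have {cB} : c \in lker (linfun (comp_sums [set K])).
  apply: (subvP _ c cB); apply/span_subvP=> w /mapP[w' /mapP[A + ->{w'}] ->{w}].
  rewrite mem_filter mem_enum => /andP[/cards2P[x [y [xy AE]]] AD].
  rewrite AE in AD *; rewrite memv_ker lfunE.
  have [a [_ ->]] := bd_edge xy; apply/eqP/ffunP=> K'; rewrite !ffunE.
  case: ifP => // /set1P->{K'}.
  have vert z : \sum_(w in K) fc [set z] [set w] = (z \in K)%:R :> F.
    have [zK|zK] := boolP (z \in K).
      rewrite (bigD1 z) //= ffunE eqxx big1 ?addr0 // => w /andP[_ wz].
      by rewrite ffunE (inj_eq set1_inj) (negPf wz).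
    rewrite big1 // => w wK; rewrite ffunE (inj_eq set1_inj).
    by case: eqP => // wz; rewrite -wz wK in zK.
  have [xV yV] : x \in V /\ y \in V.
    by rewrite !inE; split; apply: D_sc AD _; rewrite sub1set !inE eqxx ?orbT.
  have xyK : (x \in K) = (y \in K).
    have exy : e x y by rewrite /e /edge_graph /= xy.
    by apply/idP/idP => zK; apply: Kcl zK _ _ => //; rewrite e_sym.
  rewrite (eq_bigr (fun z => a * (fc [set x] [set z] - fc [set y] [set z]))) => [|z _].
    by rewrite -mulr_sumr sumrB !vert xyK subrr mulr0.
  by rewrite !ffunE.
rewrite memv_ker lfunE => /eqP/ffunP/(_ K); by rewrite !ffunE set11.
Qed.

Lemma bd1_chains0 c : c \in (bd T F @: chains F 1 D)%VS -> c \in chains F 0 D.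
Proof.
rewrite (@chainsE 1 2) // limg_span; apply: subvP; apply/span_subvP=> w.
move=> /mapP[w' /mapP[A + ->{w'}] ->{w}].
rewrite mem_filter mem_enum => /andP[/cards2P[x [y [xy AE]]] AD]; rewrite AE in AD *.
have [a [_ ->]] := bd_edge xy; apply: memvZ; apply: memvB; apply: vertex_chain;
  by apply: D_sc AD _; rewrite sub1set !inE eqxx ?orbT.
Qed.

Lemma rel_cycles0 : set0 \in G -> rel_cycles F 0 D G = chains F 0 D.
Proof.
move=> G0; apply/vspaceP=> c; rewrite memv_cap.
case: (boolP (c \in chains F 0 D)) => //= cD.
rewrite -memv_preim bd_chains0 //; apply: memvZ; apply/(@mem_chains (0 - 1) 0) => // A.
by rewrite ffunE; case: (A =P set0) => // ->; rewrite G0 cards0.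
Qed.

Lemma rel_boundaries0 : (rel_boundaries F 0 D G <= chains F 0 D)%VS.
Proof.
rewrite subv_add /rel_boundaries add0r; apply/andP; split.
  apply/subvP=> c; exact: bd1_chains0.
apply/subvP=> c /mem_chains0 cG; apply/mem_chains0 => A nA; apply: cG; apply: contra nA.
by move=> /andP[/(subsetP GD)-> ->].
Qed.

(** The empty face is in [G], so every 0-chain is a cycle. On components missing [G], [comp_sums] is
    onto with the relative boundaries as kernel. *)
Lemma betti0_rel : set0 \in G ->
  betti F 0 D G = #|[set K in comps e V | [disjoint K & vertices G]]|.
Proof.
move=> G0; set S := [set _ | _ & _]; rewrite /betti rel_cycles0 //.
have BE c : c \in chains F 0 D -> (c \in rel_boundaries F 0 D G) = (comp_sums S c == 0).
  move=> cD; apply/idP/eqP => [/memv_addP[c1 c1B [c2 c2G ->]]|c0].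
    rewrite add0r in c1B; apply/ffunP=> K; rewrite !ffunE; case: ifP => //.
    rewrite inE => /andP[Kc dK].
    rewrite (eq_bigr (fun x => c1 [set x] + c2 [set x])) => [|x _]; last by rewrite ffunE.
    rewrite big_split /= (comp_sum_bd Kc c1B) add0r big1 // => x xK.
    move/mem_chains0: c2G; apply; rewrite cards1 eqxx andbT.
    by have := disjointFr dK xK; rewrite inE => ->.
  apply: mem_boundary0 => // K Kc; have /(compsP e_sym)[/set0Pn[x xK] _ _ _] := Kc.
  have [dK|/meetP[r rK rG]] := boolP [disjoint K & vertices G].
    by exists x => //; move/ffunP/(_ K): c0; rewrite !ffunE inE Kc dK /= => ->; rewrite eqxx.
  by exists r => //; move: rG; rewrite inE => ->; rewrite orbT.
have E : (chains F 0 D :&: lker (linfun (comp_sums S)))%VS = rel_boundaries F 0 D G.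
  apply/vspaceP=> c; rewrite memv_cap memv_ker lfunE.
  by apply/andP/idP => [[cZ]|cB]; [rewrite BE | rewrite -BE ?(subvP rel_boundaries0)].
rewrite -(limg_ker_dim (linfun (comp_sums S)) (chains F 0 D)) E addKn.
have -> : (linfun (comp_sums S) @: chains F 0 D)%VS = <<[seq fc K | K <- enum S]>>%VS.
  apply/eqP; rewrite eqEsubv; apply/andP; split.
    apply/subvP=> _ /memv_imgP[c _ ->]; rewrite lfunE; apply/mem_face_span=> K.
    by rewrite mem_enum ffunE => /negPf->.
  apply/span_subvP=> w /mapP[K]; rewrite mem_enum => KS ->{w}.
  have Kc : K \in comps e V by move: KS; rewrite inE => /andP[].
  have /(compsP e_sym)[/set0Pn[x xK] /subsetP KV _ _] := Kc.
  apply/memv_imgP; exists (fc [set x]); first by apply: vertex_chain; move: (KV x xK); rewrite inE.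
  rewrite lfunE; apply/ffunP=> K'; rewrite !ffunE; case: ifP => [|K'S]; last first.
    by case: eqP => // KK'; rewrite -KK' K'S in KS.
  rewrite inE => /andP[K'c _]; have [->|nK] := eqVneq K' K.
    rewrite (bigD1 x) //= ffunE eqxx big1 ?addr0 // => w /andP[_ wx].
    by rewrite ffunE (inj_eq set1_inj) (negPf wx).
  rewrite big1 // => w wK'; rewrite ffunE (inj_eq set1_inj).
  by case: eqP => // wx; case/eqP: nK; apply: (comps_eq e_sym K'c Kc wK'); rewrite wx.
by rewrite dim_face_span ?enum_uniq // -cardE.
Qed.

(** The only generator in degree -1, the empty face, is killed in the quotient. *)
Lemma betti_pred_rel : set0 \in G -> betti F (- 1) D G = 0%N.
Proof.
move=> G0; apply/eqP; rewrite subn_eq0; apply: dimvS.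
apply/subvP=> c; rewrite memv_cap => /andP[cD _].
rewrite -[c]add0r; apply: memv_add; first exact: mem0v.
apply/(@mem_chains (- 1) 0) => // A nA; move/(@mem_chains (- 1) 0 D _ (erefl _)): cD; apply.
apply: contra nA => /andP[_ /eqP/cards0_eq ->]; by rewrite G0 cards0.
Qed.

End Betti0.

(* Compares (D, set0) with (D, [set set0]), whose homology in degree 0 is known:
   both have the same boundaries in degree 0, and the numbers of cycles differ
   by the rank of the augmentation. *)
Lemma betti_abs D G : simplicial_complex D -> set0 \in D -> G = set0 ->
  (betti F 0 D G)%:R - (betti F (- 1) D G)%:R =
    #|comps (edge_graph D) (vertices D)|%:R - 1 :> rat.
Proof.
move=> D_sc D0 ->; have s0D : [set set0] \subset D by rewrite sub1set.
have := betti0_rel D_sc s0D (set11 _).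
have -> : [set K in comps (edge_graph D) (vertices D) | [disjoint K & vertices [set set0]]] =
    comps (edge_graph D) (vertices D).
  apply/setP=> K; rewrite in_set -setI_eq0 (_ : vertices [set set0] = set0) ?setI0 ?eqxx ?andbT //.
  apply/setP=> x; rewrite inE in_set1 in_set0; apply/eqP=> /setP/(_ x).
  by rewrite in_set1 eqxx in_set0.
have noG k : chains F k (set0 : {set {set T}}) = 0%VS by rewrite /chains enum_set0 span_nil.
have bound0 := rel_boundaries0 D_sc s0D.
rewrite /betti rel_cycles0 ?set11 // /rel_cycles /rel_boundaries in bound0 *.
rewrite (@chainsE 0 1 [set set0]) // enum_set1 /= cards0 /= span_nil addv0 add0r in bound0 *.
rewrite !noG lpreim0 !addv0 addNr.
have cyc : (chains F (-1) D :&: lker (bd T F) = <[fc set0]>)%VS.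
  apply/vspaceP=> c; rewrite memv_cap memv_ker.
  apply/andP/vlineP => [[/(@mem_chains (-1) 0) cD _]|[a ->]].
    exists (c set0); apply/ffunP=> A; rewrite !ffunE; have [->|A0] := eqVneq A set0.
      by rewrite -[LHS]mulr1.
    by rewrite cD ?scaler0 // cards_eq0 (negPf A0) andbF.
  rewrite linearZ /= bd_face big_set0 scaler0; split=> //; apply: memvZ.
  by apply/(@mem_chains (-1) 0) => // A; rewrite ffunE; case: (A =P set0) => // ->; rewrite D0 cards0.
have BZ : (bd T F @: chains F 1 D <= chains F 0 D :&: lker (bd T F))%VS.
  rewrite subv_cap bound0 (@chainsE 1 2) // limg_span; apply/span_subvP=> w.
  move=> /mapP[w' /mapP[A + ->{w'}] ->{w}].
  rewrite mem_filter => /andP[/cards2P[x [y [xy ->]]] _]; have [a [_ ->]] := bd_edge xy.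
  by rewrite memv_ker linearZ linearB /= !bd_vertex subrr scaler0.
have r1 : (\dim (bd T F @: chains F 0 D) <= \dim <[fc set0]>)%N.
  by apply: dimvS; apply/subvP=> _ /memv_imgP[c cD ->]; rewrite (bd_chains0 cD) memvZ // memv_line.
have rk := limg_ker_dim (bd T F) (chains F 0 D).
have fc0 : fc set0 != 0.
  by apply/eqP=> /ffunP/(_ set0); rewrite !ffunE eqxx => /eqP; rewrite oner_eq0.
rewrite cyc !natrB // ?dimvS //; move: r1; rewrite dim_vline fc0 /= => r1.
rewrite -rk => <-; rewrite natrB ?natrD; last exact: leq_trans (dimvS BZ) (leq_addr _ _).
by ring.
Qed.

End Chains.

(** * Local inequalities *)

Section Sigma.

Variables (F : fieldType) (T : finType) (D G : {set {set T}}).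
Implicit Types (A B W : {set T}).

Lemma sigmaE (i : int) : sigma F i D G =
  \sum_(W : {set T} | W \subset vertices D)
     wt #|W| #|vertices D :\: W| * (betti F i (induced D W) (induced G W))%:R.
Proof.
rewrite /sigma mulr_sumr; apply: eq_big => [W|W]; first by rewrite powersetE.
by rewrite powersetE => WV; rewrite mulrA wt_bin ?subset_leq_card // cardsDS.
Qed.

Lemma induced_sc W : simplicial_complex D -> simplicial_complex (induced D W).
Proof.
move=> D_sc A B; rewrite !inE => /andP[AD AW] BA.
by rewrite (D_sc A) //= (subset_trans BA).
Qed.

Lemma vertices_induced W : W \subset vertices D -> vertices (induced D W) = W.
Proof.
move=> WV; apply/setP=> x; rewrite !inE sub1set andbC.
by case: (boolP (x \in W)) => //= /(subsetP WV); rewrite inE.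
Qed.

Lemma comps_induced W : comps (edge_graph (induced D W)) W = comps (edge_graph D) W.
Proof.
apply: eq_comps => x y xW yW xy; rewrite /edge_graph /= xy [_ \in induced _ _]inE /=.
by rewrite subUset !sub1set xW yW !andbT.
Qed.

Lemma sigma_abs : simplicial_complex D -> set0 \in D -> G = set0 ->
  sigma F 0 D G - sigma F (-1) D G = phi (edge_graph D) set0 (vertices D) - 1.
Proof.
move=> D_sc D0 G0; rewrite !sigmaE -sumrB /phi setD0 -[X in _ = _ - X](sum_wt1 (vertices D)).
rewrite -sumrB; apply: eq_bigr => W WV; rewrite -mulrBr betti_abs.
- by rewrite setU0 vertices_induced // comps_induced mulrBr mulr1.
- exact: induced_sc.
- by rewrite inE D0 sub0set.
by apply/setP=> A; rewrite G0 !inE.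
Qed.

Lemma sigma_pred_rel : set0 \in G -> sigma F (-1) D G = 0.
Proof.
move=> G0; rewrite sigmaE big1 // => W _; rewrite betti_pred_rel ?mulr0 //.
by rewrite inE G0 sub0set.
Qed.

Lemma sigma0_rel : simplicial_complex D -> G \subset D -> set0 \in G ->
  sigma F 0 D G = \sum_(W : {set T} | W \subset vertices D) wt #|W| #|vertices D :\: W| *
    #|[set K in comps (edge_graph D) W | [disjoint K & vertices G]]|%:R.
Proof.
move=> D_sc GD G0; rewrite sigmaE; apply: eq_bigr => W WV; rewrite betti0_rel.
- rewrite vertices_induced // comps_induced; congr (_ * (#|pred_of_set _|)%:R).
  apply/setP=> K; rewrite !in_set; case: (boolP (K \in _)) => //= KW.
  have KsW : K \subset W by case/imsetP: KW => x _ ->; apply/subsetP=> y; rewrite inE => /andP[].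
  congr (_ == _ :> nat); apply: eq_card => x; rewrite !inE sub1set.
  by case: (boolP (x \in K)) => //= /(subsetP KsW)->; rewrite andbT.
- exact: induced_sc.
- apply/subsetP=> A; rewrite !inE => /andP[AG ->]; rewrite andbT.
  exact: (subsetP GD).
by rewrite inE G0 sub0set.
Qed.

End Sigma.

Lemma stacked_sphere_le k (T : finType) (D : {set {set T}}) A :
  stacked_sphere_dim k D -> A \in D -> (#|A| <= k.+1)%N.
Proof.
move=> Dk; elim: Dk A => {T D} [T S Sk A|T1 T2 D1 D2 S f _ IH1 _ IH2 _ _ _ A|T T' D f _ IH _ A].
- by rewrite inE => /proper_card; rewrite Sk.
- rewrite inE in_setU => /andP[_ /orP[]] /imsetP[B];
    [move=> /IH1 le1 ->|move=> /IH2 le1 ->]; exact: leq_trans (leq_imset_card _ _) le1.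
by move=> /imsetP[B /IH le1 ->]; exact: leq_trans (leq_imset_card _ _) le1.
Qed.

Section Vertex.

Variables (T : finType) (d : nat) (D : {set {set T}}).
Hypotheses (d_ge3 : (3 <= d)%N) (D_npm : normal_pseudomanifold d D).
Variable v : T.
Implicit Types (A B F R W : {set T}) (x y : T).
Hypothesis vD : v \in vertices D.

Let L := link D [set v].
Let C := cone_off d v (link_cells d D v).
Let Cm : min_cycle d C := link_cycle D_npm vD.

Let D_sc : simplicial_complex D. Proof. by case: D_npm. Qed.

Let bL : link (boundary D) [set v] = boundary L := link_boundary D_npm vD.
Let bD_sc : simplicial_complex (boundary D) := boundary_sc D_npm.

Lemma notin_link A : A \in L -> v \notin A.
Proof. by rewrite (mem_link1 v A D_sc) => /andP[]. Qed.

Lemma boundary_link_sub : boundary L \subset L.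
Proof.
apply/subsetP=> A; rewrite -bL !mem_link1 //.
by case/andP=> -> /(subsetP (boundary_sub D_npm)).
Qed.

Lemma boundary_link_sc : simplicial_complex (boundary L).
Proof.
move=> A B; rewrite -bL !mem_link1; try exact: bD_sc.
move=> /andP[vA AD] BA; rewrite (contra (subsetP BA v) vA) /=.
by apply: (bD_sc AD); apply: setUS.
Qed.

Lemma set0_boundary_link : (set0 \in boundary L) = ([set v] \in boundary D).
Proof. by rewrite -bL mem_link1 ?inE ?setU0 //; exact: bD_sc. Qed.

Lemma boundary_link0 : [set v] \notin boundary D -> boundary L = set0.
Proof.
rewrite -set0_boundary_link => L0; apply/setP=> A; rewrite in_set0; apply: contraNF L0.
by move=> AB; apply: (boundary_link_sc AB); rewrite sub0set.
Qed.

Lemma cone_cells_base A : v \notin A -> (A \in C) = (A \in L) && (#|A| == d).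
Proof. by move=> vA; rewrite /C cone_off_base // inE. Qed.

Lemma boundary_link_ext A : A \in boundary L ->
  exists R, [/\ R \in boundary L, #|R|.+1 = d, A \subset R & v |: R \in C].
Proof.
rewrite -bL mem_link1; last exact: bD_sc.
move=> /andP[vA /(mem_boundary D_npm)[R [RD Rd Rc AR]]].
have vR : v \in R by apply: (subsetP AR); rewrite setU11.
have vS : v \notin R :\ v by rewrite !inE eqxx.
have Sd : #|R :\ v|.+1 = d by rewrite -Rd (cardsD1 v R) vR.
exists (R :\ v); split=> //.
- rewrite mem_link1; last exact: bD_sc.
  by rewrite vS setD1K //; apply/(mem_boundary D_npm); exists R.
- by rewrite subsetD1 vA (subset_trans (subsetUr _ _) AR).
rewrite /C cone_off_apex //; last by move=> F; rewrite inE => /andP[/notin_link].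
by rewrite bd2_link_cells // setD1K // Rc.
Qed.

Lemma cone_cells_apex F : F \in C -> v \in F -> F :\ v \in boundary L.
Proof.
move=> FC vF; have vS : v \notin F :\ v by rewrite !inE eqxx.
case/cone_offP: FC => [|[_ Fd]]; first by rewrite inE => /andP[/notin_link]; rewrite vF.
have Sd : #|F :\ v|.+1 = d by rewrite -Fd (cardsD1 v F) vF.
rewrite bd2_link_cells // setD1K // => /eqP cF.
rewrite -bL mem_link1; last exact: bD_sc.
rewrite vS setD1K //; apply/(mem_boundary D_npm); exists F; split=> //.
have /card_gt0P[x] : (0 < #|cofaces D F|)%N by rewrite cF.
by rewrite inE => /andP[_] /D_sc; apply; apply: subsetUr.
Qed.

Lemma cone_cells_link F : F \in C -> F :\ v \in L.
Proof.
move=> FC; have [vF|vF] := boolP (v \in F).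
  exact: (subsetP boundary_link_sub _ (cone_cells_apex FC vF)).
have : F \in C by []. 
rewrite cone_cells_base // => /andP[FL _].
by apply: (link_sc D_npm FL); apply: subsetDl.
Qed.

Lemma link_cone_cells A : A \in L -> exists2 F, F \in C & (A \subset F) && (v \notin F).
Proof.
move=> /(link_ext D_npm)[F FL /andP[Fd AF]]; exists F; last by rewrite AF notin_link.
by rewrite cone_cells_base ?FL // notin_link.
Qed.

Lemma notin_vertices_link : v \notin vertices L.
Proof. by rewrite inE; apply/negP => /notin_link; rewrite set11. Qed.

Lemma cell_graph_link : {in vertices L &, forall x y, x != y ->
  cell_graph C x y = edge_graph L x y}.
Proof.
move=> x y xL yL xy; have -> : edge_graph L x y = ([set x; y] \in L) by rewrite /edge_graph /= xy.
 apply/cell_graphP/idP => [[_ [F FC /andP[xF yF]]]|].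
  apply: (link_sc D_npm (cone_cells_link FC)).
  by rewrite subUset !sub1set !in_setD1 xF yF !andbT; apply/andP; split;
    apply: contraNneq notin_vertices_link => <-.
move=> /link_cone_cells[F FC /andP[]]; rewrite subUset !sub1set => xyF _.
by split=> //; exists F.
Qed.

Lemma cell_graph_apex : nbr (cell_graph C) v = vertices (boundary L).
Proof.
apply/setP=> y; rewrite inE [RHS]inE; apply/cell_graphP/idP => [[vy [F FC /andP[vF yF]]]|].
  apply: (boundary_link_sc (cone_cells_apex FC vF)).
  by rewrite sub1set in_setD1 yF eq_sym vy.
move=> yB; split.
  by have /notin_link := subsetP boundary_link_sub _ yB; rewrite in_set1.
have [R [_ _ yR RC]] := boundary_link_ext yB; exists (v |: R) => //.
by rewrite setU11 in_setU1; move: yR; rewrite sub1set => ->; rewrite orbT.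
Qed.

Lemma vertices_boundary_link : vertices (boundary L) \subset vertices L.
Proof. by apply/subsetP=> x; rewrite !(in_set (fun x => _)); apply: (subsetP boundary_link_sub). Qed.

Lemma cover_cone_interior : [set v] \notin boundary D -> cover C = vertices L.
Proof.
move=> vB; apply/setP=> x; rewrite [RHS]inE; apply/bigcupP/idP => [[F FC xF]|].
  have vF : v \notin F.
    by apply/negP => /(cone_cells_apex FC); rewrite boundary_link0 // inE.
  apply: (link_sc D_npm (cone_cells_link FC)); rewrite sub1set in_setD1 xF andbT.
  by apply: contraNneq vF => <-.
move=> /link_cone_cells[F FC /andP[xF _]]; exists F => //; by rewrite -sub1set.
Qed.

Lemma subcells_cone_interior : [set v] \notin boundary D -> subcells C = L.
Proof.
move=> vB; apply/setP=> A; apply/subcellsP/idP => [[F FC AF]|].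
  have vF : v \notin F.
    by apply/negP => /(cone_cells_apex FC); rewrite boundary_link0 // inE.
  apply: (link_sc D_npm (cone_cells_link FC)); rewrite subsetD1 AF.
  by apply: contra vF; apply: subsetP.
by move=> /link_cone_cells[F FC /andP[AF _]]; exists F.
Qed.

Lemma cover_cone_boundary : [set v] \in boundary D -> cover C = v |: vertices L.
Proof.
move=> vB; apply/setP=> x; rewrite in_setU1 [x \in vertices L]inE.
apply/bigcupP/orP => [[F FC xF]|[/eqP->|]].
- have [->|xv] := eqVneq x v; [by left|right].
  by apply: (link_sc D_npm (cone_cells_link FC)); rewrite sub1set in_setD1 xv.
- move: vB; rewrite -set0_boundary_link => /boundary_link_ext[R [_ _ _ RC]].
  by exists (v |: R); rewrite ?setU11.
by move=> /link_cone_cells[F FC /andP[xF _]]; exists F => //; rewrite -sub1set.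
Qed.

Lemma phi_link_interior : [set v] \notin boundary D ->
  phi (edge_graph L) set0 (vertices L) = phi (cell_graph C) set0 (cover C).
Proof.
move=> vB; rewrite cover_cone_interior //; apply: eq_phi; first exact: sub0set.
by move=> x y xL yL xy; rewrite cell_graph_link.
Qed.

Lemma phi_link_interior_le : [set v] \notin boundary D ->
  phi (edge_graph L) set0 (vertices L) <= stacked_bound d #|vertices L|.
Proof.
move=> vB; rewrite phi_link_interior // -(cover_cone_interior vB).
exact: phi_min_cycle_le.
Qed.

(** One direction decomposes the cycle into stacked pieces, the other evaluates [phi] along a tree
    of cliques. *)
Lemma phi_link_interior_eq : [set v] \notin boundary D ->
  phi (edge_graph L) set0 (vertices L) = stacked_bound d #|vertices L|
  <-> stacked_sphere L.
Proof.
move=> vB; split=> [|[k Lk]].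
  rewrite phi_link_interior // -(cover_cone_interior vB) => /(min_cycle_stacked d_ge3 Cm).
  by rewrite subcells_cone_interior //; exists d.-1.
(* The dimension [k] in [stacked_sphere] is existential; comparing facet cardinalities gives
   [d = k.+1]. *)
have [F FL /andP[/eqP Fd _]] := link_ext D_npm (set0_link D_npm vD).
have dk : (d <= k.+1)%N by rewrite -Fd; apply: stacked_sphere_le FL.
have k2 : (1 < k)%N by rewrite -ltnS; apply: leq_trans d_ge3 dk.
have [_ L0 _ ext _] := stacked_sphere_inv k2 Lk.
have [|G GL [Gk _ _]] := ext set0 set0 L0; first by rewrite cards0.
have -> : d = k.+1 by apply/eqP; rewrite eqn_leq dk -Gk /= (link_le D_npm GL).
exact: phi_stacked_sphere.
Qed.

(** The component of the apex swallows the components of [W] meeting the boundary of the link; it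
    accounts for the subtracted 1. *)
Lemma sigma_link_boundary (F : fieldType) : [set v] \in boundary D ->
  sigma F 0 L (boundary L) = phi (cell_graph C) [set v] (v |: vertices L) - 1.
Proof.
move=> vB; rewrite sigma0_rel; first last.
- by rewrite set0_boundary_link.
- exact: boundary_link_sub.
- exact: (link_sc D_npm (v := v)).
rewrite /phi setU1K ?notin_vertices_link // -[X in _ = _ - X](sum_wt1 (vertices L)) -sumrB.
apply: eq_bigr => W WL; rewrite -[X in _ = _ - X]mulr1 -mulrBr; congr (_ * _).
have vW : v \notin W by apply: contra notin_vertices_link; apply: (subsetP WL).
have <- : comps (cell_graph C) W = comps (edge_graph L) W.
  apply: eq_comps => x y xW yW xy; apply: cell_graph_link => //; exact: (subsetP WL).
have := card_comps_setU1 (@cell_graph_sym _ C) vW.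
rewrite cell_graph_apex (card_comps_meet _ (vertices (boundary L)) W) [W :|: _]setUC.
move=> E; apply/eqP; rewrite eq_sym subr_eq natr1; apply/eqP; congr (_%:R).
by move: E; move: (kappa _ _ _) #|_| #|_| => k a b; lia.
Qed.

(** The growth starts from the apex with the boundary vertices of the link: they contain a cell, and
    the apex is adjacent to all of them, so [phi] is 1 there. *)
Lemma sigma_link_boundary_le (F : fieldType) : [set v] \in boundary D ->
  sigma F 0 L (boundary L) <= wt 1 d * #|vertices L :\: vertices (boundary L)|%:R.
Proof.
move=> vB; rewrite sigma_link_boundary // lerBlDl.
have [R [RB Rd _ RC]] := boundary_link_ext (etrans set0_boundary_link vB).
have RU : v |: R \subset v |: vertices (boundary L).
  apply: setUS; apply/subsetP=> x xR; rewrite inE; apply: (boundary_link_sc RB).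
  by rewrite sub1set.
have R1 : (#|[set v]| <= 1)%N by rewrite cards1.
have [_ + _] := extends_cycle d_ge3 R1 (@cell_graph_sym _ C) Cm (@cell_graph_complete _ C)
  (subsetUl [set v] (vertices (boundary L))) RC RU.
have -> : (v |: vertices (boundary L)) :|: cover C = v |: vertices L.
  by rewrite cover_cone_boundary // -setUUr (setUidPr vertices_boundary_link).
rewrite (phi_hub (V := v |: vertices (boundary L))) ?setU11 //; last 2 first.
- exact: cell_graph_sym.
- move=> x; rewrite in_setU1 => /predU1P[->|]; first by rewrite eqxx.
  by rewrite -cell_graph_apex inE.
suff -> : (v |: vertices L) :\: (v |: vertices (boundary L)) =
  vertices L :\: vertices (boundary L) by [].
apply/setP=> x; rewrite !in_setD !in_setU1; case: (x =P v) => //= ->.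
by rewrite (negPf notin_vertices_link) andbF.
Qed.

End Vertex.

(** * Summation over the vertices *)

Section Counting.

Variable T : finType.
Implicit Types (D G : {set {set T}}) (A : {set T}).

Lemma mem_vertices D x : (x \in vertices D) = ([set x] \in D).
Proof. by rewrite inE. Qed.

Lemma f_numE D G n : f_num D G (n%:Z - 1) = #|[set A in D :\: G | #|A| == n]|.
Proof. by apply: eq_card => A; rewrite !inE subrK eqz_nat. Qed.

Lemma f_num0 D G : f_num D G 0 = #|vertices D :\: vertices G|.
Proof.
rewrite -[0 : int](subrr 1) (f_numE D G 1) -(card_imset _ (@set1_inj T)).
apply: eq_card => A; rewrite inE; apply/andP/imsetP => [[ADG /cards1P[x AE]]|[x]].
  by exists x => //; rewrite AE in ADG; move: ADG; rewrite !inE.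
by rewrite !inE => xDG ->; rewrite cards1.
Qed.

(** Both sides count pairs of a relative edge and one of its ends. *)
Lemma sum_f_num_link D G : simplicial_complex D -> simplicial_complex G ->
  (\sum_(v in vertices D) f_num (link D [set v]) (link G [set v]) 0 = 2 * f_num D G 1)%N.
Proof.
move=> D_sc G_sc; rewrite -[1 : int](addrK 1) (f_numE D G 2).
set E := [set A in _ | _]; have E2 A : A \in E -> #|A| = 2 by rewrite inE => /andP[_ /eqP].
rewrite mulnC -sum_nat_const -(eq_bigr _ E2).
under [RHS]eq_bigr do rewrite -sum1_card.
rewrite (exchange_big_dep (mem (vertices D))) /= => [|A v]; last first.
  by rewrite !inE => /andP[/andP[_ AD] _] vA; apply: D_sc AD _; rewrite sub1set.
apply: eq_bigr => v vD; rewrite f_num0 sum1dep_card.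
have vx x : (x \in vertices (link D [set v]) :\: vertices (link G [set v])) =
    (x != v) && (v |: [set x] \in D :\: G).
  rewrite in_setD !mem_vertices !mem_link1 // in_set1 in_setD [v == x]eq_sym.
  by case: (x != v).
rewrite -(card_in_imset (f := fun x => v |: [set x])) => [|x y]; last first.
  rewrite !vx => /andP[xv _] /andP[yv _] /setP/(_ x).
  by rewrite !inE eqxx (negPf xv) orbT => /esym/eqP.
apply: eq_card => A; apply/imsetP/idP => [[x]|].
  by rewrite vx => /andP[xv xDG] ->; rewrite in_set [_ \in E]in_set xDG cards2 [v == x]eq_sym xv setU11.
rewrite in_set => /andP[AE vA]; have /eqP := E2 A AE.
rewrite (cardsD1 v) vA add1n eqSS => /cards1P[x AvE].
have AE' : A = v |: [set x] by rewrite -AvE setD1K.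
have : x \in A :\ v by rewrite AvE set11.
rewrite in_setD1 => /andP[xv _]; exists x => //; rewrite vx xv -AE'.
by move: AE; rewrite in_set => /andP[].
Qed.

End Counting.

Section Main.

Variables (F : fieldType) (T : finType) (d : nat) (D : {set {set T}}).
Hypotheses (d_ge3 : (3 <= d)%N) (D_npm : normal_pseudomanifold d D)
  (bdD_neq0 : boundary D != set0).

Let D_sc : simplicial_complex D. Proof. by case: D_npm. Qed.
Let bD_sc : simplicial_complex (boundary D) := boundary_sc D_npm.

Lemma rank_rel : rank (rel_faces D (boundary D)) = d.+1.
Proof.
have [_ rk _ _ _] := D_npm; apply/eqP; rewrite eqn_leq; apply/andP; split.
  by apply/bigmax_leqP => A; rewrite inE => /andP[_]; apply: (npm_le D_npm).
have [A0 A0B] := set0Pn _ bdD_neq0.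
have [A AD /andP[/eqP Ad _]] := npm_ext D_npm (subsetP (boundary_sub D_npm) _ A0B).
rewrite -Ad; apply: leq_bigmax_cond; rewrite inE AD andbT.
apply/negP => /(mem_boundary D_npm)[R [_ Rd _ AR]].
by have := subset_leq_card AR; rewrite Ad Rd ltnn.
Qed.

(** A nonempty boundary contains the empty face, which is therefore not a relative face. *)
Lemma f_num_pred : f_num D (boundary D) (-1) = 0%N.
Proof.
rewrite -[-1]add0r (f_numE D (boundary D) 0); apply/eqP; rewrite cards_eq0; apply/eqP/setP=> A.
rewrite [RHS]in_set0 in_set in_setD; apply/negP => /andP[/andP[AB _]].
rewrite cards_eq0 => /eqP A0; move: AB; have [B BD] := set0Pn _ bdD_neq0.
by rewrite (bD_sc BD) // A0 sub0set.
Qed.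

(** With [f_(-1) = 0] one has [h_1 = f_0] and [h_2 = f_1 - d f_0]. *)
Lemma g_num2 : g_num D (boundary D) 2 =
  (f_num D (boundary D) 1)%:Z - d.+1%:Z * (f_num D (boundary D) 0)%:Z.
Proof.
rewrite /g_num /h_num rank_rel !big_ord_recl !big_ord0 /=.
rewrite !sub0r f_num_pred !mulr0 !add0r.
rewrite (_ : bump 0 0 = 1%N) // (_ : bump 0 1 = 2%N) // subrr.
rewrite (_ : (2 : nat)%:Z - 1 = 1) // !subSS !subn0 !subn1 /=.
have -> : 'C(d, d.-1) = d by rewrite -{1}(prednK (ltnW (ltnW d_ge3))) binSn prednK // ltnW // ltnW.
by rewrite !binn !expr0 expr1 [d.+1%:Z]intS; ring.
Qed.

Lemma mu_sub : mu F 1 D (boundary D) - mu F 0 D (boundary D) =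
  \sum_(v in vertices D) (sigma F 0 (link D [set v]) (boundary (link D [set v]))
    - sigma F (-1) (link D [set v]) (boundary (link D [set v]))).
Proof.
rewrite /mu subrr sub0r -sumrB; apply: eq_bigr => v vD.
by rewrite (link_boundary D_npm vD).
Qed.

Let c : rat := 'C(d + 2, 2)%:R.

Lemma binom_wt : c * wt 1 d = 2^-1.
Proof.
rewrite /c wt1E addn2; have := mul_bin_diag d.+2 1; rewrite bin1 /= => E.
have -> : (d.+1 * d.+2)%N = (2 * 'C(d.+2, 2))%N by rewrite mulnC E.
by rewrite natrM invfM mulrCA mulfV ?mulr1 // pnatr_eq0 gtn_eqF ?bin_gt0.
Qed.

Let c_gt0 : 0 < c. Proof. by rewrite ltr0n bin_gt0 addn2. Qed.

Let term v := sigma F 0 (link D [set v]) (boundary (link D [set v]))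
    - sigma F (-1) (link D [set v]) (boundary (link D [set v])).
Let n v := f_num (link D [set v]) (boundary (link D [set v])) 0.
(** The contribution of [v] to [g_2]: half of each relative edge at [v], and [- (d + 1)] if [v] is
    itself a relative vertex. *)
Let bound v : rat := 2^-1 * (n v)%:R - d.+1%:R * ([set v] \notin boundary D)%:R.

Lemma sum_bound : \sum_(v in vertices D) bound v = (g_num D (boundary D) 2)%:~R.
Proof.
rewrite sumrB -!mulr_sumr -!natr_sum g_num2.
have -> : (\sum_(v in vertices D) n v = 2 * f_num D (boundary D) 1)%N.
  rewrite -(sum_f_num_link D_sc bD_sc); apply: eq_bigr => v vD.
  by rewrite (link_boundary D_npm vD).
have -> : (\sum_(v in vertices D) ([set v] \notin boundary D) = f_num D (boundary D) 0)%N.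
  rewrite f_num0 -sum1_card big_mkcond [RHS]big_mkcond; apply: eq_bigr => v _.
  rewrite in_setD [_ \in vertices (boundary D)]in_set andbC.
  by case: (v \in _) => //=; case: (_ \notin _).
by rewrite natrM mulKf // rmorphB rmorphM /=.
Qed.

Lemma term_interior v : v \in vertices D -> [set v] \notin boundary D ->
  term v = phi (edge_graph (link D [set v])) set0 (vertices (link D [set v])) - 1
  /\ bound v = c * (stacked_bound d #|vertices (link D [set v])| - 1).
Proof.
move=> vD vB; have L0 := boundary_link0 D_npm vD vB; split.
  by apply: sigma_abs; [exact: (link_sc D_npm (v := v)) | exact: (set0_link D_npm vD)|].
rewrite /bound /n vB mulr1 f_num0 L0.
have -> : vertices (set0 : {set {set T}}) = set0 by apply/setP=> x; rewrite !inE.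
rewrite setD0 /stacked_bound; set m := #|_|.
(* The base term of [stacked_bound] and the [- d] in its slope add up to [- (d + 2) / 2 - d / 2],
   which is the [- (d + 1)] of [bound]. *)
have c1 : c * d.+1%:R^-1 = 2^-1 * d.+2%:R.
  by rewrite -binom_wt wt1E natrM invfM -!mulrA mulVf ?mulr1 // pnatr_eq0.
have -> : c * (1 - d.+1%:R^-1 + wt 1 d * (m%:R - d%:R) - 1) =
  c * wt 1 d * (m%:R - d%:R) - c * d.+1%:R^-1 by ring.
by rewrite binom_wt c1 -[d.+2%:R]natr1 -[d.+1%:R]natr1; lra.
Qed.

Lemma term_boundary v : v \in vertices D -> [set v] \in boundary D ->
  term v = sigma F 0 (link D [set v]) (boundary (link D [set v]))
  /\ bound v = 2^-1 * (n v)%:R.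
Proof.
move=> vD vB; rewrite /term /bound vB mulr0 subr0 sigma_pred_rel ?subr0 //.
by rewrite (set0_boundary_link D_npm vD).
Qed.

Lemma term_le v : v \in vertices D -> c * term v <= bound v.
Proof.
move=> vD; have [vB|vB] := boolP ([set v] \in boundary D).
  have [-> ->] := term_boundary vD vB.
  have -> : 2^-1 * (n v)%:R = c * (wt 1 d * (n v)%:R) by rewrite mulrA binom_wt.
  by rewrite ler_pM2l // /n f_num0 sigma_link_boundary_le.
have [-> ->] := term_interior vD vB.
by rewrite ler_pM2l // lerD2r phi_link_interior_le.
Qed.

Lemma term_eq_interior v : v \in vertices D -> [set v] \notin boundary D ->
  c * term v = bound v <-> stacked_sphere (link D [set v]).
Proof.
move=> vD vB; rewrite -(phi_link_interior_eq d_ge3 D_npm vD vB).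
have [-> ->] := term_interior vD vB.
split=> [/(mulfI (lt0r_neq0 c_gt0))/addIr //|-> //].
Qed.

End Main.

Theorem theorem7p3 (F : fieldType) (T : finType) (d : nat)
    (D : {set {set T}}) (d_ge3 : (3 <= d)%N)
    (D_npm : normal_pseudomanifold d D) (bdD_neq0 : boundary D != set0) :
  (g_num D (boundary D) 2)%:~R >=
    'C(d + 2, 2)%:R * (mu F 1 D (boundary D) - mu F 0 D (boundary D)) :> rat
  /\
  ((g_num D (boundary D) 2)%:~R =
     'C(d + 2, 2)%:R * (mu F 1 D (boundary D) - mu F 0 D (boundary D)) :> rat
   <->
   (forall v : T, [set v] \in boundary D ->
      'C(d + 2, 2)%:R *
        sigma F 0 (link D [set v]) (boundary (link D [set v])) =
      2%:R^-1 *
        (f_num (link D [set v]) (boundary (link D [set v])) 0)%:R :> rat)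
   /\
   (forall v : T, v \in vertices D -> [set v] \notin boundary D ->
      stacked_sphere (link D [set v]))).
Proof.
rewrite (mu_sub F D_npm) mulr_sumr -(sum_bound d_ge3 D_npm bdD_neq0).
have le v vD := term_le F d_ge3 D_npm (v := v) vD.
split; first exact: ler_sum.
have vert v : [set v] \in boundary D -> v \in vertices D.
  by move=> vB; rewrite inE (subsetP (boundary_sub D_npm)).
split=> [E|[bdry int]].
  (* Equality of the sums forces equality at every vertex, because the local inequalities all point
     the same way. *)
  have eq v vD := eq_sum_le le (esym E) (i := v) vD.
  split=> v vD => [|vB]; last exact/(term_eq_interior F d_ge3 D_npm vD vB)/eq.
  have [<- <-] := term_boundary F D_npm (vert v vD) vD.
  exact/eq/vert.
apply: eq_bigr => v vD; have /orP[vB|vB] := orbN ([set v] \in boundary D); last first.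
  exact/esym/(term_eq_interior F d_ge3 D_npm vD vB)/int.
by have [E1 E2] := term_boundary F D_npm vD vB; rewrite E1 E2; apply/esym/bdry.
Qed.
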